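(* Let $\Omega\subset\mathbb R^d$ be a bounded domain with continuous boundary, let $a\in(-(d-1)^{-1},1)$, and let $M_1(a)\le M_2(a)\le\cdots$ be the eigenvalues of the biharmonic Neumann problem on $\Omega$ with Poisson ratio $a$. For $k\ge1$ put $$m_k=C_d^2\left(\frac k{|\Omega|}\right)^{4/d},\qquad S_k(a)=\frac{\frac{d+4}d\,\frac1k\sum_{j=1}^kM_j(a)}{m_k}.$$ Then for all integers $k\ge1$ the Neumann eigenvalue $M_{k+1}(a)$ satisfies $$m_k(1-S_k(a))\ge\left(\sqrt{M_{k+1}(a)}-\sqrt{m_k}\right)^2,$$ or equivalently $$m_k\left(1-\sqrt{1-S_k(a)}\right)^2\le M_{k+1}(a)\le m_k\left(1+\sqrt{1-S_k(a)}\right)^2.$$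
   Context: $B_d=\pi^{d/2}/\Gamma(1+d/2)$ is the volume of the unit ball of $\mathbb R^d$ and $C_d=(2\pi)^2B_d^{-2/d}$. The biharmonic Neumann eigenvalues are those of the quadratic form $Q(u,v)=\int_\Omega(1-a)D^2u:D^2v+a\Delta u\Delta v$ on $H^2(\Omega)$, where $D^2u:D^2v=\sum_{\alpha,\beta}\partial^2_{\alpha\beta}u\,\partial^2_{\alpha\beta}v$; explicitly $$M_j(a)=\min_{\substack{V\subset H^2(\Omega)\\ \dim V=j}}\max_{u\in V\setminus\{0\}}\frac{\int_\Omega(1-a)|D^2u|^2+a(\Delta u)^2}{\int_\Omega u^2}.$$ *)

(* Defs.v *)
From HB Require Import structures.
From mathcomp Require Import all_boot all_order all_algebra.
From mathcomp Require Import all_classical all_reals all_analysis.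
From mathcomp Require Import measurable_realfun.

Set Implicit Arguments.
Unset Strict Implicit.
Unset Printing Implicit Defensive.

Import Order.TTheory GRing.Theory Num.Theory.
Import numFieldNormedType.Exports.

Local Open Scope classical_set_scope.
Local Open Scope ring_scope.

(* R^d is 'rV[R]_d with its Borel sigma-algebra. *)
HB.instance Definition _ (R : realType) (m n : nat) :=
  @isMeasurable.Build default_measure_display 'M[R]_(m, n)
    <<s [set A : set 'M[R]_(m, n) | open A] >>
    (@sigma_algebra0 _ _ _) (@sigma_algebraC _ _) (@sigma_algebra_bigcup _ _ _).

Section BorelRow.
Context {R : realType}.

Definition cons_rV n (p : measurableTypeR R * 'rV[R]_n) : 'rV[R]_n.+1 :=
  row_mx (const_mx (p.1 : R) : 'rV[R]_1) p.2.

Definition uncons_rV n (v : 'rV[R]_n.+1) : measurableTypeR R * 'rV[R]_n :=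
  (v ord0 ord0, \row_i v ord0 (lift ord0 i)).

Lemma cons_rV0 n (p : measurableTypeR R * 'rV[R]_n) :
  cons_rV p ord0 ord0 = p.1.
Proof.
rewrite /cons_rV (_ : ord0 = lshift n (ord0 : 'I_1)); last exact/val_inj.
by rewrite (row_mxEl (const_mx (p.1 : R) : 'rV[R]_1)) mxE.
Qed.

Lemma cons_rVS n (p : measurableTypeR R * 'rV[R]_n) (i : 'I_n) :
  cons_rV p ord0 (lift ord0 i) = p.2 ord0 i.
Proof.
rewrite /cons_rV (_ : lift ord0 i = rshift 1 i); last exact/val_inj.
by rewrite (row_mxEr (const_mx (p.1 : R) : 'rV[R]_1)).
Qed.

Lemma cons_rVK n : cancel (@cons_rV n) (@uncons_rV n).
Proof.
move=> [t v]; rewrite /uncons_rV cons_rV0; congr (_, _).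
by apply/rowP => i; rewrite mxE cons_rVS.
Qed.

Lemma uncons_rVK n : cancel (@uncons_rV n) (@cons_rV n).
Proof.
move=> v; apply/rowP => i; have [j ->|->] := unliftP ord0 i.
  by rewrite cons_rVS mxE.
by rewrite cons_rV0.
Qed.

Lemma open_measurable_rV n (U : set 'rV[R]_n) : open U -> measurable U.
Proof. by move=> oU; exact: sub_sigma_algebra. Qed.

Lemma open_rat_balls n (U : set 'rV[R]_n) : open U ->
  U = \bigcup_(p in [set p : 'rV[rat]_n * nat |
        ball (map_mx ratr p.1 : 'rV[R]_n) (p.2.+1%:R^-1 : R) `<=` U])
      ball (map_mx ratr p.1 : 'rV[R]_n) (p.2.+1%:R^-1 : R).
Proof.
move=> oU; apply/seteqP; split=> [x Ux|x [p pU]]; last exact: pU.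
have /nbhs_ballP[e /= e0 xeU] : nbhs x U by exact: open_nbhs_nbhs.
pose k := Num.truncn (2 / e).
have kP : (k.+1%:R^-1 : R) < e / 2.
  rewrite -[ltRHS]invrK ltf_pV2 ?posrE ?invr_gt0 ?divr_gt0// invf_div.
  by rewrite truncnS_gt.
have k0 : 0 < (k.+1%:R^-1 : R) by rewrite invr_gt0.
have qP i : {q : rat | ratr q \in `](x ord0 i - k.+1%:R^-1), (x ord0 i + k.+1%:R^-1)[}.
  apply: cid; apply: rat_in_itvoo.
  by rewrite ltrBlDr -addrA ltrDl addr_gt0.
pose q : 'rV[rat]_n := \row_i sval (qP i).
have qx i : `|(ratr (q ord0 i) : R) - x ord0 i| < k.+1%:R^-1.
  rewrite mxE; case: (qP i) => r /=; rewrite in_itv /= => rP.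
  by rewrite ltr_distl.
have xq : ball (map_mx ratr q : 'rV[R]_n) (k.+1%:R^-1) x.
  split=> // i j; rewrite (ord1 i) mxE; exact: qx.
exists (q, k) => //= y qy; apply: xeU.
rewrite (splitr e); apply: (@ball_triangle _ _ (map_mx ratr q : 'rV[R]_n)).
  by apply: ball_sym; apply: le_ball xq; exact: ltW.
by apply: le_ball qy; exact: ltW.
Qed.

Lemma measurable_cons_rV n : measurable_fun setT (@cons_rV n).
Proof.
apply: (measurability (D := setT) (f := @cons_rV n)
  [set A : set 'rV[R]_n.+1 | open A] erefl) => _ [U oU <-].
rewrite setTI (open_rat_balls oU) preimage_bigcup.
rewrite bigcup_mkcond.
pose F (m : nat) : set (measurableTypeR R * 'rV[R]_n) :=
  if @unpickle ('rV[rat]_n.+1 * nat)%type m is Some p then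
    if p \in [set p : 'rV[rat]_n.+1 * nat |
        ball (map_mx ratr p.1 : 'rV[R]_n.+1) (p.2.+1%:R^-1 : R) `<=` U]
    then @cons_rV n @^-1` ball (map_mx ratr p.1 : 'rV[R]_n.+1) (p.2.+1%:R^-1 : R)
    else set0
  else set0.
rewrite [X in measurable X](_ : _ = \bigcup_m F m); last first.
  apply/seteqP; split=> [x [p _ px]|x [m _]].
    by exists (pickle p) => //; rewrite /F pickleK.
  by rewrite /F; case: unpickle => // p px; exists p.
apply: bigcupT_measurable => m; rewrite /F.
case: unpickle => // p; case: ifP => // _.
set c := map_mx _ _; set e := _^-1.
have e0 : 0 < e by rewrite invr_gt0.
rewrite (_ : _ @^-1` _ = (ball (c ord0 ord0) e : set (measurableTypeR R)) `*`
  ball (\row_i c ord0 (lift ord0 i)) e); last first.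
  apply/seteqP; split=> -[t v] /=.
    move=> [_ H]; split.
      by have := H ord0 ord0; rewrite cons_rV0.
    by split=> // i j; rewrite (ord1 i) mxE; have := H ord0 (lift ord0 j);
      rewrite cons_rVS.
  move=> [ht [_ hv]]; split=> // i j; rewrite (ord1 i).
  have [j' ->|->] := unliftP ord0 j.
    by have := hv ord0 j'; rewrite cons_rVS mxE.
  by rewrite cons_rV0.
apply: measurableX; first by apply: open_measurable; exact: ball_open.
by apply: open_measurable_rV; exact: ball_open.
Qed.

Lemma measurable_uncons_rV n : measurable_fun setT (@uncons_rV n).
Proof.
have m1 : measurable_fun setT
    (fun v : 'rV[R]_n.+1 => v ord0 ord0 : measurableTypeR R).
  refine (@measurability default_measure_display _ 'rV[R]_n.+1 (measurableTypeR R) setT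
    (fun v : 'rV[R]_n.+1 => v ord0 ord0) (@RGenOpens.G R)
    (RGenOpens.measurableE R) _).
  move=> _ [U [x [y ->]] <-]; rewrite setTI.
  apply: open_measurable_rV; apply: open_comp; last exact: interval_open.
  by move=> v _; exact: coord_continuous.
apply: (measurable_fun_pair m1).
apply: (measurability (D := setT)
  (f := fun v : 'rV[R]_n.+1 => \row_i v ord0 (lift ord0 i))
  [set A : set 'rV[R]_n | open A] erefl) => _ [U oU <-].
rewrite setTI; apply: open_measurable_rV.
apply: open_comp oU => v _ A /nbhs_ballP[e /= e0 veA].
apply/nbhs_ballP; exists e => //= w [_ vw]; apply: veA; split=> // i j.
by rewrite /= !mxE; exact: vw.
Qed.

End BorelRow.

Section LebesgueRow.
Context {R : realType} (n : nat)
  (mu : {sigma_finite_measure set 'rV[R]_n -> \bar R}).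

(* Lebesgue measure on R x R^n transported to R^(n+1). *)
Definition lebesgue_step : set 'rV[R]_n.+1 -> \bar R :=
  pushforward ((@lebesgue_measure R) \x mu)%E (@cons_rV R n).

Let lebesgue_step0 : lebesgue_step set0 = 0%E.
Proof. by rewrite /lebesgue_step /pushforward preimage_set0 measure0. Qed.

Let lebesgue_step_ge0 A : (0 <= lebesgue_step A)%E.
Proof. exact: (measure_ge0 (lebesgue_measure \x mu)%E). Qed.

Let lebesgue_step_sigma_additive : semi_sigma_additive lebesgue_step.
Proof.
move=> F mF tF mUF; rewrite /lebesgue_step /pushforward preimage_bigcup.
apply: (measure_semi_sigma_additive (s := (lebesgue_measure \x mu)%E)).
- move=> k; rewrite -[X in measurable X]setTI.
  exact: (measurable_cons_rV measurableT (mF k)).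
- apply/trivIsetP => /= i j _ _ ij; rewrite -preimage_setI.
  by move/trivIsetP : tF => /(_ _ _ _ _ ij) ->//; rewrite preimage_set0.
- rewrite -preimage_bigcup -[X in measurable X]setTI.
  exact: (measurable_cons_rV measurableT mUF).
Qed.

HB.instance Definition _ := isMeasure.Build _ _ _ lebesgue_step
  lebesgue_step0 lebesgue_step_ge0 lebesgue_step_sigma_additive.

Let lebesgue_step_sigma_finite : sigma_finite setT lebesgue_step.
Proof.
have /sigma_finiteP[F [TF ndF Foo]] := sigma_finiteT (@lebesgue_measure R).
have /sigma_finiteP[G [TG ndG Goo]] := sigma_finiteT mu.
exists (fun k => @uncons_rV R n @^-1` (F k `*` G k)).
  apply/seteqP; split=> // v _.
  have [k _ Fk] : (\bigcup_i F i) (v ord0 ord0) by rewrite -TF.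
  have [l _ Gl] : (\bigcup_i G i) (\row_i v ord0 (lift ord0 i)) by rewrite -TG.
  exists (maxn k l) => //; split.
  - by move: Fk; exact/subsetPset/ndF/leq_maxl.
  - by move: Gl; exact/subsetPset/ndG/leq_maxr.
move=> k; have [mF Fk] := Foo k; have [mG Gk] := Goo k.
have mFG : measurable (F k `*` G k) by exact: measurableX.
split.
  rewrite -[X in measurable X]setTI.
  exact: (measurable_uncons_rV measurableT mFG).
rewrite /lebesgue_step /pushforward -comp_preimage.
rewrite (_ : _ \o _ = id); last by apply/funext => p; exact: cons_rVK.
by rewrite preimage_id product_measure1E// lte_mul_pinfty// ge0_fin_numE.
Qed.

HB.instance Definition _ := Measure_isSigmaFinite.Build _ _ _ lebesgue_step
  lebesgue_step_sigma_finite.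

End LebesgueRow.

Fixpoint lebesgue_rV {R : realType} (n : nat) :
    {sigma_finite_measure set 'rV[R]_n -> \bar R} :=
  if n is m.+1 then lebesgue_step (lebesgue_rV m) else \d_(0 : 'rV[R]_0).

Section BiharmonicNeumann.
Context {R : realType}.

(* Euler's Gamma function at a positive real argument. *)
Definition Gamma (x : R) : R :=
  \int[lebesgue_measure]_(t in `]0, +oo[) (t `^ (x - 1) * expR (- t)).

Definition ball_volume (d : nat) : R :=
  pi `^ (d%:R / 2) / Gamma (1 + d%:R / 2).

Definition weyl_const (d : nat) : R :=
  (2 * pi) ^+ 2 * ball_volume d `^ (- (2 / d%:R)).

Context {d : nat}.
Local Notation E := 'rV[R]_d.
Implicit Types (Omega : set E) (u v : E -> R) (s : seq 'I_d) (a : R).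

Definition volume Omega : R := fine (lebesgue_rV d Omega).

Definition bounded_domain Omega : Prop :=
  [/\ Omega !=set0, open Omega, connected Omega & bounded_set Omega].

(* Near each boundary point, in the orthonormal coordinates z = y *m O, the set
   is the strict epigraph of a continuous function of all coordinates but
   one, the i-th. *)
Definition continuous_boundary Omega : Prop :=
  forall x, (closure Omega `\` Omega°) x ->
  exists (O : 'M[R]_d) (i : 'I_d) (phi : 'rV[R]_d.-1 -> R),
    [/\ O *m O^T = 1%:M, continuous phi &
        \forall y \near x,
          Omega y <-> phi (col' i (y *m O)) < (y *m O) ord0 i].

(* The partial derivative d_(i1) ... d_(ip) u for s = [:: i1; ...; ip]. *)
Definition partials s u : E -> R :=
  foldr (fun i f => 'D_(delta_mx 0 i : E) f) u s.

Definition smooth u : Prop := forall s,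
  continuous (partials s u) /\
  forall (i : 'I_d) (x : E), derivable (partials s u) x (delta_mx 0 i).

Definition test_function Omega : set (E -> R) := [set f : E -> R |
  [/\ smooth f, compact (closure [set x | f x != 0])
    & closure [set x | f x != 0] `<=` Omega]].

Definition L2 Omega : set (E -> R) := [set u : E -> R |
  measurable_fun Omega u /\
  (lebesgue_rV d).-integrable Omega (fun x => (u x ^+ 2)%:E)].

Definition weak_derivative Omega s u v : Prop :=
  forall f, test_function Omega f ->
    \int[lebesgue_rV d]_(x in Omega) (u x * partials s f x) =
    (-1) ^+ size s * \int[lebesgue_rV d]_(x in Omega) (v x * f x).

Definition H2 Omega : set (E -> R) := [set u : E -> R | L2 Omega u /\
  forall s, (size s <= 2)%N ->
    exists2 v, L2 Omega v & weak_derivative Omega s u v].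

(* A representative of the weak derivative in L2, which is unique almost
   everywhere in Omega when it exists. *)
Definition weak_partials Omega s u : E -> R :=
  xget (cst 0) [set v | L2 Omega v /\ weak_derivative Omega s u v].

Definition hessian Omega u (x : E) : 'M[R]_d :=
  \matrix_(i, j) weak_partials Omega [:: i; j] u x.

Definition laplacian Omega u (x : E) : R :=
  \sum_(i < d) weak_partials Omega [:: i; i] u x.

Definition frobenius (A B : 'M[R]_d) : R :=
  \sum_(i < d) \sum_(j < d) A i j * B i j.

Definition biharmonic_form Omega a u v : R :=
  \int[lebesgue_rV d]_(x in Omega)
    ((1 - a) * frobenius (hessian Omega u x) (hessian Omega v x)
     + a * (laplacian Omega u x * laplacian Omega v x)).

Definition rayleigh Omega a u : R :=
  biharmonic_form Omega a u u / \int[lebesgue_rV d]_(x in Omega) (u x ^+ 2).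

Definition ae_zero Omega : set (E -> R) := [set u : E -> R |
  {ae lebesgue_rV d, forall x, Omega x -> u x = 0}].

Definition lin_comb (j : nat) (b : 'I_j -> E -> R) (c : 'I_j -> R) : E -> R :=
  fun x => \sum_(i < j) c i * b i x.

(* Functions stand for their classes modulo almost everywhere equality in
   Omega, so independence is meant modulo ae_zero. *)
Definition has_dim Omega (j : nat) (V : set (E -> R)) : Prop :=
  exists b : 'I_j -> E -> R,
    (forall c, ae_zero Omega (lin_comb b c) -> forall i, c i = 0) /\
    V = range (lin_comb b).

(* The min-max value M_j(a), j >= 1, the infimum over j-dimensional subspaces
   of the maximal Rayleigh quotient; it is a nonnegative real number because
   H2 is infinite dimensional and the form is nonnegative. *)
Definition neumann_eigenvalue Omega a (j : nat) : R :=
  fine (ereal_inf [set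
    ereal_sup [set (rayleigh Omega a u)%:E | u in V `\` ae_zero Omega] |
    V in [set V | V `<=` H2 Omega /\ has_dim Omega j V]]).

Definition weyl_m Omega (k : nat) : R :=
  weyl_const d ^+ 2 * (k%:R / volume Omega) `^ (4 / d%:R).

Definition weyl_ratio Omega a (k : nat) : R :=
  (d%:R + 4) / d%:R
    * (k%:R^-1 * \sum_(1 <= j < k.+1) neumann_eigenvalue Omega a j)
    / weyl_m Omega k.

End BiharmonicNeumann.

(* Main.v *)
(* Test functions: for a frequency p, the Hartley function cos(p.x) + sin(p.x)
   satisfies |D^2 h|^2 = (Delta h)^2 = |p|^4 h^2 pointwise, so Q(h, h) =
   |p|^4 <h, h> whatever a is, and <h_p, h_p> + <h_(-p), h_(-p)> = 2 |Omega|.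
   Put Omega in a cube of half-side r; the h_p with p in (pi/r) Z^d are orthogonal
   on the cube, hence satisfy a Bessel inequality with constant (2r)^d.

   Diagonalise the two forms simultaneously on the span of finitely many h_p:
   by min-max the i-th diagonal value m_i is at least M_i, and expanding
   (M_(k+1) - |p|^4) <h_p, h_p> in the diagonal basis and summing over p with
   Bessel gives the Riesz mean bound
     |Omega| sum_p (M_(k+1) - |p|^4)_+ <= (2r)^d sum_(j <= k) (M_(k+1) - M_j).
   Letting r -> oo turns the sum, times (pi/r)^d, into an integral over R^d
   equal to 4/(d+4) B_d M_(k+1)^((d+4)/4).  The elementary inequality
   (d+2) x^2 <= d + 2 x^(d+2), at x = (M_(k+1) / m_k)^(1/4), then gives
   M_(k+1) + m_k S_k <= 2 sqrt(m_k M_(k+1)), which is the theorem. *)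

From HB Require Import structures.
Require Import Defs.
From mathcomp Require Import all_boot all_order all_algebra.
From mathcomp Require Import all_classical all_reals all_analysis.
From mathcomp Require Import measurable_realfun.
From mathcomp Require Import ring lra.

Set Implicit Arguments.
Unset Strict Implicit.
Unset Printing Implicit Defensive.

Import Order.TTheory GRing.Theory Num.Theory.
Import numFieldNormedType.Exports.

Local Open Scope classical_set_scope.
Local Open Scope ring_scope.

(** * Lebesgue measure on row vectors *)

(** Each [M_j] is only an infimum over trial spaces, so the functions that diagonalise both forms on
    the span of the [h_p] play the part of eigenfunctions: Bessel's inequality is applied to them,
    where the classical argument projects plane waves off the first k eigenfunctions. Over Omega the
    [h_p] lose the orthogonality they have on the cube and their Gram matrix is only known to be
    nonnegative; it may be diagonalised all the same, because a combination of zero norm vanishes on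
    the open set Omega together with its derivatives.

    The form is built from weak derivatives picked by choice. Before any computation these have to
    be identified, almost everywhere, with classical derivatives; the bump functions and the
    fundamental lemma serve this purpose.

    The norm of [h_p] over Omega depends on p, and only its mean over p and -p is |Omega|; hence the
    frequency sets symmetric about 0. The Bessel constant [(2r)^d] times the cell volume [(pi/r)^d]
    of the frequency lattice is [(2 pi)^d] for every r, so the right-hand side stays fixed while the
    left-hand side tends to an integral. *)

Section LebesgueRV.
Context {R : realType}.
Local Notation leb n := (@lebesgue_rV R n).

Lemma continuous_measurable_rV n (f : 'rV[R]_n -> R) :
  continuous f -> measurable_fun setT f.
Proof.
move=> cf; refine (@measurability default_measure_display _ 'rV[R]_n
  (measurableTypeR R) setT f (@RGenOpens.G R) (RGenOpens.measurableE R) _).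
move=> _ [U [x [y ->]] <-]; rewrite setTI.
apply: open_measurable_rV; apply: open_comp; last exact: interval_open.
by move=> v _; exact: cf.
Qed.

Lemma integral_lebesgue_rV0 (f : 'rV[R]_0 -> \bar R) :
  measurable_fun setT f -> (\int[leb 0]_x f x)%E = f 0.
Proof.
by move=> mf; rewrite /= integral_dirac// diracT mul1e.
Qed.

Lemma tonelli_rV1 n (f : 'rV[R]_n.+1 -> \bar R) :
  measurable_fun setT f -> (forall x, (0 <= f x)%E) ->
  (\int[leb n.+1]_x f x =
   \int[lebesgue_measure]_t \int[leb n]_v f (cons_rV (t, v)))%E.
Proof.
move=> mf f0.
transitivity (\int[(lebesgue_measure \x leb n)%E]_p (f \o @cons_rV R n) p)%E.
  have := ge0_integral_pushforward (@measurable_cons_rV R n) (lebesgue_measure \x leb n)%E measurableT mf.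
  by rewrite preimage_setT; apply=> x _; exact: f0.
rewrite (fubini_tonelli1 (f \o @cons_rV R n))//.
  by apply: measurableT_comp => //; exact: (@measurable_cons_rV R n).
by move=> x; exact: f0.
Qed.

Lemma tonelli_rV2 n (f : 'rV[R]_n.+1 -> \bar R) :
  measurable_fun setT f -> (forall x, (0 <= f x)%E) ->
  (\int[leb n.+1]_x f x =
   \int[leb n]_v \int[lebesgue_measure]_t f (cons_rV (t, v)))%E.
Proof.
move=> mf f0.
rewrite tonelli_rV1// (fubini_tonelli (f \o @cons_rV R n))//.
  by apply: measurableT_comp => //; exact: (@measurable_cons_rV R n).
by move=> x; exact: f0.
Qed.

Lemma integrable_cons_rV n (f : 'rV[R]_n.+1 -> \bar R) :
  (leb n.+1).-integrable setT f ->
  ((@lebesgue_measure R) \x leb n)%E.-integrable setT (f \o @cons_rV R n).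
Proof.
move=> /integrableP[mf foo]; apply/integrableP; split.
  by apply: measurableT_comp => //; exact: (@measurable_cons_rV R n).
have maf : measurable_fun setT (abse \o f) by exact: measurableT_comp.
have := ge0_integral_pushforward (@measurable_cons_rV R n)
  (lebesgue_measure \x leb n)%E measurableT maf.
rewrite preimage_setT => H; rewrite /comp /= in H.
by rewrite -H.
Qed.

Lemma fubini_rV1 n (f : 'rV[R]_n.+1 -> \bar R) :
  (leb n.+1).-integrable setT f ->
  (\int[leb n.+1]_x f x =
   \int[lebesgue_measure]_t \int[leb n]_v f (cons_rV (t, v)))%E.
Proof.
move=> fi; have fi' := integrable_cons_rV fi.
transitivity (\int[(lebesgue_measure \x leb n)%E]_p (f \o @cons_rV R n) p)%E.
  have := @integral_pushforward _ _ _ _ R _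
    (@measurable_cons_rV R n) (lebesgue_measure \x leb n)%E setT f.
  rewrite preimage_setT => <- //.
  by move/integrableP: fi => [].
by rewrite -(integral12_prod_meas1 fi').
Qed.

Lemma fubini_rV2 n (f : 'rV[R]_n.+1 -> \bar R) :
  (leb n.+1).-integrable setT f ->
  (\int[leb n.+1]_x f x =
   \int[leb n]_v \int[lebesgue_measure]_t f (cons_rV (t, v)))%E.
Proof.
by move=> fi; rewrite fubini_rV1// (Fubini (integrable_cons_rV fi)).
Qed.

Definition box n (I : 'I_n -> interval R) : set 'rV[R]_n :=
  [set x | forall i, x ord0 i \in I i].

Lemma box_cons n (I : 'I_n.+1 -> interval R) :
  @cons_rV R n @^-1` box I =
  ([set` I ord0] : set (measurableTypeR R)) `*` box (fun i => I (lift ord0 i)).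
Proof.
apply/seteqP; split=> -[t v] /=.
  move=> H; split; first by have := H ord0; rewrite cons_rV0.
  by move=> i; have := H (lift ord0 i); rewrite cons_rVS.
move=> [h0 hS] i; have [j ->|->] := unliftP ord0 i.
  by rewrite cons_rVS; exact: hS.
by rewrite cons_rV0.
Qed.

Lemma measurable_box n (I : 'I_n -> interval R) : measurable (box I).
Proof.
elim: n I => [|n IHn] I.
  by rewrite (_ : box I = setT)//; apply/seteqP; split=> // x _ [].
rewrite (_ : box I = @uncons_rV R n @^-1` (([set` I ord0] : set (measurableTypeR R))
   `*` box (fun i => I (lift ord0 i)))).
  rewrite -[X in measurable X]setTI; apply: (@measurable_uncons_rV R n) => //.
  by apply: measurableX => //; exact: IHn.
rewrite -box_cons -comp_preimage (_ : _ \o _ = id) ?preimage_id//.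
by apply/funext => v /=; rewrite uncons_rVK.
Qed.

Lemma lebesgue_rV_box n (I : 'I_n -> interval R) (l : 'I_n -> R) :
  (forall i, lebesgue_measure ([set` I i] : set R) = (l i)%:E) ->
  leb n (box I) = (\prod_(i < n) l i)%:E.
Proof.
elim: n I l => [|n IHn] I l H.
  rewrite big_ord0 (_ : box I = setT) /= ?diracT//.
  by apply/seteqP; split=> // x _ [].
rewrite /= /lebesgue_step /pushforward box_cons product_measure1E//.
- rewrite big_ord_recl EFinM; congr (_ * _)%E; first exact: H.
  by apply: IHn => i; exact: H.
- exact: measurable_box.
Qed.

Definition cube n (r : R) : set 'rV[R]_n := box (fun=> `[- r, r]).

Lemma compact_cube n r : compact (@cube n r).
Proof.
exact: (@rV_compact _ n (fun=> `[- r, r]%classic) (fun=> @segment_compact _ _ _)).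
Qed.

Lemma measurable_cube n r : measurable (@cube n r).
Proof. exact: measurable_box. Qed.

Lemma lebesgue_rV_cube n r : 0 <= r -> leb n (@cube n r) = ((2 * r) ^+ n)%:E.
Proof.
move=> r0; rewrite (@lebesgue_rV_box n _ (fun=> 2 * r)).
  by rewrite prodr_const card_ord.
move=> _; rewrite lebesgue_measure_itv/= lte_fin.
case: ltP => rr; first by congr (_%:E); ring.
by congr (_%:E); lra.
Qed.

Lemma bounded_cube n (A : set 'rV[R]_n) :
  bounded_set A -> exists2 r, 0 < r & A `<=` @cube n r.
Proof.
move=> [M [_ HM]]; exists (`|M| + 1); first by rewrite ltr_pwDr.
move=> x Ax i; have xM : `|x| <= `|M| + 1.
  by apply: HM => //; rewrite ltr_pwDr// ler_norm.
rewrite in_itv /= -ler_norml; apply: le_trans xM.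
rewrite [leRHS]/Num.norm /= mx_normrE; apply/bigmax_geP; right => /=.
by exists (ord0, i).
Qed.

Lemma lebesgue_rV_bounded n (A : set 'rV[R]_n) :
  measurable A -> bounded_set A -> (leb n A < +oo)%E.
Proof.
move=> mA /bounded_cube[r r0 Ar].
rewrite (@le_lt_trans _ _ (leb n (@cube n r)))//.
  by rewrite le_measure ?inE//; exact: measurable_cube.
by rewrite lebesgue_rV_cube ?ltry// ltW.
Qed.

Lemma cube_bounded n (r : R) : bounded_set (@cube n r).
Proof. by apply: compact_bounded; exact: compact_cube. Qed.

Lemma continuous_integrable_rV n (A : set 'rV[R]_n) (f : 'rV[R]_n -> R) :
  measurable A -> bounded_set A -> continuous f ->
  (leb n).-integrable A (EFin \o f).
Proof.
move=> mA bA cf; apply: measurable_bounded_integrable => //.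
- exact: lebesgue_rV_bounded.
- by apply: measurable_funS (continuous_measurable_rV cf).
have [r r0 Ar] := bounded_cube bA.
have : compact (f @` @cube n r).
  apply: continuous_compact (@compact_cube n r).
  by move=> x; apply: continuous_subspaceT.
move=> /compact_bounded [M [_ HM]].
by exists M; split; rewrite ?num_real// => x Mx y Ay; apply: HM => //; exists y => //; exact: Ar.
Qed.

Lemma open_lebesgue_rV_gt0 n (U : set 'rV[R]_n) :
  open U -> U !=set0 -> (0 < leb n U)%E.
Proof.
move=> oU [x Ux].
have /nbhs_ballP[e /= e0 xeU] : nbhs x U by exact: open_nbhs_nbhs.
rewrite (@lt_le_trans _ _ (leb n (box (fun i => `]x ord0 i - e, x ord0 i + e[))))//.
  rewrite (@lebesgue_rV_box n _ (fun=> 2 * e)).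
    by rewrite prodr_const card_ord lte_fin exprn_gt0// mulr_gt0.
  move=> i; rewrite lebesgue_measure_itv/= lte_fin ltrD2l gtrN//.
  by rewrite -EFinB; congr (_%:E); ring.
apply: le_measure; rewrite ?inE; [exact: measurable_box|exact: open_measurable_rV|].
move=> y Hy; apply: xeU; split=> // i j; rewrite (ord1 i).
by have := Hy j; rewrite in_itv /= => ?; rewrite /ball/= ltr_distlC.
Qed.

(** If [f x > 0], then [f > f x / 2] on a nonempty open subset of [U], which has positive measure,
    so the integral would be positive. *)
Lemma continuous_ge0_integral0 n (U : set 'rV[R]_n) (f : 'rV[R]_n -> R) :
  open U -> continuous f -> (forall x, 0 <= f x) ->
  (\int[leb n]_(x in U) (f x)%:E = 0)%E -> forall x, U x -> f x = 0.
Proof.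
move=> oU cf f0 If0 x Ux; apply/eqP; rewrite eq_le f0 andbT leNgt; apply/negP => fx.
pose V := U `&` f @^-1` [set y | f x / 2 < y].
have oV : open V.
  apply: openI => //; apply: open_comp; last exact: open_gt.
  by move=> y _; exact: cf.
have Vx : V x by split=> //=; lra.
have := open_lebesgue_rV_gt0 oV (ex_intro _ x Vx).
apply/negP; rewrite -leNgt.
have mV := open_measurable_rV oV; have mU := open_measurable_rV oU.
have : ((f x / 2)%:E * leb n V <= 0)%E.
  rewrite -If0 -integral_cst//.
  rewrite (@le_trans _ _ (\int[leb n]_(x in V) (f x)%:E)%E)//.
    apply: ge0_le_integral => //.
    - by move=> y _; rewrite lee_fin; have := f0 x; lra.
    - by apply/measurable_EFinP; exact: measurable_funS (continuous_measurable_rV cf).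
    - by move=> y [_ /=] /ltW; rewrite lee_fin.
  apply: ge0_subset_integral => //.
  - by apply/measurable_EFinP; exact: measurable_funS (continuous_measurable_rV cf).
  - by move=> y _; rewrite lee_fin.
  - by move=> y [].
by rewrite pmule_rle0// lte_fin; lra.
Qed.

End LebesgueRV.

(** * Smooth functions *)

Section LineDerivative.
Context {R : realType}.

(** The two difference quotients are the same function of the step. This lets directional
    derivatives be handled by the one-variable chain rule. *)
Lemma is_derive_line (V : normedModType R) (f : V -> R) x v (l : R) :
  is_derive (0 : R) 1 (fun t => f (t *: v + x)) l -> is_derive x v f l.
Proof.
move=> [df fl]; apply: DeriveDef; first exact: (derivable1P f x v).2 df.
rewrite -fl /derive; set g1 := fun h => h^-1 *: _; set g2 := fun h => h^-1 *: _.
suff -> : g1 = g2 by [].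
by rewrite funeqE /g1 /g2 => h /=; rewrite addr0 scale0r add0r [_%:A]mulr1.
Qed.

Lemma line_is_derive (V : normedModType R) (f : V -> R) x v (l : R) :
  is_derive x v f l -> is_derive (0 : R) 1 (fun t => f (t *: v + x)) l.
Proof.
move=> [df fl]; apply: DeriveDef; first exact: (derivable1P f x v).1 df.
rewrite -fl /derive; set g1 := fun h => h^-1 *: _; set g2 := fun h => h^-1 *: _.
suff -> : g1 = g2 by [].
by rewrite funeqE /g1 /g2 => h /=; rewrite addr0 scale0r add0r [_%:A]mulr1.
Qed.

Lemma is_derive1_comp (f g : R -> R) x df dg :
  is_derive (g x) 1 f df -> is_derive x 1 g dg ->
  is_derive x 1 (fun t => f (g t)) (df * dg).
Proof.
move=> [Df fd] [Dg gd].
have D : derivable (f \o g) x 1.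
  apply/derivable1_diffP; apply: differentiable_comp; exact/derivable1_diffP.
by apply: DeriveDef => //; rewrite -derive1E derive1_comp// !derive1E fd gd.
Qed.

Lemma is_derive_affine (a b t : R) : is_derive t 1 (fun t => t * a + b) a.
Proof. by apply: is_derive_eq; rewrite scaler0 add0r addr0 [_%:A]mulr1. Qed.

Lemma derivable1_continuous (f : R -> R) : (forall x, derivable f x 1) -> continuous f.
Proof.
by move=> df x; apply: differentiable_continuous; exact/derivable1_diffP.
Qed.

End LineDerivative.

Section Smooth.
Context {R : realType} {d : nat}.
Local Notation E := 'rV[R]_d.
Local Notation "''e_' i" := (delta_mx 0 i : E) (at level 8, i at level 2, format "''e_' i").
Implicit Types (u v f : E -> R) (s : seq 'I_d).

Lemma partials_rcons s i u : partials (rcons s i) u = partials s ('D_('e_i) u).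
Proof. by rewrite /partials foldr_rcons. Qed.

(** Coinduction for smoothness: iterated partial derivatives of a member of [K] stay in [K]. Each
    later smoothness proof then amounts to choosing a class of continuous functions stable under one
    derivative. *)
Lemma smooth_coind (K : (E -> R) -> Prop) :
  (forall u, K u -> continuous u /\
    forall i, exists2 w, K w & forall x, is_derive x 'e_i u (w x)) ->
  forall u, K u -> smooth u.
Proof.
move=> HK u Ku.
have Kp s : K (partials s u).
  elim: s => [|i s /HK[_ /(_ i)[w Kw Hw]]] //=.
  by rewrite (_ : 'D_('e_i) _ = w)//; apply/funext => x; case: (Hw x).
move=> s; split; first by case: (HK _ (Kp s)).
by move=> i x; have [_ /(_ i)[w _ /(_ x)[]]] := HK _ (Kp s).
Qed.

Lemma smooth_continuous u : smooth u -> continuous u.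
Proof. by move=> /(_ [::])[]. Qed.

Lemma smooth_derivable u i x : smooth u -> derivable u x 'e_i.
Proof. by move=> /(_ [::])[]. Qed.

Lemma smooth_derive u i : smooth u -> smooth ('D_('e_i) u).
Proof. by move=> su s; rewrite -partials_rcons; exact: su. Qed.

Lemma smooth_is_derive u i x : smooth u -> is_derive x 'e_i u ('D_('e_i) u x).
Proof. by move=> su; apply: DeriveDef => //; exact: smooth_derivable. Qed.

Lemma smooth_partials u s : smooth u -> smooth (partials s u).
Proof. by move=> su; elim: s => //= i s; exact: smooth_derive. Qed.

(** The product rule turns a product into a sum of products, so sums and products have to be
    adjoined together for the class to be stable under derivation. *)
Inductive smooth_alg : (E -> R) -> Prop :=
| SmoothBase u of smooth u : smooth_alg u
| SmoothAdd u v of smooth_alg u & smooth_alg v : smooth_alg (u + v)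
| SmoothMul u v of smooth_alg u & smooth_alg v : smooth_alg (u * v).

Lemma smooth_alg_smooth u : smooth_alg u -> smooth u.
Proof.
apply: smooth_coind => {}u; elim=> {u} [u su|u v _ [cu Hu] _ [cv Hv]|u v au [cu Hu] av [cv Hv]].
- split; first exact: smooth_continuous.
  move=> i; exists ('D_('e_i) u) => [|x]; last exact: smooth_is_derive.
  by apply: SmoothBase; exact: smooth_derive.
- split; first by move=> x; apply: continuousD; [exact: cu|exact: cv].
  move=> i; have [w Kw Hw] := Hu i; have [z Kz Hz] := Hv i.
  exists (w + z); first exact: SmoothAdd.
  by move=> x; apply: is_deriveD.
- split; first by move=> x; apply: continuousM; [exact: cu|exact: cv].
  move=> i; have [w Kw Hw] := Hu i; have [z Kz Hz] := Hv i.
  exists (u * z + v * w); first by apply: SmoothAdd; exact: SmoothMul.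
  by move=> x; apply: is_deriveM.
Qed.

Lemma smooth_add u v : smooth u -> smooth v -> smooth (fun x => u x + v x).
Proof. by move=> su sv; apply/smooth_alg_smooth/SmoothAdd; exact: SmoothBase. Qed.

Lemma smooth_mul u v : smooth u -> smooth v -> smooth (fun x => u x * v x).
Proof. by move=> su sv; apply/smooth_alg_smooth/SmoothMul; exact: SmoothBase. Qed.

Lemma smooth_cst (c : R) : smooth (fun _ : E => c).
Proof.
apply: (smooth_coind (K := fun u => exists c, u = cst c)); last by exists c.
move=> _ [b ->]; split; first exact: cst_continuous.
move=> i; exists (cst 0); first by exists 0.
by move=> x; exact: is_derive_cst.
Qed.

Lemma smooth_sum (I : Type) (r : seq I) (P : pred I) (F : I -> E -> R) :
  (forall i, smooth (F i)) -> smooth (fun x => \sum_(i <- r | P i) F i x).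
Proof.
move=> sF; elim: r => [|i r IHr].
  by under eq_fun do rewrite big_nil; exact: smooth_cst.
under eq_fun do rewrite big_cons.
by case: (P i) => //; exact: smooth_add.
Qed.

Lemma smooth_prod (I : Type) (r : seq I) (P : pred I) (F : I -> E -> R) :
  (forall i, smooth (F i)) -> smooth (fun x => \prod_(i <- r | P i) F i x).
Proof.
move=> sF; elim: r => [|i r IHr].
  by under eq_fun do rewrite big_nil; exact: smooth_cst.
under eq_fun do rewrite big_cons.
by case: (P i) => //; exact: smooth_mul.
Qed.

Definition dot (p x : E) : R := \sum_(i < d) p 0 i * x 0 i.

Lemma dotDl p q x : dot (p + q) x = dot p x + dot q x.
Proof. by rewrite /dot -big_split; apply: eq_bigr => i _; rewrite mxE mulrDl. Qed.

Lemma dotNl p x : dot (- p) x = - dot p x.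
Proof. by rewrite /dot -sumrN; apply: eq_bigr => i _; rewrite mxE mulNr. Qed.

Lemma dotDr p x y : dot p (x + y) = dot p x + dot p y.
Proof. by rewrite /dot -big_split; apply: eq_bigr => i _; rewrite mxE mulrDr. Qed.

Lemma dotZr p t x : dot p (t *: x) = t * dot p x.
Proof. by rewrite /dot mulr_sumr; apply: eq_bigr => i _; rewrite mxE mulrCA. Qed.

Lemma dot_delta p i : dot p 'e_i = p 0 i.
Proof.
rewrite /dot (bigD1 i)//= big1 ?addr0 => [|j ji]; rewrite mxE !eqxx/=.
  by rewrite mulr1.
by rewrite (negbTE ji) mulr0.
Qed.

Lemma continuous_dot p : continuous (dot p).
Proof.
apply: (@continuous_big R _ +%R 0 xpredT) => [|i _ x]; first exact: add_continuous.
by apply: (@continuousM _ _ (cst (p 0 i)) (fun x : E => x 0 i)); [exact: cst_continuous|exact: coord_continuous].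
Qed.

Lemma is_derive_dot (g : R -> R) p b x i l :
  is_derive (dot p x + b) 1 g l ->
  is_derive x 'e_i (fun y => g (dot p y + b)) (l * p 0 i).
Proof.
move=> Hg; apply: is_derive_line.
have H := is_derive_affine (p 0 i) (dot p x + b) 0.
rewrite (_ : (fun t => _) = (fun t => g (t * p 0 i + (dot p x + b)))).
  by apply: is_derive1_comp H; rewrite mul0r add0r.
by apply/funext => t; rewrite dotDr dotZr dot_delta addrA.
Qed.

(* [K] is a class of functions of one real variable closed under derivation. *)
Lemma smooth_dot (K : (R -> R) -> Prop) :
  (forall g, K g -> exists2 g', K g' & forall t : R, is_derive t 1 g (g' t)) ->
  forall g p b, K g -> smooth (fun x => g (dot p x + b)).
Proof.
move=> HK g p b Kg.
(* The factor [c] collects the coordinates of [p] that the chain rule brings out at each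
   derivation. *)
apply: (smooth_coind (K := fun u => exists c h, K h /\
    u = fun x => c * h (dot p x + b))); last first.
  by exists 1, g; split=> //; apply/funext => x; rewrite mul1r.
move=> _ [c [h [Kh ->]]]; have [h' Kh' Hh] := HK _ Kh; split.
  move=> x; apply: (@continuousM _ _ (cst c) (fun x => h (dot p x + b))).
    exact: cst_continuous.
  apply: (@continuous_comp _ _ _ (fun x => dot p x + b)).
    apply: (@continuousD _ _ _ (dot p) (cst b)); first exact: continuous_dot.
    exact: cst_continuous.
  by apply: derivable1_continuous => t; case: (Hh t).
move=> i; exists (fun x => (c * p 0 i) * h' (dot p x + b)).
  by exists (c * p 0 i), h'.
move=> x; have H := @is_derive_dot h p b x i _ (Hh _).
have := is_deriveM (is_derive_cst c x 'e_i) H.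
move=> H'; apply: (is_derive_eq H').
by rewrite scaler0 addr0 -mulrA (mulrC (p 0 i)).
Qed.

Lemma smooth_coord i : smooth (fun x : E => x 0 i).
Proof.
apply: (smooth_coind (K := fun u => (exists c, u = cst c) \/ u = fun x => x 0 i)); last by right.
move=> _ [[c ->]|->].
  split; first exact: cst_continuous.
  move=> j; exists (cst 0); first by left; exists 0.
  by move=> x; exact: is_derive_cst.
split; first exact: coord_continuous.
move=> j; exists (cst (('e_j : E) 0 i)); first by left; eexists.
move=> x; apply: is_derive_line.
have H := is_derive_affine (('e_j : E) 0 i) (x 0 i) 0.
by move: H; congr is_derive; apply/funext => t; rewrite !mxE.
Qed.

Lemma partialsD s u v : smooth u -> smooth v ->
  partials s (fun x => u x + v x) = fun x => partials s u x + partials s v x.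
Proof.
move=> su sv; elim: s => //= i s ->; apply/funext => x.
by apply: derive_val; apply: is_deriveD; apply: smooth_is_derive; exact: smooth_partials.
Qed.

Lemma partials_cst0 s : partials s (fun _ : E => 0) = fun=> 0.
Proof. by elim: s => //= i s ->; apply/funext => x; apply: derive_val. Qed.

Lemma partialsZ s c u : smooth u ->
  partials s (fun x => c * u x) = fun x => c * partials s u x.
Proof.
move=> su; elim: s => //= i s ->; apply/funext => x.
have := is_deriveM (is_derive_cst c x 'e_i) (smooth_is_derive i x (smooth_partials s su)).
by case=> _; rewrite scaler0 addr0.
Qed.

Lemma partials_sum (I : Type) (r : seq I) s (c : I -> R) (F : I -> E -> R) :
  (forall i, smooth (F i)) ->
  partials s (fun x => \sum_(i <- r) c i * F i x) =
  fun x => \sum_(i <- r) c i * partials s (F i) x.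
Proof.
move=> sF; elim: r => [|i r IHr].
  under eq_fun do rewrite big_nil.
  by rewrite partials_cst0; apply/funext => x; rewrite big_nil.
under eq_fun do rewrite big_cons.
rewrite partialsD; last 2 first.
- by apply: smooth_mul => //; exact: smooth_cst.
- by apply: smooth_sum => j; apply: smooth_mul => //; exact: smooth_cst.
by rewrite partialsZ// IHr; apply/funext => x; rewrite big_cons.
Qed.

Lemma partials_near (U : set E) s u v : open U ->
  (forall x, U x -> u x = v x) ->
  forall x, U x -> partials s u x = partials s v x.
Proof.
move=> oU uv; elim: s => //= i s IHs x Ux.
apply: near_eq_derive; near=> y; apply: IHs.
by near: y; exact: open_nbhs_nbhs.
Unshelve. all: by end_near. Qed.

End Smooth.

(** * Integration by parts and weak derivatives *)

Section IntegrationByParts.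
Context {R : realType}.
Local Notation leb n := (@lebesgue_rV R n).

Lemma cons_rVD n (t h : measurableTypeR R) (v w : 'rV[R]_n) :
  cons_rV ((t + h : R) : measurableTypeR R, v + w) = cons_rV (t, v) + cons_rV (h, w).
Proof.
apply/rowP => i; rewrite [RHS]mxE; have [j ->|->] := unliftP ord0 i.
  by rewrite !cons_rVS mxE.
by rewrite !cons_rV0.
Qed.

Lemma cons_rV_delta0 n (h : R) :
  cons_rV (h : measurableTypeR R, 0 : 'rV[R]_n) = h *: delta_mx 0 ord0.
Proof.
apply/rowP => i; have [j ->|->] := unliftP ord0 i.
  by rewrite cons_rVS !mxE eqxx eq_sym (negbTE (neq_lift _ _)) mulr0.
by rewrite cons_rV0 !mxE !eqxx mulr1.
Qed.

Lemma cons_rV_deltaS n (j : 'I_n) (h : R) :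
  cons_rV ((0 : R) : measurableTypeR R, h *: delta_mx 0 j : 'rV[R]_n) =
  h *: delta_mx 0 (lift ord0 j).
Proof.
apply/rowP => i; have [k ->|->] := unliftP ord0 i.
  by rewrite cons_rVS !mxE !eqxx (inj_eq lift_inj).
by rewrite cons_rV0 !mxE eqxx (negbTE (neq_lift _ _)) mulr0.
Qed.

Lemma continuous_cons_rV1 n (v : 'rV[R]_n) :
  continuous (fun t : R => cons_rV (t : measurableTypeR R, v) : 'rV[R]_n.+1).
Proof.
move=> t A /nbhs_ballP[e /= e0 HA]; apply/nbhs_ballP; exists e => //= u tu.
apply: HA; split=> // i j; rewrite (ord1 i).
have [k ->|->] := unliftP ord0 j; first by rewrite !cons_rVS; exact: ballxx.
by rewrite !cons_rV0.
Qed.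

Lemma continuous_cons_rV2 n (t : measurableTypeR R) :
  continuous (fun v : 'rV[R]_n => cons_rV (t, v)).
Proof.
move=> v A /nbhs_ballP[e /= e0 HA]; apply/nbhs_ballP; exists e => //= u [_ tu].
apply: HA; split=> // i j; rewrite (ord1 i).
have [k ->|->] := unliftP ord0 j; first by rewrite !cons_rVS; exact: tu.
by rewrite !cons_rV0; exact: ballxx.
Qed.

Lemma is_derive_cons_rV1 n (F : 'rV[R]_n.+1 -> R) (t : R) v l :
  is_derive (cons_rV (t : measurableTypeR R, v)) (delta_mx 0 ord0) F l ->
  is_derive t 1 (fun s : R => F (cons_rV (s : measurableTypeR R, v))) l.
Proof.
move=> /line_is_derive H; apply: is_derive_line; move: H.
congr is_derive; apply/funext => h; congr F.
by rewrite -cons_rV_delta0 -cons_rVD add0r [_%:A]mulr1.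
Qed.

Lemma is_derive_cons_rV2 n (F : 'rV[R]_n.+1 -> R) (t : measurableTypeR R) v j l :
  is_derive (cons_rV (t, v)) (delta_mx 0 (lift ord0 j)) F l ->
  is_derive v (delta_mx 0 j) (fun w => F (cons_rV (t, w))) l.
Proof.
move=> /line_is_derive H; apply: is_derive_line; move: H.
congr is_derive; apply/funext => h; congr F.
by rewrite -cons_rV_deltaS -cons_rVD add0r.
Qed.

Lemma closed_cube n (r : R) : closed (@cube R n r).
Proof. by apply: compact_closed; [exact: norm_hausdorff|exact: compact_cube]. Qed.

Lemma restrict_eq0 (T : Type) (A : set T) (G : T -> R) :
  (forall x, ~ A x -> G x = 0) -> (EFin \o G) \_ A = EFin \o G.
Proof.
move=> H; apply/funext => x; rewrite patchE; case: ifPn => // /negP xA.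
by rewrite /= H// => /mem_set.
Qed.

Lemma integrable_supp_rV n (r : R) (G : 'rV[R]_n -> R) : continuous G ->
  (forall x, ~ cube r x -> G x = 0) -> (leb n).-integrable setT (EFin \o G).
Proof.
move=> cG G0; rewrite -(restrict_eq0 G0).
apply: (integrable_mkcond (EFin \o G) (@measurable_cube R n r)).1.
by apply: continuous_integrable_rV => //; [exact: measurable_cube|exact: cube_bounded].
Qed.

Lemma is_derive_supp n (i : 'I_n) (F : 'rV[R]_n -> R) (C : set 'rV[R]_n) x l :
  closed C -> (forall x, ~ C x -> F x = 0) ->
  is_derive x (delta_mx 0 i) F l -> ~ C x -> l = 0.
Proof.
move=> cC F0 [_ <-] Cx; rewrite -(derive_val (is_derive := is_derive_cst (0:R) x (delta_mx 0 i))).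
apply: near_eq_derive; near=> y; apply: F0.
by near: y; apply: open_nbhs_nbhs; split=> //; exact: closed_openC.
Unshelve. all: by end_near. Qed.

Lemma integral_derive_supp (f g : R -> R) (r : R) : continuous g ->
  (forall t : R, is_derive t 1 f (g t)) -> (forall t, r < `|t| -> f t = 0) ->
  (\int[lebesgue_measure]_t (g t)%:E = 0)%E.
Proof.
move=> cg fg f0.
have g0 t : r < `|t| -> g t = 0.
  move=> rt; case: (fg t) => _ <-.
  rewrite -(derive_val (is_derive := is_derive_cst (0:R) t 1)).
  apply: near_eq_derive; near=> y; apply: f0.
  near: y; apply: open_nbhs_nbhs; split=> //.
  by apply: (@open_comp _ _ (fun t : R => `|t|) [set y | r < y]); [move=> x _; exact: (@norm_continuous _ R^o)|exact: open_gt].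
(* [r] may be negative; [s] exceeds both [r] and 0, so [f] vanishes at both ends of a genuine
   interval. *)
pose s := `|r| + 1.
have rs : r < s by rewrite ltr_pwDr// ler_norm.
have s0 : 0 < s by rewrite ltr_pwDr.
have E : (fun t => (g t)%:E) = (EFin \o g) \_ `[- s, s]%classic.
  apply/esym/restrict_eq0 => t; rewrite /= in_itv/= => /negP.
  by rewrite -ler_norml -ltNge => st; apply: g0; exact: lt_trans rs st.
rewrite E -integral_mkcond.
have df t : derivable f t 1 by case: (fg t).
have cf : continuous f by exact: derivable1_continuous.
rewrite (@continuous_FTC2 _ g f (- s) s).
- by rewrite !f0 ?subee// ?normrN gtr0_norm.
- lra.
- exact: continuous_subspaceT.
- by split=> //; [apply: cvg_at_right_filter|apply: cvg_at_left_filter]; exact: cf.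
- by move=> t _; rewrite derive1E; case: (fg t).
Unshelve. all: by end_near. Qed.

(** Fubini with the order adapted to [i]: for the first coordinate, the inner integral along it
    vanishes by the fundamental theorem of calculus; otherwise the slices with the first coordinate
    fixed fall under the induction hypothesis. *)
Lemma integral_partial0 n (i : 'I_n) (F G : 'rV[R]_n -> R) (r : R) :
  continuous G -> (forall x, is_derive x (delta_mx 0 i) F (G x)) ->
  (forall x, ~ cube r x -> F x = 0) -> (\int[leb n]_x (G x)%:E = 0)%E.
Proof.
elim: n i F G => [[]//|n IHn] i F G cG FG F0.
have G0 x : ~ cube r x -> G x = 0.
  by move=> xr; exact: (is_derive_supp (@closed_cube _ r) F0 (FG x)).
have Gi := integrable_supp_rV cG G0.
move: FG; have [j ->|->] := unliftP ord0 i => FG.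
  rewrite (fubini_rV1 Gi) integral0_eq// => t _.
  apply: (IHn j (fun v => F (cons_rV (t, v)))).
  - move=> v; apply: continuous_comp; first exact: continuous_cons_rV2.
    exact: cG.
  - by move=> v; apply: is_derive_cons_rV2; exact: FG.
  - move=> v vr; apply: F0 => H; apply: vr => k.
    by have := H (lift ord0 k); rewrite cons_rVS.
rewrite (fubini_rV2 Gi) integral0_eq// => v _.
apply: (@integral_derive_supp (fun t => F (cons_rV (t : measurableTypeR R, v))) _ r).
- move=> t; apply: continuous_comp; first exact: continuous_cons_rV1.
  exact: cG.
- by move=> t; apply: is_derive_cons_rV1; exact: FG.
- move=> t rt; apply: F0 => /(_ ord0).
  by rewrite cons_rV0 in_itv/= -ler_norml leNgt rt.
Qed.

End IntegrationByParts.

Section WeakDerivative.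
Context {R : realType} {d : nat}.
Local Notation E := 'rV[R]_d.
Local Notation mu := (lebesgue_rV d).
Implicit Types (Omega K : set E) (u v f : E -> R) (s : seq 'I_d).

Lemma partials_supp s K f : closed K -> smooth f -> (forall x, ~ K x -> f x = 0) ->
  forall x, ~ K x -> partials s f x = 0.
Proof.
move=> cK sf f0; elim: s => //= i s IHs x Kx.
by have := is_derive_supp cK IHs (smooth_is_derive i x (smooth_partials s sf)) Kx.
Qed.

Lemma Rintegral_supp Omega (g : E -> R) :
  (forall x, ~ Omega x -> g x = 0) ->
  \int[mu]_(x in Omega) g x = \int[mu]_x g x.
Proof.
move=> g0; rewrite Rintegral_mkcond; congr Rintegral; apply/funext => x.
by rewrite patchE; case: ifPn => // /negP xO; rewrite g0// => /mem_set.
Qed.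

(** The sum of the two integrands is the derivative of [u * f], which is supported in a cube, so its
    integral over the whole space is zero. *)
Lemma ibp_step Omega K u f i : compact K -> K `<=` Omega ->
  smooth u -> smooth f -> (forall x, ~ K x -> f x = 0) ->
  \int[mu]_(x in Omega) (u x * 'D_(delta_mx 0 i : E) f x) =
  - \int[mu]_(x in Omega) ('D_(delta_mx 0 i : E) u x * f x).
Proof.
move=> cK KO su sf f0.
have clK : closed K by apply: compact_closed => //; exact: norm_hausdorff.
have [r r0 Kr] := bounded_cube (compact_bounded cK).
set e := delta_mx 0 i : E.
have su' : smooth ('D_e u) by exact: smooth_derive.
have sf' : smooth ('D_e f) by exact: smooth_derive.
have f'0 x : ~ K x -> 'D_e f x = 0 by exact: (@partials_supp [:: i] K f).
have nO x : ~ Omega x -> ~ K x by move=> H /KO.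
have nc x : ~ cube r x -> ~ K x by move=> H /Kr.
rewrite [LHS]Rintegral_supp; last by move=> x /nO/f'0 ->; rewrite mulr0.
rewrite [X in _ = - X]Rintegral_supp; last by move=> x /nO/f0 ->; rewrite mulr0.
apply/eqP; rewrite -addr_eq0 -RintegralD//=; last 2 first.
- apply: (@integrable_supp_rV _ _ r); last by move=> x /nc/f'0 ->; rewrite mulr0.
  by apply: smooth_continuous; exact: smooth_mul.
- apply: (@integrable_supp_rV _ _ r); last by move=> x /nc/f0 ->; rewrite mulr0.
  by apply: smooth_continuous; exact: smooth_mul.
apply/eqP; rewrite /Rintegral.
pose g x := u x * 'D_e f x + 'D_e u x * f x.
have cg : continuous g.
  by apply: smooth_continuous; apply: smooth_add; exact: smooth_mul.
have Hg x : is_derive x e (u * f) (g x).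
  rewrite /g (mulrC ('D_e u x)).
  by apply: is_deriveM; exact: smooth_is_derive.
have uf0 x : ~ cube r x -> (u * f) x = 0.
  by move=> /nc/f0; rewrite /GRing.mul/= => ->; rewrite mulr0.
by rewrite (integral_partial0 cg Hg uf0).
Qed.

Lemma ibp_partials Omega K u f s : compact K -> K `<=` Omega ->
  smooth u -> smooth f -> (forall x, ~ K x -> f x = 0) ->
  \int[mu]_(x in Omega) (u x * partials s f x) =
  (-1) ^+ size s * \int[mu]_(x in Omega) (partials (rev s) u x * f x).
Proof.
move=> cK KO + sf f0; elim: s u => [|i s IHs] u su; first by rewrite mul1r.
have clK : closed K by apply: compact_closed => //; exact: norm_hausdorff.
rewrite /= (@ibp_step Omega K)//; last 2 first.
- exact: smooth_partials.
- exact: partials_supp.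
rewrite IHs; last exact: smooth_derive.
by rewrite rev_cons partials_rcons exprS mulN1r mulNr.
Qed.

Lemma test_function_supp f : forall x, ~ closure [set x | f x != 0] x -> f x = 0.
Proof.
move=> x Kx; apply/eqP; apply/negPn/negP => fx; apply: Kx.
exact: subset_closure.
Qed.

(* Integration by parts reverses the order of the derivatives. *)
Lemma smooth_weak_derivative Omega u s : smooth u ->
  weak_derivative Omega s u (partials (rev s) u).
Proof.
move=> su f [sf cK KO].
by apply: ibp_partials cK KO su sf _; exact: test_function_supp.
Qed.

Lemma continuous_L2 Omega u : measurable Omega -> bounded_set Omega ->
  continuous u -> L2 Omega u.
Proof.
move=> mO bO cu; split.
  by apply: measurable_funS (continuous_measurable_rV cu).
apply: (continuous_integrable_rV (f := fun x => u x ^+ 2)) => // x.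
by apply: (@continuous_comp _ _ _ u (fun t => t ^+ 2)); [exact: cu|exact: exprn_continuous].
Qed.

Lemma smooth_H2 Omega u : measurable Omega -> bounded_set Omega ->
  smooth u -> H2 Omega u.
Proof.
move=> mO bO su; split; first by apply: continuous_L2 => //; exact: smooth_continuous.
move=> s _; exists (partials (rev s) u); last exact: smooth_weak_derivative.
by apply: continuous_L2 => //; apply: smooth_continuous; exact: smooth_partials.
Qed.

End WeakDerivative.

(** * Bump functions and the fundamental lemma *)

Section FlatFunctions.
Context {R : realType}.

(* The flat functions [P(1/t) exp(-1/t)], extended by zero to [t <= 0]. *)
Definition flat (P : {poly R}) (t : R) : R :=
  if 0 < t then P.[t^-1] * expR (- t^-1) else 0.

(** Each monomial obeys [s^i <= i! e^s], a single term of the exponential series, hence the bound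
    with factorials. *)
Lemma poly_expR_bounded (P : {poly R}) :
  exists2 C : R, 0 <= C & forall s, 0 < s -> `|P.[s]| * expR (- s) <= C.
Proof.
exists (\sum_(i < size P) `|P`_i| * (i`!)%:R) => [|s s0].
  by apply: sumr_ge0 => i _; rewrite mulr_ge0.
rewrite horner_coef (le_trans (ler_wpM2r (expR_ge0 _) (ler_norm_sum _ _ _)))//.
rewrite mulr_suml ler_sum// => i _; rewrite normrM -mulrA ler_wpM2l//.
rewrite expRN ler_pdivrMr ?expR_gt0// ger0_norm ?exprn_ge0 ?(ltW s0)//.
case: (val i) => [|n].
  by rewrite expr0 fact0 mul1r (le_trans _ (expR_ge1Dx s))// lerDl ltW.
have := expR_ge1Dxn n (ltW s0) => H.
rewrite -ler_pdivrMl ?ltr0n ?fact_gt0// mulrC.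
by rewrite (le_trans _ H)// lerDr.
Qed.

Lemma is_derive0_sqr (f : R -> R) (C : R) :
  (forall h, `|f h| <= C * h ^+ 2) -> is_derive (0 : R) 1 f 0.
Proof.
move=> Hf.
have f0 : f 0 = 0.
  by apply/eqP; rewrite -normr_le0; have := Hf 0; rewrite expr0n mulr0.
have H : h^-1 *: ((f \o shift 0) (h *: 1) - f 0) @[h --> 0^'] --> (0:R).
  apply/cvgr0Pnorm_lt => e e0; near=> h.
  rewrite /= f0 subr0 addr0 [_%:A]mulr1.
  have h0 : h != 0 by near: h; exact: nbhs_dnbhs_neq.
  rewrite [_ *: _]/(_ * _) normrM normfV mulrC ltr_pdivrMr ?normr_gt0//.
  apply: le_lt_trans (Hf h) _.
  have C1 : C * h ^+ 2 <= `|C| * `|h| * `|h|.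
    rewrite -mulrA -expr2 -normrX (ger0_norm (sqr_ge0 h)).
    by rewrite ler_wpM2r ?sqr_ge0// ler_norm.
  apply: (le_lt_trans C1); rewrite ltr_pM2r ?normr_gt0//.
  rewrite (@le_lt_trans _ _ ((`|C| + 1) * `|h|))//.
    by rewrite ler_wpM2r// lerDl.
  rewrite mulrC -ltr_pdivlMr ?ltr_wpDl//.
  by near: h; apply: dnbhs0_lt; rewrite divr_gt0// ltr_wpDl.
by split; [apply/cvg_ex; exists 0|exact/cvg_lim].
Unshelve. all: by end_near. Qed.

(** For [t > 0], differentiating in [1/t] gives [t^-2 (P - P')(1/t) exp(-1/t)], so flat functions
    are stable under derivation. At 0, boundedness of [s^2 P(s) exp(-s)] gives [O(h^2)] decay and
    hence derivative 0. *)
Lemma is_derive_flat P (t : R) :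
  is_derive t 1 (flat P) (flat ('X^2 * (P - P^`())) t).
Proof.
have [t0|t0|<-] := ltgtP 0 t.
- have H : is_derive t 1 (fun t => P.[t^-1] * expR (- t^-1))
      (flat ('X^2 * (P - P^`())) t).
    have Hi : is_derive t 1 (fun t : R => t^-1) (- t ^- 2).
      have tn0 : t != 0 by rewrite gt_eqF.
      apply: DeriveDef; first exact: (@derivableV _ _ id).
      by rewrite (@deriveV _ _ id)// derive_id [_ *: _]mulr1.
    have HP : is_derive t 1 (fun t : R => P.[t^-1]) (P^`().[t^-1] * - t ^- 2).
      apply: (@is_derive1_comp _ (horner P)) => //.
    have HE : is_derive t 1 (fun t : R => expR (- t^-1)) (expR (- t^-1) * - - t ^- 2).
      by apply: (@is_derive1_comp _ expR).
    move: (is_deriveM HP HE) => HM; apply: (is_derive_eq HM).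
    by rewrite /flat t0 !hornerE/= exprVn /GRing.scale/=; ring.
  apply: near_eq_is_derive H; near=> s; rewrite /flat ifT//.
  by near: s; exact: lt_nbhsr.
- rewrite {2}/flat ltNge (ltW t0)/=.
  apply: near_eq_is_derive (is_derive_cst 0 t 1); near=> s.
  by rewrite /flat ltNge ltW//; near: s; exact: lt_nbhsl.
- rewrite {2}/flat ltxx.
  have [C C0 HC] := poly_expR_bounded ('X^2 * P).
  apply: (@is_derive0_sqr _ C) => h; rewrite /flat.
  case: ifPn => h0; last by rewrite normr0 mulr_ge0// sqr_ge0.
  have hi : 0 < h^-1 by rewrite invr_gt0.
  have := HC _ hi; rewrite hornerM hornerXn normrM normrX (ger0_norm (ltW hi)).
  rewrite normrM (ger0_norm (expR_ge0 _)) -mulrA exprVn.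
  by rewrite mulrC ler_pdivrMr// exprn_gt0.
Unshelve. all: by end_near. Qed.

Lemma flat1_ge0 t : 0 <= flat 1 t.
Proof. by rewrite /flat; case: ifP => // _; rewrite hornerC mul1r expR_ge0. Qed.

Lemma flat1_le1 t : flat 1 t <= 1.
Proof.
rewrite /flat; case: ifPn => // t0.
by rewrite hornerC mul1r -expR0 ler_expR oppr_le0 invr_ge0 ltW.
Qed.

Lemma flat1_eq0 t : t <= 0 -> flat 1 t = 0.
Proof. by move=> t0; rewrite /flat ltNge t0. Qed.

Lemma cvg_flat1 (c : R) : 0 < c -> flat 1 (n.+1%:R * c) @[n --> \oo] --> (1 : R).
Proof.
move=> c0.
rewrite (_ : (fun n => _) = fun n => expR (- (n.+1%:R^-1 * c^-1))); last first.
  apply/funext => n; rewrite /flat mulr_gt0// hornerC mul1r.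
  by rewrite invfM.
rewrite -[X in _ --> X](expR0 R).
apply: (@cvg_comp _ _ _ (fun n => - (n.+1%:R^-1 * c^-1)) expR _ (nbhs 0)); last first.
  exact: continuous_expR.
rewrite -oppr0 -(mul0r c^-1); apply: cvgN; apply: cvgM; last exact: cvg_cst.
exact: cvg_harmonic.
Qed.

End FlatFunctions.

Section FundamentalLemma.
Context {R : realType} {d : nat}.
Local Notation E := 'rV[R]_d.
Local Notation mu := (@lebesgue_rV R d).
Implicit Types (a b : E) (Omega : set E) (g f : E -> R).

Definition obox a b : set E := box (fun i => `]a 0 i, b 0 i[).
Definition cbox a b : set E := box (fun i => `[a 0 i, b 0 i]).

Lemma cbox_closed a b : closed (cbox a b).
Proof.
apply: compact_closed; first exact: norm_hausdorff.
exact: (@rV_compact _ d (fun i => `[a 0 i, b 0 i]%classic) (fun=> @segment_compact _ _ _)).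
Qed.

(** Smooth functions with values in [0, 1] that vanish off the open box and tend pointwise to its
    indicator: the factor [n.+1] sends each exponent [-1/((n+1)c)] to 0. *)
Definition bump a b (n : nat) (x : E) : R :=
  \prod_(i < d) (flat 1 (n.+1%:R * (x 0 i - a 0 i)) * flat 1 (n.+1%:R * (b 0 i - x 0 i))).

Lemma smooth_flat1 (c e : R) (i : 'I_d) : smooth (fun x : E => flat 1 (c * x 0 i + e)).
Proof.
have -> : (fun x : E => flat 1 (c * x 0 i + e)) =
    fun x => flat 1 (dot (c *: delta_mx 0 i) x + e).
  apply/funext => x; congr (flat _ (_ + _)).
  rewrite /dot (bigD1 i)//= big1 ?addr0 => [|j ji]; rewrite !mxE !eqxx/=.
    by rewrite mulr1.
  by rewrite (negbTE ji) mulr0 mul0r.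
have /(_ _ (flat 1) (c *: delta_mx 0 i) e) := @smooth_dot R d (fun h : R -> R => exists P, h = flat P).
apply; last by exists 1.
move=> _ [P ->]; exists (flat ('X^2 * (P - P^`()))); first by eexists.
exact: is_derive_flat.
Qed.

Lemma smooth_bump a b n : smooth (bump a b n).
Proof.
apply: smooth_prod => i; apply: smooth_mul.
  have -> : (fun x : E => flat 1 (n.+1%:R * (x 0 i - a 0 i))) =
      fun x => flat 1 (n.+1%:R * x 0 i + - (n.+1%:R * a 0 i)).
    by apply/funext => x; rewrite mulrBr.
  exact: smooth_flat1.
have -> : (fun x : E => flat 1 (n.+1%:R * (b 0 i - x 0 i))) =
      fun x => flat 1 (- n.+1%:R * x 0 i + n.+1%:R * b 0 i).
  by apply/funext => x; rewrite mulrBr mulNr addrC.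
exact: smooth_flat1.
Qed.

Lemma bump_ge0 a b n x : 0 <= bump a b n x.
Proof. by apply: prodr_ge0 => i _; rewrite mulr_ge0// flat1_ge0. Qed.

Lemma bump_le1 a b n x : bump a b n x <= 1.
Proof.
rewrite /bump -[leRHS](@big1 _ 1 *%R _ (index_enum 'I_d) xpredT (fun=> 1))//.
apply: ler_prod => i _; rewrite mulr_ge0 ?flat1_ge0//=.
by rewrite mulr_ile1// ?flat1_ge0 ?flat1_le1.
Qed.

Lemma bump_out a b n x : ~ obox a b x -> bump a b n x = 0.
Proof.
move=> xab; have [i Hi] : exists i, ~ x 0 i \in `]a 0 i, b 0 i[.
  by apply/existsNP => H; apply: xab.
apply/eqP/prodf_eq0; exists i => //; move/negP: Hi.
rewrite in_itv/= negb_and -!leNgt => /orP[H|H].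
  by rewrite flat1_eq0 ?mul0r// mulr_ge0_le0// subr_le0.
by rewrite mulrC flat1_eq0 ?mul0r// mulr_ge0_le0// subr_le0.
Qed.

Lemma cvg_bump a b x : bump a b n x @[n --> \oo] --> (\1_(obox a b) x : R).
Proof.
rewrite indicE; case: (boolP (x \in _)) => [|/negP] xab; last first.
  rewrite (_ : (fun n => _) = cst 0); first exact: cvg_cst.
  by apply/funext => n; apply: bump_out => /mem_set.
rewrite inE in xab.
rewrite [X in _ --> X](_ : _ = \prod_(i < d) (1 * 1)); last first.
  by rewrite mul1r big1.
apply: (@cvg_big R _ *%R 1 xpredT); first exact: mul_continuous.
move=> i _; have := xab i; rewrite in_itv/= => /andP[ax xb].
by apply: cvgM; apply: cvg_flat1; rewrite subr_gt0.
Qed.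

Lemma bump_test Omega a b n : cbox a b `<=` Omega -> test_function Omega (bump a b n).
Proof.
move=> abO.
have H : closure [set x | bump a b n x != 0] `<=` cbox a b.
  rewrite [X in _ `<=` X]((closure_id (cbox a b)).1 (@cbox_closed a b)).
  apply: closure_subset => x /= Hx i.
  have : obox a b x by apply: contrapT => /(@bump_out _ _ n) H; rewrite H eqxx in Hx.
  by move=> /(_ i); exact: subset_itv_oo_cc.
split; first exact: smooth_bump.
- apply: subclosed_compact H; first exact: closed_closure.
  exact: (@rV_compact _ d (fun i => `[a 0 i, b 0 i]%classic) (fun=> @segment_compact _ _ _)).
- exact: subset_trans H abO.
Qed.

Lemma obox_subset_cbox a b : obox a b `<=` cbox a b.
Proof. by move=> x xab i; apply: subset_itv_oo_cc; exact: xab. Qed.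

Lemma measurable_obox a b : measurable (obox a b).
Proof. exact: measurable_box. Qed.

(** Dominated convergence along the bumps, with [|g|] as the dominating function. *)
Lemma integral_obox_eq0 Omega g a b : measurable Omega ->
  mu.-integrable Omega (EFin \o g) ->
  (forall f, test_function Omega f -> \int[mu]_(x in Omega) (g x * f x) = 0) ->
  cbox a b `<=` Omega -> (\int[mu]_(x in obox a b) (g x)%:E = 0)%E.
Proof.
move=> mO ig Hg abO.
have mg : measurable_fun Omega g by apply/measurable_EFinP; case/integrableP: ig.
have mb n : measurable_fun Omega (bump a b n).
  by apply: measurable_funS (continuous_measurable_rV (smooth_continuous (smooth_bump a b n))).
have abO' : obox a b `<=` Omega by apply: subset_trans abO; exact: obox_subset_cbox.
have mi : measurable_fun Omega (\1_(obox a b) : E -> R).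
  by apply: measurable_indic; exact: measurable_obox.
have E0 n : (\int[mu]_(x in Omega) (g x * bump a b n x)%:E = 0)%E.
  have := Hg _ (@bump_test Omega a b n abO); rewrite /Rintegral => H.
  rewrite -[LHS]fineK ?H//.
  apply: integrable_fin_num => //.
  apply: le_integrable ig => //.
    by apply/measurable_EFinP; exact: measurable_funM.
  move=> x _ /=; rewrite lee_fin normrM (ger0_norm (bump_ge0 _ _ _ _)).
  by rewrite ler_piMr// bump_le1.
have [|||||_ _] := @dominated_convergence _ _ _ mu Omega mO
  (fun n x => (g x * bump a b n x)%:E) (fun x => (g x * \1_(obox a b) x)%:E)
  (fun x => `|g x|%:E).
- by move=> n; apply/measurable_EFinP; exact: measurable_funM.
- by apply/measurable_EFinP; exact: measurable_funM.
- apply: aeW => x _; apply: cvg_EFin; first by near=> n.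
  by apply: cvgM; [exact: cvg_cst|exact: cvg_bump].
- exact: (@integrable_norm _ _ _ mu Omega g).
- apply: aeW => x n _; rewrite lee_fin normrM (ger0_norm (bump_ge0 _ _ _ _)).
  by rewrite ler_piMr// bump_le1.
rewrite (_ : [sequence _]_n = cst 0%E); last by apply/funext => n; exact: E0.
move=> /cvg_lim; rewrite lim_cst// => ->//.
rewrite [LHS](_ : _ = \int[mu]_(x in Omega) (((EFin \o g) \_ (obox a b)) x))%E; last first.
  by rewrite -integral_mkcondr (setIidr abO').
apply: eq_integral => x _; rewrite patchE indicE.
by case: (x \in obox a b); rewrite /= ?mulr1 ?mulr0.
Unshelve. all: by end_near. Qed.

Lemma obox_setI a b a' b' : obox a b `&` obox a' b' =
  obox (\row_i Num.max (a 0 i) (a' 0 i)) (\row_i Num.min (b 0 i) (b' 0 i)).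
Proof.
apply/seteqP; split=> x.
  by move=> [H H'] i; have := H i; have := H' i; rewrite !in_itv/= !mxE lt_min gt_max
    => /andP[-> ->] /andP[-> ->].
move=> H; split=> i; have := H i; rewrite !in_itv/= !mxE lt_min gt_max
    => /andP[/andP[H1 H2] /andP[H3 H4]]; exact/andP.
Qed.

Lemma ball_obox (c : E) (r : R) : 0 < r -> ball c r = obox (c - const_mx r) (c + const_mx r).
Proof.
move=> r0; apply/seteqP; split=> [x [_ H] i|x H].
  by have := H 0 i; rewrite in_itv/= !mxE /ball/= ltr_distlC.
split=> // j i; rewrite (ord1 j) /ball/= ltr_distlC.
by have := H i; rewrite in_itv/= !mxE.
Qed.

(** Balls of the sup norm are open boxes, and every open set is a countable union of balls with
    rational data. This makes the boxes, stable under intersection, available for Dynkin's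
    theorem. *)
Lemma measurable_obox_gen : @measurable _ E = <<s [set A | exists a b, A = obox a b] >>.
Proof.
apply/seteqP; split.
  apply: smallest_sub; first exact: smallest_sigma_algebra.
  move=> U oU; rewrite (open_rat_balls oU) bigcup_mkcond.
  pose F (m : nat) : set E :=
    if @unpickle ('rV[rat]_d * nat)%type m is Some p then
      if p \in [set p : 'rV[rat]_d * nat |
        ball (map_mx ratr p.1 : E) (p.2.+1%:R^-1 : R) `<=` U]
      then ball (map_mx ratr p.1 : E) (p.2.+1%:R^-1 : R) else set0
    else set0.
  rewrite [X in _ X](_ : _ = \bigcup_m F m); last first.
    apply/seteqP; split=> [x [p _ px]|x [m _]].
      by exists (pickle p) => //; rewrite /F pickleK.
    by rewrite /F; case: unpickle => // p px; exists p.
  have [S0 _ SU] := @smallest_sigma_algebra _ setT [set A | exists a b, A = obox a b].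
  apply: SU => m; rewrite /F; case: unpickle => // p; case: ifP => // _.
  rewrite ball_obox ?invr_gt0//.
  by apply: sub_sigma_algebra; do 2 eexists.
apply: smallest_sub; first exact: sigma_algebra_measurable.
by move=> _ [a [b ->]]; exact: measurable_obox.
Qed.

(** Among Borel sets [S], those with [g] of integral zero over the part of [S] in the box form a
    Dynkin system containing all boxes. Hence [g] has integral zero over every measurable part of
    the box, and so vanishes there almost everywhere. *)
Lemma ae_eq0_obox Omega g a b : measurable Omega ->
  mu.-integrable Omega (EFin \o g) ->
  (forall f, test_function Omega f -> \int[mu]_(x in Omega) (g x * f x) = 0) ->
  cbox a b `<=` Omega -> {ae mu, forall x, obox a b x -> g x = 0}.
Proof.
move=> mO ig Hg abO.
have abO' : obox a b `<=` Omega by apply: subset_trans abO; exact: obox_subset_cbox.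
have mab := measurable_obox a b.
have igK : mu.-integrable (obox a b) (EFin \o g) by apply: integrableS ig.
have igS S : measurable S -> mu.-integrable (S `&` obox a b) (EFin \o g).
  by move=> mS; apply: integrableS igK => //; exact: measurableI.
have IK : (\int[mu]_(x in obox a b) (g x)%:E = 0)%E.
  exact: (integral_obox_eq0 mO ig Hg abO).
have H (S : set E) : measurable S -> (\int[mu]_(x in S `&` obox a b) (g x)%:E = 0)%E.
  move=> mS; move: (mS); rewrite [X in X S]measurable_obox_gen; move: S {mS}.
  apply: (@dynkin_induction _ _ _ _ measurable_obox_gen).
  - move=> _ _ [a1 [b1 ->]] [a2 [b2 ->]]; rewrite obox_setI.
    by do 2 eexists.
  - by rewrite setTI.
  - move=> _ [a1 [b1 ->]]; rewrite obox_setI.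
    apply: (integral_obox_eq0 mO ig Hg).
    move=> x Hx; apply: abO => i; have := Hx i.
    by rewrite !mxE !in_itv/= le_min ge_max => /andP[/andP[_ ->] /andP[_ ->]].
  - move=> S mS IS.
    have KE : obox a b = (S `&` obox a b) `|` (~` S `&` obox a b).
      by rewrite -setIUl setUv setTI.
    have := IK; rewrite [in X in X -> _]KE integral_setU_EFin//.
    + by rewrite IS add0e.
    + exact: measurableI.
    + by apply: measurableI => //; exact: measurableC.
    + rewrite -KE.
      by apply/measurable_EFinP; case/integrableP: igK.
    + by rewrite disj_set2E setIACA setICr set0I.
  - move=> F mF tF IF; rewrite setI_bigcupl integral_bigcup.
    + by rewrite eseries0// => i _ _; exact: IF.
    + exact: trivIset_setIr.
    + by move=> k; exact: measurableI.
    + by rewrite -setI_bigcupl; apply: igS; exact: bigcup_measurable.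
have := @integral_ae_eq _ _ _ mu _ mab (cst 0%E) (EFin \o g) igK (measurable_cst _).
move=> /(_ _)[].
  move=> S Sab mS; rewrite integral0 -(setIidl Sab); exact: H.
move=> N [mN N0 sN]; exists N; split=> // x /= Hx; apply: sN => /= H'.
by apply: Hx => /H'[].
Qed.

Lemma ball_ae (Omega : set E) (P : E -> Prop) : open Omega ->
  (forall a b, cbox a b `<=` Omega -> {ae mu, forall x, obox a b x -> P x}) ->
  {ae mu, forall x, Omega x -> P x}.
Proof.
move=> oO HP.
(* The open rational balls inside Omega may have closures that leave it, while [HP] asks for closed
   boxes in Omega; each ball is therefore exhausted by the smaller boxes of half-side [r p m]. The
   family stays countable. *)
pose r (p : 'rV[rat]_d * nat) (m : nat) : R := p.2.+1%:R^-1 - m.+1%:R^-1.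
pose c (p : 'rV[rat]_d * nat) : E := map_mx ratr p.1.
pose Q (n m : nat) (x : E) : Prop :=
  if @unpickle ('rV[rat]_d * nat)%type n is Some p then
    ball (c p) (p.2.+1%:R^-1 : R) `<=` Omega ->
    obox (c p - const_mx (r p m)) (c p + const_mx (r p m)) x -> P x
  else True.
have HQ n m : {ae mu, forall x, Q n m x}.
  rewrite /Q; case: unpickle => [p|]; last exact: aeW.
  have [pO|pO] := pselect (ball (c p) (p.2.+1%:R^-1 : R) `<=` Omega); last exact: aeW.
  have := HP (c p - const_mx (r p m)) (c p + const_mx (r p m)).
  move=> /(_ _)[x Hx|N [mN N0 sN]].
    apply: pO; split=> // j i; rewrite (ord1 j).
    have := Hx i; rewrite in_itv/= !mxE /ball/= ltr_distlC /r => /andP[H1 H2].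
    have m0 : 0 < (m.+1%:R^-1 : R) by rewrite invr_gt0.
    move: H1 H2 m0; rewrite /c; set A := _.+1%:R^-1; set B := _.+1%:R^-1 => H1 H2 m0.
    by apply/andP; split; lra.
  exists N; split=> // x /= Hx; apply: sN => /= H; apply: Hx => _; exact: H.
have {HQ}[N [mN N0 sN]] : {ae mu, forall x n m, Q n m x}.
  by apply/ae_foralln => n; apply/ae_foralln => m; exact: HQ.
exists N; split=> // x /= Hx; apply: sN => /= H; apply: Hx => Ox.
have : (\bigcup_(p in [set p : 'rV[rat]_d * nat |
        ball (map_mx ratr p.1 : E) (p.2.+1%:R^-1 : R) `<=` Omega])
      ball (map_mx ratr p.1 : E) (p.2.+1%:R^-1 : R)) x.
  by rewrite -open_rat_balls.
move=> [p /= pO px].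
have [m Hm] : exists m : nat, forall i, `|c p 0 i - x 0 i| < r p m.
  pose M := \big[Num.max/0]_(i < d) `|c p 0 i - x 0 i|.
  have Mp : M < p.2.+1%:R^-1.
    apply/bigmax_ltP; split; first by rewrite invr_gt0.
    by move=> i _; have [_ /(_ 0 i)] := px.
  have e0 : 0 < p.2.+1%:R^-1 - M by rewrite subr_gt0.
  exists (Num.truncn (p.2.+1%:R^-1 - M)^-1) => i.
  have : ((Num.truncn (p.2.+1%:R^-1 - M)^-1).+1%:R^-1 : R) < p.2.+1%:R^-1 - M.
    by rewrite -[ltRHS]invrK ltf_pV2 ?posrE ?invr_gt0// truncnS_gt.
  rewrite ltrBrDl -ltrBrDr => H2; apply: le_lt_trans H2.
  by apply/bigmax_geP; right; exists i.
have := H (pickle p) m; rewrite /Q pickleK; apply => // i.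
by have := Hm i; rewrite in_itv/= /c !mxE -ltr_distlC.
Qed.

Lemma fundamental_lemma Omega g : open Omega ->
  mu.-integrable Omega (EFin \o g) ->
  (forall f, test_function Omega f -> \int[mu]_(x in Omega) (g x * f x) = 0) ->
  {ae mu, forall x, Omega x -> g x = 0}.
Proof.
move=> oO ig Hg; apply: (ball_ae oO) => a b abO.
by apply: ae_eq0_obox ig Hg abO; exact: open_measurable_rV.
Qed.

End FundamentalLemma.

(** * The quadratic form on smooth functions *)

Section QuadraticDensity.
Context {R : realType} {d : nat}.
Implicit Types A B : 'I_d -> 'I_d -> R.

Definition density (a : R) A B : R :=
  (1 - a) * (\sum_(i < d) \sum_(j < d) A i j * B i j)
  + a * ((\sum_(i < d) A i i) * (\sum_(i < d) B i i)).

Lemma densityC a A B : density a A B = density a B A.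
Proof.
rewrite /density [X in a * X]mulrC; congr (_ * _ + _).
by apply: eq_bigr => i _; apply: eq_bigr => j _; rewrite mulrC.
Qed.

Lemma density_sum a n (c : 'I_n -> R) (A : 'I_n -> 'I_d -> 'I_d -> R) B :
  density a (fun i j => \sum_(k < n) c k * A k i j) B = \sum_(k < n) c k * density a (A k) B.
Proof.
rewrite /density.
under [RHS]eq_bigr do rewrite mulrDr.
rewrite big_split/=; congr (_ + _).
  transitivity (\sum_(k < n) \sum_(i < d) \sum_(j < d)
      c k * ((1 - a) * (A k i j * B i j))).
    rewrite [RHS]exchange_big mulr_sumr; apply: eq_bigr => i _ /=.
    rewrite [RHS]exchange_big mulr_sumr; apply: eq_bigr => j _ /=.
    rewrite mulr_suml mulr_sumr; apply: eq_bigr => k _.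
    ring.
  apply: eq_bigr => k _; rewrite !mulr_sumr; apply: eq_bigr => i _.
  by rewrite !mulr_sumr.
transitivity (\sum_(k < n) \sum_(i < d) c k * (a * (A k i i * \sum_(j < d) B j j))).
  rewrite [RHS]exchange_big mulr_suml mulr_sumr; apply: eq_bigr => i _ /=.
  rewrite mulr_suml mulr_sumr; apply: eq_bigr => k _.
  ring.
by apply: eq_bigr => k _; rewrite mulr_suml !mulr_sumr.
Qed.

(** Cauchy-Schwarz against the constant vector; twice the difference of the two sides is the double
    sum of [(x i - x j)^2]. *)
Lemma sqr_sum_le (x : 'I_d -> R) :
  (\sum_(i < d) x i) ^+ 2 <= d%:R * \sum_(i < d) x i ^+ 2.
Proof.
have : 0 <= \sum_(i < d) \sum_(j < d) (x i - x j) ^+ 2.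
  by apply: sumr_ge0 => i _; apply: sumr_ge0 => j _; exact: sqr_ge0.
have -> : \sum_(i < d) \sum_(j < d) (x i - x j) ^+ 2 =
    (d%:R * \sum_(i < d) x i ^+ 2) *+ 2 - (\sum_(i < d) x i) ^+ 2 *+ 2.
  transitivity (\sum_(i < d) (d%:R * x i ^+ 2 + \sum_(j < d) x j ^+ 2
      - (x i * \sum_(j < d) x j) *+ 2)).
    apply: eq_bigr => i _; under eq_bigr do rewrite sqrrB.
    rewrite !big_split/= sumr_const card_ord -[x i ^+ 2 *+ d]mulr_natl addrAC.
    by congr (_ + _ + _); rewrite sumrN mulr_sumr sumrMnl.
  rewrite !big_split/= sumr_const card_ord sumrN sumrMnl -mulr_suml -mulr_sumr.
  by rewrite -expr2 -[(\sum_(j < d) _) *+ d]mulr_natl -mulr2n.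
by rewrite subr_ge0 lerMn2r.
Qed.

(** For [a < 0] the trace term is controlled by [T^2 <= d F], where [T] is the trace and [F] the
    squared Frobenius norm: the density is at least [(1 + a (d - 1)) F], and the lower bound on [a]
    makes this factor nonnegative. *)
Lemma density_ge0 a A : a < 1 -> ((1 < d)%N -> - (d%:R - 1)^-1 < a) -> 0 <= density a A A.
Proof.
move=> a1 ad; rewrite /density -expr2.
set F := \sum_i _; set T := \sum_i _.
have F0 : 0 <= F.
  by apply: sumr_ge0 => i _; apply: sumr_ge0 => j _; rewrite -expr2 sqr_ge0.
have TF : T ^+ 2 <= d%:R * F.
  apply: le_trans (sqr_sum_le _) _; rewrite ler_wpM2l//; apply: ler_sum => i _.
  rewrite (bigD1 i)//= -expr2 lerDl.
  by apply: sumr_ge0 => j _; rewrite -expr2 sqr_ge0.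
have [a0|a0] := leP 0 a.
  by rewrite addr_ge0// mulr_ge0// ?sqr_ge0//; lra.
have [d1|d1] := ltnP 1 d; last first.
  have {}TF : T ^+ 2 <= F.
    by apply: le_trans TF _; rewrite ler_piMl// (ler_nat R d 1).
  have : 0 <= - a * (F - T ^+ 2) by rewrite mulr_ge0 ?subr_ge0// oppr_ge0 ltW.
  by move: F0; rewrite mulrBr => F0; lra.
have {}ad := ad d1.
have d1R : 0 < (d%:R - 1 : R) by rewrite subr_gt0 ltr1n.
have : 0 <= 1 + a * (d%:R - 1).
  by rewrite -lerBlDl sub0r -ler_pdivrMr// mulN1r ltW.
have : 0 <= - a * (d%:R * F - T ^+ 2) by rewrite mulr_ge0 ?subr_ge0// oppr_ge0 ltW.
rewrite mulrBr => H1 H2; have := mulr_ge0 F0 H2; rewrite mulrDr mulr1 mulrCA mulrBr => H3.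
by move: H1 H3; set D := d%:R; lra.
Qed.

End QuadraticDensity.

Section BoundedIntegrals.
Context {R : realType} {d : nat}.
Local Notation E := 'rV[R]_d.
Local Notation mu := (@lebesgue_rV R d).
Variable Omega : set E.
Hypotheses (mO : measurable Omega) (bO : bounded_set Omega).
Implicit Types (u v w f : E -> R).

Lemma continuous_integrable u : continuous u -> mu.-integrable Omega (EFin \o u).
Proof. exact: continuous_integrable_rV. Qed.

Lemma continuous_mul u v : continuous u -> continuous v -> continuous (fun x => u x * v x).
Proof. by move=> cu cv x; apply: (@continuousM _ _ u v); [exact: cu|exact: cv]. Qed.

Lemma continuous_bounded u : continuous u ->
  exists2 C, 0 <= C & forall x, Omega x -> `|u x| <= C.
Proof.
move=> cu; have [r r0 Or] := bounded_cube bO.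
have : compact (u @` @cube R d r).
  apply: continuous_compact (@compact_cube _ d r).
  by move=> x; apply: continuous_subspaceT.
move=> /compact_bounded [M [_ HM]]; exists (`|M| + 1); first by rewrite addr_ge0.
move=> x Ox; apply: HM; first by rewrite ltr_pwDr// ler_norm.
by exists x => //; exact: Or.
Qed.

Lemma continuous_sumr (I : Type) (r : seq I) (F : I -> E -> R) :
  (forall i, continuous (F i)) -> continuous (fun x => \sum_(i <- r) F i x).
Proof.
by move=> cF; apply: (@continuous_big R _ +%R 0 xpredT) => //; exact: add_continuous.
Qed.

Lemma Rintegral_lin (n : nat) (c : 'I_n -> R) (h : 'I_n -> E -> R) :
  (forall i, continuous (h i)) ->
  \int[mu]_(x in Omega) (\sum_(i < n) c i * h i x) =
  \sum_(i < n) c i * \int[mu]_(x in Omega) h i x.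
Proof.
move=> ch; elim: n c h ch => [|n IHn] c h ch.
  rewrite big_ord0 (@eq_Rintegral _ _ _ mu Omega (cst 0)); last by move=> x _; rewrite big_ord0.
  by rewrite Rintegral_cst// mul0r.
rewrite big_ord_recl -IHn//.
rewrite (@eq_Rintegral _ _ _ mu Omega (fun x => c ord0 * h ord0 x +
    \sum_(i < n) c (lift ord0 i) * h (lift ord0 i) x)); last first.
  by move=> x _; rewrite big_ord_recl.
rewrite RintegralD// ?RintegralZl//.
- exact: continuous_integrable.
- by apply: continuous_integrable; apply: continuous_mul => //; exact: cst_continuous.
- apply: continuous_integrable; apply: continuous_sumr => i.
  by apply: continuous_mul => //; exact: cst_continuous.
Qed.

End BoundedIntegrals.

Section ClassicalForm.
Context {R : realType} {d : nat}.
Local Notation E := 'rV[R]_d.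
Local Notation mu := (@lebesgue_rV R d).
Variable Omega : set E.
Hypotheses (oO : open Omega) (bO : bounded_set Omega).
Implicit Types (u v w f : E -> R) (s : seq 'I_d).

Let mO : measurable Omega := open_measurable_rV oO.

(** [|v| <= 1 + v^2], and constants are integrable over the bounded set Omega. *)
Lemma L2_integrable v : L2 Omega v -> mu.-integrable Omega (EFin \o v).
Proof.
move=> [mv iv].
have : mu.-integrable Omega (fun x => (1 + v x ^+ 2)%:E).
  have := integrableD mO (continuous_integrable mO bO (@cst_continuous _ _ (1 : R))) iv.
  by apply: eq_integrable => // x _ /=; rewrite EFinD.
apply: le_integrable => //; first exact/measurable_EFinP.
move=> x _; rewrite /= lee_fin [leRHS]ger0_norm ?addr_ge0 ?sqr_ge0//.
rewrite -[v x ^+ 2]real_normK ?num_real//.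
set t := `|v x|; have := sqr_ge0 (t - 1); have := sqr_ge0 t; nra.
Qed.

Lemma L2_mul_integrable v f : L2 Omega v -> continuous f ->
  mu.-integrable Omega (EFin \o (fun x => v x * f x)).
Proof.
move=> L2v cf; have [C C0 HC] := continuous_bounded bO cf.
have iv := integrableZl mO C (L2_integrable L2v).
have mf : measurable_fun Omega f by apply: measurable_funS (continuous_measurable_rV cf).
apply: le_integrable iv => //.
  by case: L2v => mv _; apply/measurable_EFinP; exact: measurable_funM.
move=> x Ox; rewrite lee_fin/= !normrM (ger0_norm C0) mulrC ler_wpM2r//.
exact: HC.
Qed.

Lemma weak_partials_spec u s : smooth u ->
  L2 Omega (weak_partials Omega s u) /\ weak_derivative Omega s u (weak_partials Omega s u).
Proof.
move=> su; rewrite /weak_partials; case: xgetP => [v -> []//|/(_ (partials (rev s) u))[]].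
split; last exact: smooth_weak_derivative.
by apply: continuous_L2 => //; apply: smooth_continuous; exact: smooth_partials.
Qed.

(** Both sides are weak derivatives of [u], so their difference is orthogonal to every test function
    and the fundamental lemma applies. The reversed list comes from integration by parts. *)
Lemma weak_partials_ae u s : smooth u ->
  {ae mu, forall x, Omega x -> weak_partials Omega s u x = partials (rev s) u x}.
Proof.
move=> su; have [L2v wv] := weak_partials_spec s su.
set v := weak_partials _ _ _ in L2v wv *; set w := partials _ _.
have cw : continuous w by apply: smooth_continuous; exact: smooth_partials.
have L2w : L2 Omega w by exact: continuous_L2.
have [|f tf|N [mN N0 sN]] := @fundamental_lemma R d Omega (fun x => v x - w x) oO.
- have := integrableB mO (L2_integrable L2v) (L2_integrable L2w).
  exact: eq_integrable.
- have := wv f tf; rewrite (smooth_weak_derivative s su tf).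
  move=> /(congr1 (fun t => (-1) ^+ size s * t)); rewrite !mulrA -expr2 sqrr_sign !mul1r => H.
  have cf : continuous f by case: tf => sf _ _; exact: smooth_continuous.
  rewrite (_ : (fun x => _) = fun x => v x * f x - w x * f x); last first.
    by apply/funext => x; rewrite mulrBl.
  by rewrite RintegralB//=; [rewrite -H subrr|exact: L2_mul_integrable..].
- exists N; split=> // x /= Hx; apply: sN => /= H; apply: Hx => /H /eqP.
  by rewrite subr_eq0 => /eqP.
Qed.

(* The order of the two derivatives is the one produced by
   [smooth_weak_derivative]. *)
Definition form_density (a : R) u v (x : E) : R :=
  density a (fun i j => partials [:: j; i] u x) (fun i j => partials [:: j; i] v x).

Definition cform a u v : R := \int[mu]_(x in Omega) form_density a u v x.
Definition dotL2 u v : R := \int[mu]_(x in Omega) (u x * v x).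

Lemma measurable_frobenius_hessian u : smooth u ->
  measurable_fun Omega (fun x => frobenius (hessian Omega u x) (hessian Omega u x)).
Proof.
move=> su; rewrite /frobenius.
apply: measurable_sum => i; apply: measurable_sum => j.
have m : measurable_fun Omega (fun x => hessian Omega u x i j).
  rewrite (_ : (fun x => _) = weak_partials Omega [:: i; j] u).
    by have [[]] := weak_partials_spec [:: i; j] su.
  by apply/funext => x; rewrite mxE.
exact: measurable_funM.
Qed.

Lemma measurable_laplacian u : smooth u -> measurable_fun Omega (laplacian Omega u).
Proof.
move=> su; apply: measurable_sum => i.
by have [[]] := weak_partials_spec [:: i; i] su.
Qed.

Lemma continuous_form_density a u v : smooth u -> smooth v ->
  continuous (form_density a u v).
Proof.
move=> su sv.
have cp s z : smooth z -> continuous (partials s z).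
  by move=> sz; apply: smooth_continuous; exact: smooth_partials.
move=> x; apply: (@continuousD _ _ _
  (fun x => (1 - a) * (\sum_(i < d) \sum_(j < d) partials [:: j; i] u x * partials [:: j; i] v x))
  (fun x => a * ((\sum_(i < d) partials [:: i; i] u x) * (\sum_(i < d) partials [:: i; i] v x)))).
  apply: continuous_mul; first exact: cst_continuous.
  apply: continuous_sumr => i; apply: continuous_sumr => j.
  by apply: continuous_mul; exact: cp.
apply: continuous_mul; first exact: cst_continuous.
by apply: continuous_mul; apply: continuous_sumr => i; exact: cp.
Qed.

(** The choice made by [weak_partials] changes the integrand on a null set only: finitely many
    second derivatives are involved, so their exceptional sets can be united. *)
Lemma biharmonic_form_smooth a u : smooth u -> biharmonic_form Omega a u u = cform a u u.
Proof.
move=> su; rewrite /biharmonic_form /cform /Rintegral; congr fine.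
apply: ae_eq_integral => //.
- apply/measurable_EFinP; apply: measurable_funD; apply: measurable_funM => //.
    exact: measurable_frobenius_hessian.
  by apply: measurable_funM; exact: measurable_laplacian.
- apply/measurable_EFinP; apply: measurable_funS (continuous_measurable_rV _) => //.
  exact: continuous_form_density.
have H : {ae mu, forall x, forall (i j : 'I_d), Omega x ->
    weak_partials Omega [:: i; j] u x = partials [:: j; i] u x}.
  apply: filter_forall => i; apply: filter_forall => j.
  exact: (@weak_partials_ae u [:: i; j] su).
case: H => N [mN N0 sN]; exists N; split=> // x /= Hx; apply: sN => /= H; apply: Hx => Ox.
congr (_%:E); rewrite /form_density /density /frobenius /laplacian.
congr ((1 - a) * _ + a * (_ * _)).
- by apply: eq_bigr => i _; apply: eq_bigr => j _; rewrite !mxE H.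
- by apply: eq_bigr => i _; rewrite H.
- by apply: eq_bigr => i _; rewrite H.
Qed.

Lemma rayleigh_smooth a u : smooth u -> rayleigh Omega a u = cform a u u / dotL2 u u.
Proof.
by move=> su; rewrite /rayleigh biharmonic_form_smooth.
Qed.

Lemma smooth_lin_comb n (b : 'I_n -> E -> R) c : (forall i, smooth (b i)) ->
  smooth (lin_comb b c).
Proof.
move=> sb; apply: (@smooth_sum _ _ _ _ xpredT (fun i x => c i * b i x)) => i.
by apply: smooth_mul => //; exact: smooth_cst.
Qed.

Lemma dotL2C u v : dotL2 u v = dotL2 v u.
Proof. by apply: eq_Rintegral => x _; rewrite mulrC. Qed.

Lemma cformC a u v : cform a u v = cform a v u.
Proof.
by apply: eq_Rintegral => x _; exact: densityC.
Qed.

Lemma dotL2_lin n (b : 'I_n -> E -> R) c v : (forall i, smooth (b i)) -> smooth v ->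
  dotL2 (lin_comb b c) v = \sum_(i < n) c i * dotL2 (b i) v.
Proof.
move=> sb sv; rewrite -(Rintegral_lin mO bO).
  by apply: eq_Rintegral => x _; rewrite /lin_comb mulr_suml; apply: eq_bigr => i _; rewrite mulrA.
by move=> i; apply: continuous_mul; apply: smooth_continuous.
Qed.

Lemma partials_lin_comb n (b : 'I_n -> E -> R) c s x : (forall i, smooth (b i)) ->
  partials s (lin_comb b c) x = \sum_(i < n) c i * partials s (b i) x.
Proof. by move=> sb; rewrite /lin_comb partials_sum. Qed.

Lemma cform_lin a n (b : 'I_n -> E -> R) c v : (forall i, smooth (b i)) -> smooth v ->
  cform a (lin_comb b c) v = \sum_(i < n) c i * cform a (b i) v.
Proof.
move=> sb sv; rewrite -(Rintegral_lin mO bO); last by move=> i; exact: continuous_form_density.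
apply: eq_Rintegral => x _; rewrite /form_density -density_sum; congr density.
by apply/funext => i; apply/funext => j; exact: (@partials_lin_comb _ _ _ [:: j; i]).
Qed.

Lemma dotL2_ge0 u : 0 <= dotL2 u u.
Proof. by apply: Rintegral_ge0 => x _; rewrite -expr2 sqr_ge0. Qed.

Lemma dotL2_eq0 u : continuous u -> dotL2 u u = 0 -> forall x, Omega x -> u x = 0.
Proof.
move=> cu u0 x Ox; apply/eqP; rewrite -sqrf_eq0 expr2; apply/eqP.
apply: (@continuous_ge0_integral0 R d Omega (fun x => u x * u x)) Ox => //.
- exact: continuous_mul.
- by move=> y; rewrite -expr2 sqr_ge0.
- rewrite -[LHS]fineK.
    by congr (_%:E).
  apply: integrable_fin_num => //.
  by apply: (continuous_integrable mO bO); exact: continuous_mul.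
Qed.

Lemma dotL2_ae0 u : continuous u -> ae_zero Omega u -> dotL2 u u = 0.
Proof.
move=> cu [N [mN N0 sN]]; rewrite /dotL2 /Rintegral.
rewrite (@ae_eq_integral _ _ _ _ _ (cst 0%E)) ?integral0//.
- apply/measurable_EFinP; apply: measurable_funS (continuous_measurable_rV _) => //.
  exact: continuous_mul.
- exists N; split=> // x /= Hx; apply: sN => /= H; apply: Hx => /H ->.
  by rewrite mulr0.
Qed.

(** Derivatives are local, so they vanish on the open set Omega with [u]. This places the kernel of
    the Gram matrix inside that of the stiffness matrix. *)
Lemma cform_eq0 a u v : (forall x, Omega x -> u x = 0) -> cform a u v = 0.
Proof.
move=> u0; rewrite /cform (@eq_Rintegral _ _ _ mu Omega (cst 0)); first by rewrite Rintegral_cst// mul0r.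
move=> x /set_mem Ox; rewrite /form_density.
have P s : partials s u x = 0.
  by rewrite (@partials_near _ _ Omega s u (fun=> 0))// partials_cst0.
have H : (fun i j => partials [:: j; i] u x) = fun _ _ => 0.
  by apply/funext => i; apply/funext => j; exact: (P [:: j; i]).
apply: (etrans (congr1 (fun A => density a A _) H)); rewrite /density.
under eq_bigr do under eq_bigr do rewrite mul0r.
under eq_bigr do rewrite sumr_const mul0rn.
by rewrite !sumr_const !mul0rn mul0r !mulr0 addr0.
Qed.

End ClassicalForm.

(** * Spectral theorem for symmetric pencils *)

Section RealSpectral.
Context {R : realType}.

Lemma dotE n (x y : 'rV[R]_n) : x *m y^T = (dot x y)%:M.
Proof.
apply/matrixP => i j; rewrite !ord1 !mxE eqxx mulr1n.
by apply: eq_bigr => k _; rewrite mxE.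
Qed.

Lemma dotC n (x y : 'rV[R]_n) : dot x y = dot y x.
Proof. by apply: eq_bigr => i _; rewrite mulrC. Qed.

Lemma dotZl n t (x y : 'rV[R]_n) : dot (t *: x) y = t * dot x y.
Proof. by rewrite dotC dotZr dotC. Qed.

Lemma dot_ge0 n (x : 'rV[R]_n) : 0 <= dot x x.
Proof. by apply: sumr_ge0 => i _; rewrite -expr2 sqr_ge0. Qed.

Lemma dot_eq0 n (x : 'rV[R]_n) : dot x x = 0 -> x = 0.
Proof.
move=> /eqP; rewrite psumr_eq0 => [/allP H|i _]; last by rewrite -expr2 sqr_ge0.
apply/rowP => i; rewrite mxE; apply/eqP.
by have := H i (mem_index_enum _); rewrite -expr2 sqrf_eq0.
Qed.

Lemma dot_mulmx n (A : 'M[R]_n) (x y : 'rV[R]_n) : A^T = A ->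
  dot (x *m A) y = dot x (y *m A).
Proof.
move=> As; have /matrixP/(_ 0 0) : x *m A *m y^T = x *m (y *m A)^T.
  by rewrite trmx_mul As mulmxA.
by rewrite !dotE !mxE eqxx !mulr1n.
Qed.

Lemma mulmxT_dot n k (C : 'M[R]_(k, n)) (x : 'rV[R]_n) i :
  (x *m C^T) 0 i = dot x (row i C).
Proof. by rewrite mxE; apply: eq_bigr => j _; rewrite !mxE. Qed.

Lemma dot_delta_eq (a b : R) : (a%:M : 'M[R]_1) = b%:M -> a = b.
Proof. by move=> /matrixP/(_ 0 0); rewrite !mxE eqxx !mulr1n. Qed.

(** First-order condition at a maximum: for small [t] the linear term dominates. The explicit choice
    [t = b / (|c| + 1)] gives [2 b^2 <= b^2]. *)
Lemma quad_le_eq0 (b c : R) : (forall t : R, 2 * t * b <= t ^+ 2 * c) -> b = 0.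
Proof.
move=> H; apply/eqP; rewrite -sqrf_eq0; apply/eqP.
have C0 : 0 < `|c| + 1 by rewrite ltr_wpDl.
have := H (b / (`|c| + 1)).
set D := `|c| + 1; rewrite -/D in C0.
have -> : 2 * (b / D) * b = 2 * b ^+ 2 / D by field; rewrite gt_eqF.
have -> : (b / D) ^+ 2 * c = b ^+ 2 * (c / D) / D by field; rewrite gt_eqF.
rewrite ler_pM2r ?invr_gt0// => H1.
have cD : c / D <= 1 by rewrite ler_pdivrMr// mul1r /D (le_trans (ler_norm c))// lerDl.
have : b ^+ 2 * (c / D) <= b ^+ 2 by rewrite ler_piMr ?sqr_ge0.
by have := sqr_ge0 b; lra.
Qed.

Lemma smooth_dotmx n (A : 'M[R]_n) : smooth (fun x : 'rV[R]_n => dot (x *m A) x).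
Proof.
apply: (@smooth_sum _ _ _ _ _ (fun i (x : 'rV[R]_n) => (x *m A) 0 i * x 0 i)) => i.
apply: smooth_mul; last exact: smooth_coord.
under eq_fun do rewrite mxE.
apply: (@smooth_sum _ _ _ _ _ (fun j (x : 'rV[R]_n) => x 0 j * A j i)) => j.
by apply: smooth_mul; [exact: smooth_coord|exact: smooth_cst].
Qed.

Lemma ex_orthogonal_row n k (C : 'M[R]_(k, n)) : (k < n)%N ->
  exists2 x : 'rV[R]_n, x *m C^T = 0 & dot x x = 1.
Proof.
move=> kn; have : kermx C^T != 0.
  rewrite -mxrank_eq0 mxrank_ker mxrank_tr subn_eq0 -ltnNge.
  exact: leq_ltn_trans (rank_leq_row C) kn.
case/rowV0Pn => y /sub_kermxP yC y0.
have d0 : 0 < dot y y.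
  by rewrite lt_def dot_ge0 andbT; apply: contra_neq y0; exact: dot_eq0.
exists ((Num.sqrt (dot y y))^-1 *: y); first by rewrite -scalemxAl yC scaler0.
by rewrite dotZl dotZr mulrA -expr2 exprVn sqr_sqrtr ?(ltW d0)// mulVf// gt_eqF.
Qed.

(** The unit sphere of the orthogonal complement of the rows of [C] is compact, and nonempty because
    [k < n]; the maximum found there extends to all of the complement by homogeneity. *)
Lemma max_on_orthogonal n k (A : 'M[R]_n) (C : 'M[R]_(k, n)) : (k < n)%N ->
  exists v : 'rV[R]_n, [/\ v *m C^T = 0, dot v v = 1 &
    forall x, x *m C^T = 0 -> dot (x *m A) x <= dot (v *m A) v * dot x x].
Proof.
move=> kn; pose K := [set x : 'rV[R]_n | x *m C^T = 0 /\ dot x x = 1].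
have K0 : K !=set0 by have [x ? ?] := ex_orthogonal_row C kn; exists x.
have Kcube : K `<=` @cube R n 1.
  move=> x [_ x1] i; rewrite in_itv/= -ler_norml -[leRHS]sqrtr1 -sqrtr_sqr.
  rewrite ler_wsqrtr// -x1 /dot (bigD1 i)//= expr2 lerDl.
  by apply: sumr_ge0 => j _; rewrite -expr2 sqr_ge0.
have clK : closed K.
  have -> : K = (\bigcap_(i in [set: 'I_k]) [set x | dot (row i C) x = 0]) `&`
      [set x | dot (x *m 1%:M) x = 1].
    apply/seteqP; split=> x.
      move=> [xC x1]; split; last by rewrite /= mulmx1.
      by move=> i _ /=; rewrite dotC -mulmxT_dot xC mxE.
    move=> [H] /=; rewrite mulmx1 => x1; split=> //; apply/rowP => i.
    by rewrite mulmxT_dot mxE dotC; exact: H.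
  apply: closedI.
    apply: closed_bigI => i _.
    apply: (@closed_comp _ _ (dot (row i C)) [set 0]); last exact: closed_eq.
    by move=> x _; exact: continuous_dot.
  apply: (@closed_comp _ _ (fun x : 'rV[R]_n => dot (x *m 1%:M) x) [set 1]); last exact: closed_eq.
  by move=> x _; exact: (smooth_continuous (smooth_dotmx _)).
have cK : compact K by exact: subclosed_compact clK (@compact_cube R n 1) Kcube.
have [v vK vmax] : exists2 v, v \in K & forall x, x \in K ->
    dot (x *m A) x <= dot (v *m A) v.
  apply: EVT_max_rV => //; apply: continuous_subspaceT.
  exact: (smooth_continuous (smooth_dotmx A)).
move: vK; rewrite inE => -[vC v1]; exists v; split=> // x xC.
have [x0|x0] := eqVneq (dot x x) 0.
  by rewrite x0 mulr0 (dot_eq0 x0) mul0mx /dot big1// => i _; rewrite mxE mul0r.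
have d0 : 0 < dot x x by rewrite lt_def x0 dot_ge0.
have /vmax : (Num.sqrt (dot x x))^-1 *: x \in K.
  rewrite inE; split; first by rewrite -scalemxAl xC scaler0.
  by rewrite dotZl dotZr mulrA -expr2 exprVn sqr_sqrtr ?(ltW d0)// mulVf.
rewrite -scalemxAl dotZl dotZr mulrA -expr2 exprVn sqr_sqrtr ?(ltW d0)//.
by rewrite ler_pdivrMl// mulrC.
Qed.

Lemma diag_row_mx k (l : R) (m : 'rV[R]_k) :
  diag_mx (row_mx (l%:M : 'rV[R]_1) m) = block_mx l%:M 0 0 (diag_mx m).
Proof.
rewrite diag_mx_row; congr (block_mx _ _ _ _).
by apply/matrixP => i j; rewrite !ord1 !mxE !eqxx.
Qed.

(** Deflation from the largest eigenvalue down: the maximiser on the complement of the eigenvectors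
    already found is the next one. It is placed in front, so the eigenvalues increase with the
    index; the last clause, carried through the induction, says that the new value is at most all
    the old ones. *)
Lemma partial_spectral n (A : 'M[R]_n) k : A^T = A -> (k <= n)%N ->
  exists (C : 'M[R]_(k, n)) (m : 'rV[R]_k),
  [/\ C *m C^T = 1%:M, C *m A = diag_mx m *m C,
     forall i j : 'I_k, (i <= j)%N -> m 0 i <= m 0 j &
     forall x i, x *m C^T = 0 -> dot (x *m A) x <= m 0 i * dot x x].
Proof.
move=> As; elim: k => [_|k IHk kn].
  by exists 0, 0; split=> [| |[]|x []]//; apply/matrixP => -[].
have [C [m [CC CA ms mx]]] := IHk (ltnW kn).
have [v [vC v1 vmax]] := max_on_orthogonal A C kn.
set l := dot (v *m A) v in vmax.
have vA : v *m A = l *: v.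
  have Cv : C *m v^T = 0.
    by rewrite -[C]trmxK -trmx_mul vC trmx0.
  have vAC : v *m A *m C^T = 0.
    by rewrite -mulmxA -{1}As -trmx_mul CA trmx_mul mulmxA vC mul0mx.
  (* First variation of the quotient at [v] in a direction [y] orthogonal to [v] and to [C]; applied
     below to [y = v A - l v], it forces [y = 0]. *)
  have key y : y *m C^T = 0 -> dot v y = 0 -> dot (v *m A) y = 0.
    move=> yC vy; apply: (@quad_le_eq0 _ (l * dot y y - dot (y *m A) y)) => t.
    have := vmax (v + t *: y); rewrite mulmxDl vC -scalemxAl yC scaler0 addr0 => /(_ erefl).
    rewrite mulmxDl -scalemxAl !(dotDl, dotDr, dotZl, dotZr) v1 vy -/l.
    rewrite (dotC y v) vy (dot_mulmx y v As) (dotC y) => H.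
    by nra.
  apply/eqP; rewrite -subr_eq0; apply/eqP; set y := _ - _.
  have yC : y *m C^T = 0 by rewrite mulmxBl vAC -scalemxAl vC scaler0 subrr.
  have vy : dot v y = 0.
    by rewrite dotC /y dotDl dotNl dotZl v1 mulr1 subrr.
  apply: dot_eq0; rewrite {1}/y dotDl dotNl dotZl vy mulr0 subr0.
  exact: key.
have Cv : C *m v^T = 0 by rewrite -[C]trmxK -trmx_mul vC trmx0.
rewrite -[k.+1]/(1 + k)%N.
exists (col_mx v C), (row_mx (l%:M : 'rV[R]_1) m); split.
- rewrite tr_col_mx mul_col_mx !mul_mx_row dotE v1 vC Cv CC.
  by rewrite [RHS](scalar_mx_block 1 k 1).
- rewrite mul_col_mx vA CA diag_row_mx mul_block_col !mul0mx addr0 add0r.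
  by rewrite mul_scalar_mx.
- move=> i j; have [i' ->|i' ->] := split_ordP i; have [j' ->|j' ->] := split_ordP j;
    rewrite ?row_mxEl ?row_mxEr /=.
  + by rewrite !ord1.
  + by move=> _; rewrite !ord1 mxE eqxx mulr1n /l -[leRHS]mulr1 -v1; exact: mx.
  + by rewrite !ord1.
  + by rewrite leq_add2l; exact: ms.
- move=> x i; rewrite tr_col_mx mul_mx_row => /eqP.
  rewrite -(row_mx0 _ _ 1 k) => /eqP/eq_row_mx[xv xC].
  have [i' ->|i' ->] := split_ordP i.
    rewrite row_mxEl !ord1 mxE eqxx mulr1n; exact: vmax.
  by rewrite row_mxEr; exact: mx.
Qed.

Lemma real_spectral n (A : 'M[R]_n) : A^T = A ->
  exists (C : 'M[R]_n) (m : 'rV[R]_n),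
  [/\ C *m C^T = 1%:M, C *m A = diag_mx m *m C &
     forall i j : 'I_n, (i <= j)%N -> m 0 i <= m 0 j].
Proof. by move=> /partial_spectral/(_ (leqnn n))[C [m []]]; exists C, m. Qed.

(** Take a [G]-orthonormal family of maximal size; sizes are bounded by the rank. A vector
    [G]-orthogonal to it with positive norm could be normalised and added, contradicting
    maximality. *)
Lemma gram_basis N (G : 'M[R]_N) : G^T = G -> (forall x, 0 <= dot (x *m G) x) ->
  exists r (P : 'M[R]_(r, N)), P *m G *m P^T = 1%:M /\
    forall x, x *m G *m P^T = 0 -> dot (x *m G) x = 0.
Proof.
move=> Gs G0.
pose Q r := `[< exists P : 'M[R]_(r, N), P *m G *m P^T = 1%:M >].
have exQ : exists r, Q r by exists 0; apply/asboolP; exists 0; apply/matrixP => -[].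
have ubQ r : Q r -> (r <= N)%N.
  move=> /asboolP[P HP]; rewrite -(mxrank1 R r) -HP.
  by rewrite (leq_trans (mxrankM_maxr _ _))// mxrank_tr rank_leq_col.
case: (ex_maxnP exQ ubQ) => r /asboolP[P HP] rmax.
exists r, P; split=> // x xP; apply/eqP; apply: contraT => x0.
have d0 : 0 < dot (x *m G) x by rewrite lt_def x0 G0.
suff /rmax : Q r.+1 by rewrite ltnn.
apply/asboolP; rewrite -[r.+1]/(1 + r)%N; pose v := (Num.sqrt (dot (x *m G) x))^-1 *: x.
have vP : v *m G *m P^T = 0 by rewrite -!scalemxAl xP scaler0.
have Pv : P *m G *m v^T = 0.
  have -> : P *m G *m v^T = (v *m G *m P^T)^T by rewrite !trmx_mul trmxK Gs mulmxA.
  by rewrite vP trmx0.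
exists (col_mx v P); rewrite tr_col_mx mul_col_mx mul_col_mx !mul_mx_row.
rewrite vP Pv HP dotE -!scalemxAl dotZl dotZr mulrA -expr2 exprVn sqr_sqrtr ?(ltW d0)//.
by rewrite mulVf ?gt_eqF// [RHS](scalar_mx_block 1 r 1).
Qed.

(* [G] may be singular: only the directions it sees are diagonalised. *)
Lemma pencil_spectral N (G B : 'M[R]_N) : G^T = G -> B^T = B ->
  (forall x, 0 <= dot (x *m G) x) -> (forall x, dot (x *m G) x = 0 -> x *m B = 0) ->
  exists r (C : 'M[R]_(r, N)) (m : 'rV[R]_r),
  [/\ C *m G *m C^T = 1%:M, C *m B *m C^T = diag_mx m,
     forall i j : 'I_r, (i <= j)%N -> m 0 i <= m 0 j,
     forall x, dot (x *m G) x = dot (x *m G *m C^T) (x *m G *m C^T) &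
     forall x, dot (x *m B) x = \sum_(i < r) m 0 i * (x *m G *m C^T) 0 i ^+ 2].
Proof.
move=> Gs Bs G0 GB; have [r [P [PGP Pmax]]] := gram_basis Gs G0.
have As : (P *m B *m P^T)^T = P *m B *m P^T.
  by rewrite !trmx_mul trmxK Bs mulmxA.
have [Q [m [QQ QA ms]]] := real_spectral As.
have QtQ : Q^T *m Q = 1%:M by exact: mulmx1C.
exists r, (Q *m P), m.
have CG : Q *m P *m G *m (Q *m P)^T = 1%:M.
  by rewrite trmx_mul -!mulmxA (mulmxA P) (mulmxA (P *m G)) PGP mul1mx.
have CB : Q *m P *m B *m (Q *m P)^T = diag_mx m.
  rewrite trmx_mul -!mulmxA (mulmxA P) (mulmxA (P *m B)) mulmxA QA -mulmxA QQ mulmx1.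
  by [].
(* Every vector is its [G]-orthogonal projection onto the diagonalising rows plus a remainder [w];
   by maximality [w] has zero [G]-norm, and therefore [B] kills it too. *)
have dec x : exists w, [/\ x = w + x *m G *m (Q *m P)^T *m (Q *m P),
    w *m G *m (Q *m P)^T = 0, dot (w *m G) w = 0 & w *m B = 0].
  set al := _ *m (Q *m P)^T; exists (x - al *m (Q *m P)); set w := x - _.
  have wC : w *m G *m (Q *m P)^T = 0.
    by rewrite !mulmxBl -!(mulmxA al) CG mulmx1 subrr.
  have wP : w *m G *m P^T = 0.
    by rewrite -[LHS]mulmx1 -QtQ mulmxA -[w *m G *m P^T *m Q^T]mulmxA -trmx_mul wC mul0mx.
  by split=> //; [rewrite subrK|exact: Pmax|apply: GB; exact: Pmax].
split=> // x; have [w [xE wC wG wB]] := dec x;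
  move: (x *m G *m (Q *m P)^T) xE => al xE.
- rewrite {1 2}xE mulmxDl !(dotDl, dotDr). rewrite wG add0r.
  have h1 : dot (w *m G) (al *m (Q *m P)) = 0.
    by apply: dot_delta_eq; rewrite -dotE trmx_mul mulmxA wC mul0mx raddf0.
  rewrite h1 add0r dot_mulmx// dotC h1 add0r.
  apply: dot_delta_eq; rewrite -!dotE [(al *m _)^T]trmx_mul.
  have -> : al *m (Q *m P) *m G *m ((Q *m P)^T *m al^T) =
      al *m (Q *m P *m G *m (Q *m P)^T) *m al^T by rewrite !mulmxA.
  by rewrite CG mulmx1.
- rewrite {1 2}xE mulmxDl wB add0r !dotDr.
  have h1 : dot (al *m (Q *m P) *m B) w = 0.
    rewrite dot_mulmx// wB dotC /dot big1// => i _; by rewrite mxE mul0r.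
  rewrite h1 add0r.
  have -> : dot (al *m (Q *m P) *m B) (al *m (Q *m P)) = dot (al *m diag_mx m) al.
    by apply: dot_delta_eq; rewrite -!dotE trmx_mul -CB !mulmxA.
  apply: eq_bigr => i _; rewrite mul_mx_diag mxE expr2; ring.
Qed.

End RealSpectral.

(** * Min-max and Riesz means *)

Section MinMax.
Context {R : realType} {d : nat}.
Local Notation E := 'rV[R]_d.
Local Notation mu := (@lebesgue_rV R d).
Variables (Omega : set E) (a : R).
Hypotheses (oO : open Omega) (bO : bounded_set Omega) (O0 : Omega !=set0).
Hypotheses (a1 : a < 1) (ad : (1 < d)%N -> - (d%:R - 1)^-1 < a).

Let mO : measurable Omega := open_measurable_rV oO.

(** The extended real behind [neumann_eigenvalue]. Comparisons are made here, since [fine] would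
    send an infinite value to 0 before finiteness is known. *)
Definition minmax (j : nat) : \bar R :=
  ereal_inf [set
    ereal_sup [set (rayleigh Omega a u)%:E | u in V `\` ae_zero Omega] |
    V in [set V | V `<=` H2 Omega /\ has_dim Omega j V]].

Section Family.
Variables (N : nat) (b : 'I_N -> E -> R).
Hypothesis sb : forall i, smooth (b i).

Definition lc (x : 'rV[R]_N) : E -> R := lin_comb b (fun i => x 0 i).
Definition gram : 'M[R]_N := \matrix_(i, j) dotL2 Omega (b i) (b j).
Definition stiff : 'M[R]_N := \matrix_(i, j) cform Omega a (b i) (b j).

Lemma smooth_lc x : smooth (lc x). Proof. exact: smooth_lin_comb. Qed.

Lemma dotL2_lc x y : dotL2 Omega (lc x) (lc y) = dot (x *m gram) y.
Proof.
rewrite dotL2_lin//; last exact: smooth_lc.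
under eq_bigr do rewrite dotL2C dotL2_lin// mulr_sumr.
rewrite exchange_big; apply: eq_bigr => j _ /=.
rewrite !mxE mulr_suml; apply: eq_bigr => i _.
rewrite !mxE [in LHS]dotL2C; ring.
Qed.

Lemma cform_lc x y : cform Omega a (lc x) (lc y) = dot (x *m stiff) y.
Proof.
rewrite cform_lin//; last exact: smooth_lc.
under eq_bigr do rewrite cformC cform_lin// mulr_sumr.
rewrite exchange_big; apply: eq_bigr => j _ /=.
rewrite !mxE mulr_suml; apply: eq_bigr => i _.
rewrite !mxE [in LHS]cformC; ring.
Qed.

Lemma gram_sym : gram^T = gram.
Proof. by apply/matrixP => i j; rewrite !mxE dotL2C. Qed.

Lemma stiff_sym : stiff^T = stiff.
Proof. by apply/matrixP => i j; rewrite !mxE cformC. Qed.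

Lemma gram_ge0 x : 0 <= dot (x *m gram) x.
Proof. by rewrite -dotL2_lc dotL2_ge0. Qed.

Lemma lc_delta i : lc (delta_mx 0 i) = b i.
Proof.
apply/funext => x; rewrite /lc /lin_comb (bigD1 i)//= big1 ?addr0 => [|j ji];
  rewrite mxE !eqxx/= ?mul1r//.
by rewrite (negbTE ji) mul0r.
Qed.

Lemma gram_stiff0 x : dot (x *m gram) x = 0 -> x *m stiff = 0.
Proof.
rewrite -dotL2_lc => /(dotL2_eq0 oO bO (smooth_continuous (smooth_lc x))) x0.
apply/rowP => i; rewrite [RHS]mxE -[LHS](dot_delta).
by rewrite -cform_lc (cform_eq0 oO).
Qed.

(** The [psi i] are the combinations given by the rows of the diagonalising matrix. The last two
    clauses are Parseval identities on the whole span; they remain valid when [r < N], because the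
    missing directions are invisible to both forms. *)
Lemma spectral_family : exists r (psi : 'I_r -> E -> R) (m : 'I_r -> R),
  [/\ forall i, smooth (psi i),
      forall i j, dotL2 Omega (psi i) (psi j) = (i == j)%:R,
      forall i j, cform Omega a (psi i) (psi j) = m i *+ (i == j),
      forall i j : 'I_r, (i <= j)%N -> m i <= m j &
      (forall x, dotL2 Omega (lc x) (lc x) = \sum_(i < r) dotL2 Omega (lc x) (psi i) ^+ 2) /\
      (forall x, cform Omega a (lc x) (lc x) =
         \sum_(i < r) m i * dotL2 Omega (lc x) (psi i) ^+ 2)].
Proof.
have [r [C [m [CG CB ms Gx Bx]]]] := pencil_spectral gram_sym stiff_sym gram_ge0 gram_stiff0.
have key x i : dotL2 Omega (lc x) (lc (row i C)) = (x *m gram *m C^T) 0 i.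
  by rewrite mulmxT_dot dotL2_lc.
exists r, (fun i => lc (row i C)), (fun i => m 0 i); split=> //.
- by move=> i; exact: smooth_lc.
- move=> i j; rewrite key -!row_mul CG mxE mxE.
  by [].
- move=> i j; rewrite cform_lc -mulmxT_dot -!row_mul CB mxE mxE.
  by [].
- split=> x; first by rewrite dotL2_lc Gx; apply: eq_bigr => i _; rewrite key -expr2.
  by rewrite cform_lc Bx; apply: eq_bigr => i _; rewrite key.
Qed.

End Family.

Lemma rayleigh_ge0 u : 0 <= rayleigh Omega a u.
Proof.
rewrite /rayleigh divr_ge0//; apply: Rintegral_ge0 => x _; last exact: sqr_ge0.
have -> : laplacian Omega u x = \sum_(i < d) hessian Omega u x i i.
  by apply: eq_bigr => i _; rewrite mxE.
exact: (density_ge0 (hessian Omega u x) a1 ad).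
Qed.

(** Dropping the last basis function of a trial space leaves a smaller trial space, with a smaller
    supremum. *)
Lemma minmax_mono j : (minmax j <= minmax j.+1)%E.
Proof.
apply: le_ereal_inf_tmp => _ [V [VH [b [bi VE]]] <-].
pose b' (i : 'I_j) := b (widen_ord (leqnSn j) i).
have lcE c : lin_comb b' c = lin_comb b (fun i => if unlift ord_max i is Some k then c k else 0).
  apply/funext => x; rewrite /lin_comb big_ord_recr/= unlift_none mul0r addr0.
  apply: eq_bigr => i _; congr (_ * _).
  have -> : widen_ord (leqnSn j) i = lift ord_max i by apply: (@ord_inj j.+1); rewrite lift_max.
  by rewrite liftK.
apply: ge_ereal_inf; exists (ereal_sup [set (rayleigh Omega a u)%:E |
    u in range (lin_comb b') `\` ae_zero Omega]).
  exists (range (lin_comb b')) => //; split.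
    by move=> _ [c _ <-]; apply: VH; rewrite VE lcE; eexists.
  exists b'; split=> // c c0 i.
  rewrite lcE in c0; have := bi _ c0 (widen_ord (leqnSn j) i).
  have -> : widen_ord (leqnSn j) i = lift ord_max i by apply: (@ord_inj j.+1); rewrite lift_max.
  by rewrite liftK.
apply: ge_ereal_sup => _ [u [[c _ <-] u0] <-]; apply: ereal_sup_ubound.
exists (lin_comb b' c) => //.
by split=> //; rewrite VE lcE; eexists.
Qed.

(** The trial space is the span of [psi 0, ..., psi j]. It has dimension [j.+1], and its Rayleigh
    quotients are weighted means of the values [m i] with [i <= j]. *)
Lemma minmax_upper r (psi : 'I_r -> E -> R) (m : 'I_r -> R) (j : 'I_r) :
  (forall i, smooth (psi i)) ->
  (forall i k, dotL2 Omega (psi i) (psi k) = (i == k)%:R) ->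
  (forall i k, cform Omega a (psi i) (psi k) = m i *+ (i == k)) ->
  (forall i k : 'I_r, (i <= k)%N -> m i <= m k) ->
  (minmax j.+1 <= (m j)%:E)%E.
Proof.
move=> spsi G B ms.
pose b (i : 'I_j.+1) := psi (widen_ord (ltn_ord j) i).
have sb i : smooth (b i) by exact: spsi.
have slb c : smooth (lin_comb b c) by exact: smooth_lin_comb.
have G' c : dotL2 Omega (lin_comb b c) (lin_comb b c) = \sum_i c i ^+ 2.
  rewrite dotL2_lin//; apply: eq_bigr => i _.
  rewrite dotL2C dotL2_lin// (bigD1 i)//= big1 => [|k ki].
    by rewrite G eqxx mulr1 addr0 expr2.
  by rewrite G (_ : (_ == _) = false) ?mulr0//; apply/negbTE.
have B' c : cform Omega a (lin_comb b c) (lin_comb b c) =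
    \sum_i m (widen_ord (ltn_ord j) i) * c i ^+ 2.
  rewrite cform_lin//; apply: eq_bigr => i _.
  rewrite cformC cform_lin// (bigD1 i)//= big1 => [|k ki].
    by rewrite B eqxx addr0 expr2 mulrA mulrC mulrA.
  by rewrite B (_ : (_ == _) = false) ?mulr0//; apply/negbTE.
apply: (@le_trans _ _ (ereal_sup [set (rayleigh Omega a u)%:E |
    u in range (lin_comb b) `\` ae_zero Omega])).
  apply: ereal_inf_lbound; exists (range (lin_comb b)) => //; split.
    by move=> _ [c _ <-]; exact: smooth_H2.
  exists b; split=> // c c0 i; apply/eqP; rewrite -sqrf_eq0; apply/eqP.
  have := dotL2_ae0 oO (smooth_continuous (slb c)) c0; rewrite G' => /eqP.
  rewrite psumr_eq0 => [/allP H|k _]; last exact: sqr_ge0.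
  by apply/eqP; apply: (H i (mem_index_enum _)).
apply: ge_ereal_sup => _ [u [[c _ <-] _] <-]; rewrite lee_fin.
rewrite (rayleigh_smooth oO bO a (slb c)) G' B'.
have S0 : 0 <= \sum_i c i ^+ 2 by apply: sumr_ge0 => i _; exact: sqr_ge0.
(* With zero denominator the quotient reads 0, which is at most [m j] because [m j] is itself the
   Rayleigh quotient of [psi j]. *)
have [S00|S00] := eqVneq (\sum_i c i ^+ 2) 0.
  rewrite S00 invr0 mulr0; have := rayleigh_ge0 (psi j).
  by rewrite (rayleigh_smooth oO bO a (spsi j)) G B eqxx divr1.
rewrite ler_pdivrMr ?lt_def ?S00// mulr_sumr; apply: ler_sum => i _.
rewrite ler_wpM2r ?sqr_ge0//; apply: ms => /=.
by rewrite -ltnS.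
Qed.

(* Powers of the first coordinate are linearly independent on an open set. *)
Lemma minmax_lty (hd : (0 < d)%N) j : (minmax j < +oo)%E.
Proof.
(* [minmax_upper] at the ordinal [j] bounds [minmax j.+1], which also covers [j = 0]. *)
apply: (le_lt_trans (minmax_mono j)).
pose i0 : 'I_d := Ordinal hd.
pose b (i : 'I_j.+1) (x : E) := x 0 i0 ^+ i.
have sb i : smooth (b i).
  rewrite /b; elim: (val i) => [|n IHn].
    by under eq_fun do rewrite expr0; exact: smooth_cst.
  under eq_fun do rewrite exprS.
  by apply: smooth_mul; [exact: smooth_coord|exact: IHn].
have [r [psi [m [spsi Gp Bp ms [Gx _]]]]] := spectral_family sb.
have Ginj (x : 'rV[R]_j.+1) : dotL2 Omega (lc b x) (lc b x) = 0 -> x = 0.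
  move=> /(dotL2_eq0 oO bO (smooth_continuous (smooth_lc sb x))) x0.
  have [y Oy] := O0.
  have /nbhs_ballP[e /= e0 yeO] : nbhs y Omega by exact: open_nbhs_nbhs.
  pose p : {poly R} := rVpoly x.
  have pE t : 0 < t < e -> p.[y 0 i0 + t] = 0.
    move=> /andP[t0 te].
    have Oyt : Omega (y + t *: delta_mx 0 i0).
      apply: yeO; split=> // k i; rewrite (ord1 k) /ball/= !mxE eqxx/=.
      rewrite opprD addrA subrr sub0r normrN normrM gtr0_norm//.
      by case: eqP => _; rewrite ?normr0 ?normr1 ?mulr1 ?mulr0.
    rewrite -[RHS](x0 _ Oyt) /lc /lin_comb horner_poly; apply: eq_bigr => i _.
    by rewrite valK /b !mxE !eqxx mulr1.
  have p0 : p = 0.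
    (* As many distinct roots as the size of [p]; the denominators start at 2 so that every offset
       lies strictly between 0 and [e]. *)
    apply: (@roots_geq_poly_eq0 _ p [seq y 0 i0 + e / (k.+2)%:R | k <- iota 0 (size p)]).
    - apply/allP => _ /mapP[k _ ->]; apply/rootP; apply: pE.
      by rewrite divr_gt0//= ltr_pdivrMr// ltr_pMr// ltr1n.
    - rewrite map_inj_uniq ?iota_uniq// => k l /addrI.
      move=> /(mulfI (lt0r_neq0 e0)) /invr_inj /eqP.
      by rewrite eqr_nat => /eqP [].
    - by rewrite size_map size_iota.
  by rewrite -[x]rVpolyK -/p p0 linear0.
pose D : 'M[R]_(j.+1, r) := \matrix_(k, i) dotL2 Omega (b k) (psi i).
(* A combination of the powers orthogonal to all [psi i] has zero norm by Parseval, hence is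
   trivial. So [D] has rank [j.+1], and there are at least that many [psi i]. *)
have : row_free D.
  rewrite -kermx_eq0; apply/eqP/row_matrixP => k; rewrite row0.
  have := row_sub k (kermx D); set x := row k _ => /sub_kermxP xD.
  apply: Ginj; rewrite Gx big1// => i _.
  rewrite dotL2_lin//; have := congr1 (fun v : 'rV_r => v 0 i) xD.
  rewrite !mxE => H; rewrite (_ : \sum_i _ = 0) ?expr0n// -[RHS]H.
  by apply: eq_bigr => k' _; rewrite !mxE.
rewrite /row_free => /eqP rD.
have jr : (j < r)%N by rewrite -rD rank_leq_col.
exact: le_lt_trans (minmax_upper (Ordinal jr) spsi Gp Bp ms) (ltry _).
Qed.

(** For [j > 0] a trial space contains a function that is not almost everywhere zero; without one
    the supremum would be that of the empty set, minus infinity. *)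
Lemma minmax_ge0 (hd : (0 < d)%N) j : (0 < j)%N -> (0 <= minmax j)%E.
Proof.
move=> j0; apply: le_ereal_inf_tmp => _ [V [VH [b [bi VE]]] <-].
pose c (i : 'I_j) : R := (i == Ordinal j0)%:R.
apply: le_ereal_sup_tmp; exists (rayleigh Omega a (lin_comb b c))%:E; last first.
  by rewrite lee_fin rayleigh_ge0.
exists (lin_comb b c) => //; split; first by rewrite VE; eexists.
by move=> /bi /(_ (Ordinal j0)) /eqP; rewrite /c eqxx oner_eq0.
Qed.

Lemma minmaxE (hd : (0 < d)%N) j : (0 < j)%N ->
  minmax j = (neumann_eigenvalue Omega a j)%:E.
Proof.
move=> j0; rewrite /neumann_eigenvalue -/(minmax j) fineK// ge0_fin_numE.
  exact: minmax_lty.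
exact: minmax_ge0.
Qed.

Lemma neumann_ge0 (hd : (0 < d)%N) j : (0 < j)%N -> 0 <= neumann_eigenvalue Omega a j.
Proof. by move=> j0; rewrite -lee_fin -minmaxE// minmax_ge0. Qed.

Lemma neumann_mono (hd : (0 < d)%N) i j : (0 < i)%N -> (i <= j)%N ->
  neumann_eigenvalue Omega a i <= neumann_eigenvalue Omega a j.
Proof.
move=> i0 ij; rewrite -lee_fin -!minmaxE//; last exact: leq_trans i0 ij.
elim: j ij => [|j IHj]; first by rewrite leqn0 => /eqP ->.
rewrite leq_eqVlt => /predU1P[->//|]; rewrite ltnS => /IHj ij.
exact: le_trans ij (minmax_mono j).
Qed.

Lemma riesz_mean_bound (hd : (0 < d)%N) N (phi : 'I_N -> E -> R) (e : 'I_N -> R) (W : R) k :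
  (forall t, smooth (phi t)) ->
  (forall t, cform Omega a (phi t) (phi t) = e t * dotL2 Omega (phi t) (phi t)) ->
  (forall u, smooth u -> \sum_(t < N) dotL2 Omega (phi t) u ^+ 2 <= W * dotL2 Omega u u) ->
  0 <= W ->
  \sum_(t < N) Num.max 0 (neumann_eigenvalue Omega a k.+1 - e t) * dotL2 Omega (phi t) (phi t) <=
  W * \sum_(j < k) (neumann_eigenvalue Omega a k.+1 - neumann_eigenvalue Omega a j.+1).
Proof.
move=> sphi Hphi HW W0; set z := neumann_eigenvalue Omega a k.+1.
have [r [psi [m [spsi Gp Bp ms [Gx Bx]]]]] := spectral_family sphi.
(* By Parseval, [z - e t] times the squared norm is the sum of [(z - m i)] times squared
   coefficients; taking positive parts of the terms only enlarges it. *)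
have bound t : Num.max 0 (z - e t) * dotL2 Omega (phi t) (phi t) <=
    \sum_(i < r) Num.max 0 (z - m i) * dotL2 Omega (phi t) (psi i) ^+ 2.
  have [ze|ze] := leP (z - e t) 0.
    by rewrite mul0r; apply: sumr_ge0 => i _; rewrite mulr_ge0 ?sqr_ge0// le_max lexx.
  rewrite mulrBl -Hphi -(lc_delta phi t) Gx Bx mulr_sumr -sumrB; apply: ler_sum => i _.
  by rewrite -mulrBl ler_wpM2r ?sqr_ge0// le_max lexx orbT.
apply: (@le_trans _ _ (\sum_(i < r) Num.max 0 (z - m i) * W)).
  apply: (le_trans (ler_sum _ (fun t _ => bound t))).
  rewrite exchange_big; apply: ler_sum => i _ /=; rewrite -mulr_sumr.
  rewrite ler_wpM2l ?le_max ?lexx//.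
  by rewrite (le_trans (HW _ (spsi i)))// Gp eqxx mulr1.
rewrite -mulr_suml mulrC ler_wpM2l//.
(* The ordinal [i] starts at 0, so [m i] is compared with the eigenvalue of index [i.+1]. Since [f]
   is nonnegative and zero from [k] on, the sums up to [r] and up to [k] compare whichever is
   larger. *)
pose f (i : nat) : R := Num.max 0 (z - neumann_eigenvalue Omega a i.+1).
have f0 i : 0 <= f i by rewrite /f le_max lexx.
apply: (@le_trans _ _ (\sum_(i < r) f i)).
  apply: ler_sum => i _; rewrite /f ge_max !le_max lexx/= lerB ?orbT//.
  by rewrite -lee_fin -minmaxE//; exact: (minmax_upper i spsi Gp Bp ms).
have fk i : (k <= i)%N -> f i = 0.
  move=> ki; apply/eqP; rewrite eq_le f0 andbT /f ge_max lexx subr_le0.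
  by apply: neumann_mono.
have -> : \sum_(j < k) (z - neumann_eigenvalue Omega a j.+1) = \sum_(j < k) f j.
  apply: eq_bigr => j _; rewrite /f; apply/esym/max_idPr; rewrite subr_ge0.
  by apply: neumann_mono => //; rewrite ltnS ltnW.
have [rk|kr] := leqP r k.
  rewrite -(subnKC rk) big_split_ord/= lerDl.
  by apply: sumr_ge0.
rewrite -(subnKC (ltnW kr)) big_split_ord/= [X in _ + X]big1 ?addr0// => i _.
by apply: fk; rewrite leq_addr.
Qed.

End MinMax.

(** * Hartley functions and Bessel inequality *)

Section TrigIntegrals.
Context {R : realType}.
Local Notation leb n := (@lebesgue_rV R n).

Lemma sin_periodz (m : int) (x : R) : sin (x + m%:~R * (pi *+ 2)) = sin x.
Proof.
case: m => n.
  by rewrite -pmulrn mulr_natl (periodicn (@sinD2pi R)).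
rewrite -[LHS](periodicn (@sinD2pi R) n.+1); congr sin.
by rewrite NegzE mulrNz mulNr -pmulrn mulr_natl subrK.
Qed.

Lemma continuous_cos_affine (a b : R) : continuous (fun t : R => cos (a * t + b)).
Proof.
move=> t; apply: (@continuous_comp _ _ _ (fun t => a * t + b) (@cos R)); last exact: continuous_cos.
apply: (@continuousD _ _ _ (fun t => a * t) (cst b)); last exact: cst_continuous.
by apply: (@continuousM _ _ (cst a) id); [exact: cst_continuous|move=> A].
Qed.

(** For [m] nonzero the interval contains a whole number of periods, so the primitive takes the same
    value at both ends. *)
Lemma integral_cos_period (r : R) (m : int) b : 0 < r ->
  (\int[lebesgue_measure]_(t in [set` `[(- r)%R, r]]) (cos (pi / r * m%:~R * t + b))%:E)%E =
   (2 * r * (m == 0)%:R * cos b)%:E.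
Proof.
move=> r0; have [->|m0] := eqVneq m 0.
  under eq_integral do rewrite mulr0z mulr0 mul0r add0r.
  rewrite integral_cst//= lebesgue_measure_itv/= lte_fin gtrN//.
  by rewrite -EFinB -EFinM mulr1; congr (_%:E); ring.
rewrite mulr0 mul0r; set a := pi / r * m%:~R.
have a0 : a != 0.
  by rewrite !mulf_neq0 ?intr_eq0// ?invr_neq0// lt0r_neq0// pi_gt0.
have HF t : is_derive (t : R) 1 (fun t : R => sin (a * t + b) / a) (cos (a * t + b)).
  have H : is_derive t 1 (fun t : R => sin (t * a + b)) (cos (t * a + b) * a).
    exact: is_derive1_comp (is_derive_affine a b t).
  have H' := is_deriveM H (is_derive_cst a^-1 t 1).
  have -> : (fun t : R => sin (a * t + b) / a) = (fun t : R => sin (t * a + b)) * cst a^-1.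
    by apply/funext => s; rewrite mulrC [RHS]mulrC (mulrC a).
  apply: (is_derive_eq H'); rewrite scaler0 add0r /GRing.scale/= /cst (mulrC t).
  by field.
have df t : derivable (fun t : R => sin (a * t + b) / a) t 1 by case: (HF t).
have cf := derivable1_continuous df.
rewrite (@continuous_FTC2 _ _ (fun t => sin (a * t + b) / a) (- r) r).
- rewrite -EFinB -mulrBl; congr (_%:E).
  have -> : a * r + b = a * - r + b + m%:~R * (pi *+ 2).
    by rewrite /a; field; rewrite gt_eqF.
  by rewrite sin_periodz subrr mul0r.
- lra.
- by apply: continuous_subspaceT; exact: continuous_cos_affine.
- by split=> //; [apply: cvg_at_right_filter|apply: cvg_at_left_filter]; exact: cf.
- by move=> t _; rewrite derive1E; case: (HF t).
Qed.

Lemma continuous_cos_dot n (q : 'rV[R]_n) b : continuous (fun x => cos (dot q x + b)).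
Proof.
move=> x; apply: (@continuous_comp _ _ _ (fun x => dot q x + b) (@cos R)); last exact: continuous_cos.
apply: (@continuousD _ _ _ (dot q) (cst b)); first exact: continuous_dot.
exact: cst_continuous.
Qed.

Lemma dot_cons n (q : 'rV[R]_n.+1) (t : measurableTypeR R) (v : 'rV[R]_n) :
  dot q (cons_rV (t, v)) = q 0 0 * t + dot (\row_i q 0 (lift ord0 i)) v.
Proof.
rewrite /dot big_ord_recl cons_rV0; congr (_ + _); apply: eq_bigr => i _.
by rewrite cons_rVS mxE.
Qed.

Lemma cube_cons n r (t : measurableTypeR R) (v : 'rV[R]_n) :
  (cons_rV (t, v) \in @cube R n.+1 r) = ((t : R) \in `[- r, r]) && (v \in @cube R n r).
Proof.
apply/idP/andP => [/set_mem H|[H0 /set_mem HS]].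
  split; first by have := H ord0; rewrite cons_rV0.
  by apply/mem_set => i; have := H (lift ord0 i); rewrite cons_rVS.
apply/mem_set => i.
by have [j ->|->] := unliftP ord0 i; [rewrite cons_rVS; exact: HS|rewrite cons_rV0].
Qed.

Definition freq n (r : R) (M : 'rV[int]_n) : 'rV[R]_n := \row_i (pi / r * (M 0 i)%:~R).

(** The free phase [b] carries the induction: once the first coordinate is fixed, its contribution
    to the argument of the cosine is absorbed into the phase. *)
Lemma integral_cos_cube n (r : R) (M : 'rV[int]_n) b : 0 < r ->
  ((\int[leb n]_(x in cube r) (cos (dot (freq r M) x + b))%:E)%E =
   ((2 * r) ^+ n * (M == 0)%:R * cos b)%:E).
Proof.
move=> r0; elim: n M b => [|n IHn] M b.
  have -> : @cube R 0 r = setT by apply/seteqP; split=> // x _ [].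
  rewrite integral_lebesgue_rV0; last first.
    by apply/measurable_EFinP; apply: continuous_measurable_rV; exact: continuous_cos_dot.
  rewrite /dot big_ord0 add0r expr0 mul1r (_ : M == 0) ?mul1r//.
  by apply/eqP/rowP => -[].
set M' : 'rV[int]_n := \row_i M 0 (lift ord0 i).
rewrite integral_mkcond fubini_rV1; last first.
  apply: (integrable_mkcond _ (@measurable_cube R n.+1 r)).1.
  by apply: continuous_integrable_rV;
    [exact: measurable_cube|exact: cube_bounded|exact: continuous_cos_dot].
transitivity (\int[lebesgue_measure]_t (((fun s : R => ((2 * r) ^+ n * (M' == 0)%:R *
    cos (pi / r * (M 0 0)%:~R * s + b))%:E)) \_ [set` `[(- r)%R, r]]) t)%E.
  apply: eq_integral => t _; rewrite patchE.
  transitivity (\int[leb n]_v ((fun v => if (t : R) \in [set` `[(- r)%R, r]] then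
      (cos (dot (freq r M') v + (pi / r * (M 0 0)%:~R * t + b)))%:E else 0%E) \_ (cube r)) v)%E.
    apply: eq_integral => v _; rewrite !patchE cube_cons mem_setE.
    case: (v \in _); rewrite ?andbT ?andbF//.
    case: ifP => // _; congr (cos _)%:E.
    rewrite dot_cons mxE addrA; congr (_ + _); rewrite addrC; congr (_ + _); congr (dot _ _).
    by apply/rowP => i; rewrite !mxE.
  case: ifP => tr; first by rewrite -integral_mkcond IHn.
  by rewrite -integral_mkcond integral0.
rewrite -integral_mkcond.
under eq_integral do rewrite EFinM.
rewrite integralZl//.
- rewrite integral_cos_period// -EFinM; congr (_%:E).
  have -> : (M == 0) = (M 0 0 == 0) && (M' == 0).
    apply/eqP/andP => [M0|[/eqP H0 /eqP HS]].
      by rewrite M0 mxE eqxx; split=> //; apply/eqP/rowP => i; rewrite !mxE M0 mxE.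
    apply/rowP => i; rewrite [RHS]mxE; have [j ->|->] := unliftP ord0 i => //.
    by have /rowP/(_ j) := HS; rewrite !mxE.
  by rewrite exprS; case: (_ == 0); case: (_ == 0); rewrite /= ?mulr1 ?mulr0 ?mul0r//; ring.
- apply: continuous_compact_integrable; first exact: segment_compact.
  by apply: continuous_subspaceT; exact: continuous_cos_affine.
Qed.

End TrigIntegrals.

(** * Hartley functions: values of the form, norms and Bessel's inequality *)

Section Hartley.
Context {R : realType} {d : nat}.
Local Notation E := 'rV[R]_d.
Local Notation mu := (@lebesgue_rV R d).

(* Hartley's real substitute for [exp(i p.x)]. *)
Definition hartley (p x : E) : R := cos (dot p x) + sin (dot p x).

Definition sqnorm (p : E) : R := dot p p.

Lemma is_derive_trig (A B : R) (p x : E) i :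
  is_derive x (delta_mx 0 i) (fun y => A * cos (dot p y) + B * sin (dot p y))
    (p 0 i * (B * cos (dot p x) + - A * sin (dot p x))).
Proof.
have H (t : R) : is_derive t 1 (fun t : R => A * cos t + B * sin t) (B * cos t + - A * sin t).
  have Hc := is_deriveM (is_derive_cst A t 1) (is_derive_cos t).
  have Hs := is_deriveM (is_derive_cst B t 1) (is_derive_sin t).
  apply: (is_derive_eq (is_deriveD Hc Hs)).
  rewrite !scaler0 !addr0 /GRing.scale/= /cst; ring.
have := @is_derive_dot R d (fun t : R => A * cos t + B * sin t) p 0 x i _ (H _).
rewrite addr0 mulrC; congr is_derive; apply/funext => y; by rewrite addr0.
Qed.

Lemma smooth_hartley p : smooth (hartley p).
Proof.
pose K (u : E -> R) := exists A B, u = fun y => A * cos (dot p y) + B * sin (dot p y).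
apply: (smooth_coind (K := K)); last first.
  by exists 1, 1; apply/funext => y; rewrite !mul1r.
have cdot (f : R -> R) : continuous f -> continuous (fun y => f (dot p y)).
  by move=> cf x; apply: (@continuous_comp _ _ _ (dot p) f); [exact: continuous_dot|exact: cf].
move=> _ [A [B ->]]; split.
  move=> x; apply: (@continuousD _ _ _ (fun y => A * cos (dot p y)) (fun y => B * sin (dot p y))).
    apply: (@continuous_mul _ _ (cst A)); first exact: cst_continuous.
    by apply: cdot; exact: continuous_cos.
  apply: (@continuous_mul _ _ (cst B)); first exact: cst_continuous.
  by apply: cdot; exact: continuous_sin.
move=> i; exists (fun x => p 0 i * B * cos (dot p x) + p 0 i * - A * sin (dot p x)).
  by do 2 eexists.
move=> x; apply: (is_derive_eq (is_derive_trig A B p x i)).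
by rewrite mulrDr !mulrA.
Qed.

Lemma partials2_hartley p i j x :
  partials [:: j; i] (hartley p) x = - (p 0 i * p 0 j) * hartley p x.
Proof.
have D1 : 'D_(delta_mx 0 i : E) (hartley p) =
    fun x => p 0 i * cos (dot p x) + - p 0 i * sin (dot p x).
  apply/funext => y; have [_] := is_derive_trig 1 1 p y i.
  rewrite (_ : (fun y => _) = hartley p); last by apply/funext => z; rewrite !mul1r.
  by move=> ->; ring.
rewrite /partials /= D1; have [_ ->] := is_derive_trig (p 0 i) (- p 0 i) p x j.
by rewrite /hartley; ring.
Qed.

(** The Hessian of [hartley p] is the rank-one matrix [- hartley p * p^T p], whose squared Frobenius
    norm equals its squared trace; the weights [1 - a] and [a] then add up to 1. *)
Lemma form_density_hartley a p x :
  form_density a (hartley p) (hartley p) x = sqnorm p ^+ 2 * (hartley p x * hartley p x).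
Proof.
rewrite /form_density.
have -> : (fun i j => partials [:: j; i] (hartley p) x) =
    fun i j => - (p 0 i * p 0 j) * hartley p x.
  by apply/funext => i; apply/funext => j; exact: partials2_hartley.
rewrite /density; set c := hartley p x.
have -> : \sum_(i < d) - (p 0 i * p 0 i) * c = - (sqnorm p * c).
  by rewrite /sqnorm /dot mulr_suml -sumrN; apply: eq_bigr => i _; rewrite mulNr.
have -> : \sum_(i < d) \sum_(j < d) - (p 0 i * p 0 j) * c * (- (p 0 i * p 0 j) * c) =
    sqnorm p ^+ 2 * (c * c).
  rewrite expr2 {1}/sqnorm /dot !mulr_suml; apply: eq_bigr => i _.
  rewrite /sqnorm /dot mulr_sumr mulr_suml; apply: eq_bigr => j _; ring.
ring.
Qed.

(** The product is [cos((p - q).x) + sin((p + q).x)]; the sine is written as a shifted cosine so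
    that [integral_cos_cube] covers both terms. *)
Lemma hartleyM p q x : hartley p x * hartley q x =
  cos (dot (p - q) x + 0) + cos (dot (p + q) x + - (pi / 2)).
Proof.
rewrite cosB cos_pihalf sin_pihalf mulr0 add0r mulr1 addr0.
rewrite dotDl dotNl dotDl cosB sinD /hartley; ring.
Qed.

Lemma cform_hartley (Omega : set E) a p : measurable Omega -> bounded_set Omega ->
  cform Omega a (hartley p) (hartley p) =
  sqnorm p ^+ 2 * dotL2 Omega (hartley p) (hartley p).
Proof.
move=> mO bO; rewrite /cform /dotL2 -RintegralZl//.
  by apply: eq_Rintegral => x _; exact: form_density_hartley.
apply: continuous_integrable => //.
by apply: continuous_mul; apply: smooth_continuous; exact: smooth_hartley.
Qed.

(** The square of [hartley p] is [1 + 2 sin cos]; its second term is odd in [p] and cancels. *)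
Lemma dotL2_hartleyN (Omega : set E) p : measurable Omega -> bounded_set Omega ->
  dotL2 Omega (hartley p) (hartley p) + dotL2 Omega (hartley (- p)) (hartley (- p)) =
  2 * volume Omega.
Proof.
move=> mO bO; have ch q : continuous (fun x => hartley q x * hartley q x).
  by apply: continuous_mul; apply: smooth_continuous; exact: smooth_hartley.
rewrite /dotL2 -RintegralD//; [|exact: continuous_integrable..].
rewrite (@eq_Rintegral _ _ _ mu Omega (cst 2)); first by rewrite Rintegral_cst.
move=> x _; rewrite /hartley dotNl cosN sinN /=.
have := cos2Dsin2 (dot p x); rewrite !expr2 => H.
set C := cos _ in H *; set S := sin _ in H *.
by transitivity (2 * (C * C + S * S)); [ring|rewrite H mulr1].
Qed.

Section Bessel.
Variables (r : R) (N : nat) (M : 'I_N -> 'rV[int]_d).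
Hypotheses (r0 : 0 < r) (Mi : injective M).
Let phi t := hartley (freq r (M t)).

Lemma freqB (A B : 'rV[int]_d) : freq r A - freq r B = freq r (A - B).
Proof. by apply/rowP => i; rewrite !mxE intrB mulrBr. Qed.

Lemma freqD (A B : 'rV[int]_d) : freq r A + freq r B = freq r (A + B).
Proof. by apply/rowP => i; rewrite !mxE intrD mulrDr. Qed.

(** The term of frequency [M t + M s] contributes nothing even when that frequency is 0, since its
    phase is [- pi / 2]. *)
Lemma dot_hartley_cube t s :
  dotL2 (cube r) (phi t) (phi s) = (2 * r) ^+ d * (t == s)%:R.
Proof.
have mc := @measurable_cube R d r; have bc := @cube_bounded R d r.
rewrite /dotL2 /phi; under eq_Rintegral do rewrite hartleyM freqB freqD.
rewrite RintegralD//; [|apply: continuous_integrable => //; exact: continuous_cos_dot..].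
rewrite /Rintegral !integral_cos_cube//= cosN cos_pihalf mulr0 addr0 cos0 mulr1.
by rewrite subr_eq0 (inj_eq Mi).
Qed.

(** With [T] the sum of [c t * phi t], the squared norm of [T - W u] over Omega is nonnegative, and
    that of [T] is at most its value [W S] over the cube. This gives [0 <= W S - 2 W S + W^2 |u|^2].
    Only smooth functions occur this way, whereas extending [u] by zero to the cube would leave that
    class. *)
Lemma bessel_hartley (Omega : set E) u : open Omega -> bounded_set Omega ->
  Omega `<=` cube r -> smooth u ->
  \sum_(t < N) dotL2 Omega (phi t) u ^+ 2 <= (2 * r) ^+ d * dotL2 Omega u u.
Proof.
move=> oO bO Or su; have mO := open_measurable_rV oO.
have sphi t : smooth (phi t) by exact: smooth_hartley.
set S := \sum_(t < N) _; set W := (2 * r) ^+ d.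
have W0 : 0 < W by rewrite exprn_gt0// mulr_gt0.
pose c t := dotL2 Omega (phi t) u.
pose T := lin_comb phi c.
have sT : smooth T by exact: smooth_lin_comb.
have cT := smooth_continuous sT.
have TU : dotL2 Omega T u = S.
  by rewrite dotL2_lin//; apply: eq_bigr => t _; rewrite /c -expr2.
have mc := @measurable_cube R d r; have bc := @cube_bounded R d r.
have TT : dotL2 (cube r) T T = W * S.
  have E1 v : continuous v -> dotL2 (cube r) T v = \sum_(t < N) c t * dotL2 (cube r) (phi t) v.
    move=> cv; rewrite -(Rintegral_lin mc bc); last first.
      by move=> t; exact: (continuous_mul (smooth_continuous (sphi t)) cv).
    apply: eq_Rintegral => x _; rewrite /T /lin_comb mulr_suml.
    by apply: eq_bigr => t _; rewrite mulrA.
  rewrite E1// mulr_sumr; apply: eq_bigr => t _.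
  rewrite dotL2C (E1 _ (smooth_continuous (sphi t))).
  rewrite (bigD1 t)//= big1 => [|s st]; last by rewrite dot_hartley_cube (negbTE st) !mulr0.
  by rewrite dot_hartley_cube eqxx mulr1 addr0 mulrA -expr2 mulrC.
have TTle : dotL2 Omega T T <= W * S.
  rewrite -TT /dotL2 /Rintegral; apply: fine_le.
  - by apply: integrable_fin_num => //; apply: continuous_integrable => //; exact: continuous_mul.
  - by apply: integrable_fin_num => //; apply: continuous_integrable => //; exact: continuous_mul.
  apply: ge0_subset_integral => //.
    apply/measurable_EFinP; apply: measurable_funS (continuous_measurable_rV _) => //.
    exact: continuous_mul.
  by move=> x _; rewrite lee_fin -expr2 sqr_ge0.
pose b (i : 'I_2) := if i == ord0 then T else u.
pose v := lin_comb b (fun i => if i == ord0 then 1 else - W).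
have sb i : smooth (b i) by rewrite /b; case: ifP.
have sv : smooth v by exact: smooth_lin_comb.
have E2 w : smooth w -> dotL2 Omega v w = dotL2 Omega T w - W * dotL2 Omega u w.
  move=> sw; rewrite (dotL2_lin oO bO _ sb sw) !big_ord_recl big_ord0 /b /=.
  by rewrite mul1r mulNr addr0.
have vv : dotL2 Omega v v = dotL2 Omega T T - 2 * W * S + W ^+ 2 * dotL2 Omega u u.
  rewrite (E2 _ sv) [dotL2 _ T v]dotL2C (E2 _ sT) [dotL2 _ u v]dotL2C (E2 _ su).
  rewrite [dotL2 _ u T]dotL2C TU; ring.
have := dotL2_ge0 Omega v; rewrite vv => H.
rewrite -(ler_pM2l W0); move: H TTle; rewrite expr2; set X := dotL2 Omega u u; lra.
Qed.

End Bessel.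
End Hartley.

(** * Volume of the ball *)

Section BallVolume.
Context {R : realType}.
Local Notation leb n := (@lebesgue_rV R n).

Lemma lebesgue_itvoo (a b : R) :
  lebesgue_measure ([set` `]a, b[] : set R) = (Num.max 0 (b - a))%:E.
Proof.
rewrite lebesgue_measure_itv/= lte_fin; case: ltP => ab.
  by rewrite -EFinB; congr (_%:E); apply/esym/max_idPr; rewrite subr_ge0 ltW.
by congr (_%:E); apply/esym/max_idPl; rewrite subr_le0.
Qed.

Lemma lebesgue_rV_obox n (a b : 'rV[R]_n) :
  leb n (obox a b) = (\prod_(i < n) Num.max 0 (b 0 i - a 0 i))%:E.
Proof. by apply: lebesgue_rV_box => i; exact: lebesgue_itvoo. Qed.

Lemma measurable_scale n (c : R) : measurable_fun setT (fun x : 'rV[R]_n => c *: x).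
Proof.
apply: (measurability (D := setT) (f := fun x : 'rV[R]_n => c *: x)
  [set A : set 'rV[R]_n | open A] erefl) => _ [U oU <-].
rewrite setTI; apply: open_measurable_rV; apply: open_comp oU => x _.
exact: scaler_continuous.
Qed.

Lemma preimage_scale_obox n (c : R) (a b : 'rV[R]_n) : 0 < c ->
  (fun x : 'rV[R]_n => c^-1 *: x) @^-1` obox a b = obox (c *: a) (c *: b).
Proof.
move=> c0; apply/seteqP; split=> x H i; have := H i; rewrite !in_itv/= !mxE.
  by rewrite ltr_pdivlMl// ltr_pdivrMl.
by rewrite ltr_pdivlMl// ltr_pdivrMl.
Qed.

(** The two sides are measures in [A] that agree on open boxes, and boxes determine a measure by
    uniqueness on a generating system stable under intersection. *)
Lemma lebesgue_rV_scale n (c : R) (A : set 'rV[R]_n) : 0 < c -> measurable A ->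
  leb n ((fun x => c^-1 *: x) @^-1` A) = ((c ^+ n)%:E * leb n A)%E.
Proof.
move=> c0 mA; have cn : 0 <= c ^+ n by rewrite exprn_ge0// ltW.
pose mf : {mfun 'rV[R]_n >-> 'rV[R]_n} := HB.pack (fun x : 'rV[R]_n => c^-1 *: x)
  (isMeasurableFun.Build _ _ _ _ _ (@measurable_scale n c^-1)).
have := @measure_unique _ R 'rV[R]_n [set A | exists a b, A = obox a b]
  (fun k => obox (const_mx (- k%:R)) (const_mx k%:R)) measurable_obox_gen _ _ _
  (pushforward (leb n) mf) (mscale (NngNum cn) (leb n)) _ _ A mA.
apply.
- by move=> _ _ [a [b ->]] [a' [b' ->]]; rewrite obox_setI; do 2 eexists.
- by move=> i; do 2 eexists.
- apply/seteqP; split=> // x _; have [r r0 H] := @bounded_cube R n [set x] (compact_bounded (@compact_set1 _ x)).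
  exists (Num.truncn r).+1 => // i; rewrite !mxE.
  have := H x erefl i; rewrite !in_itv/= => /andP[h1 h2].
  have := truncnS_gt r => h3.
  by rewrite (le_lt_trans h2 h3) (lt_le_trans _ h1)// ltrN2.
- move=> _ [a [b ->]]; change (leb n ((fun x : 'rV[R]_n => c^-1 *: x) @^-1` obox a b) =
    ((c ^+ n)%:E * leb n (obox a b))%E); rewrite preimage_scale_obox//.
  rewrite !lebesgue_rV_obox -EFinM; congr (_%:E).
  have -> : c ^+ n = \prod_(i < n) c by rewrite prodr_const card_ord.
  rewrite -big_split/=.
  apply: eq_bigr => i _; rewrite !mxE -mulrBr.
  by rewrite -[in LHS](mulr0 c) maxr_pMr// ltW.
- move=> k; change (leb n ((fun x : 'rV[R]_n => c^-1 *: x) @^-1`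
    obox (const_mx (- k%:R)) (const_mx k%:R))%R < +oo)%E.
  by rewrite preimage_scale_obox// lebesgue_rV_obox ltry.
Qed.

(** Indexed by the squared radius, so that [layer_cake] may use any real level, nonpositive ones
    giving the empty set. *)
Definition eball n (t : R) : set 'rV[R]_n := [set x | dot x x < t].

Lemma continuous_sqnorm n : continuous (fun x : 'rV[R]_n => dot x x).
Proof.
have := smooth_continuous (smooth_dotmx (1%:M : 'M[R]_n)).
by under eq_fun do rewrite mulmx1.
Qed.

Lemma open_eball n t : open (@eball n t).
Proof.
apply: (@open_comp _ _ (fun x : 'rV[R]_n => dot x x) [set y | y < t]); last exact: open_lt.
by move=> x _; exact: continuous_sqnorm.
Qed.

Lemma measurable_eball n t : measurable (@eball n t).
Proof. exact: open_measurable_rV (@open_eball n t). Qed.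

Lemma eball_cube n t : 0 < t -> @eball n (t ^+ 2) `<=` @cube R n t.
Proof.
move=> t0 x xt i; rewrite in_itv/= -ler_norml -(@ler_pXn2r _ 2) ?nnegrE ?(ltW t0)//.
rewrite real_normK ?num_real//; apply: le_trans (ltW xt).
rewrite /dot (bigD1 i)//= expr2 lerDl.
by apply: sumr_ge0 => j _; rewrite -expr2 sqr_ge0.
Qed.

Definition unit_ball n : R := fine (leb n (@eball n 1)).

Lemma unit_ballE n : leb n (@eball n 1) = (unit_ball n)%:E.
Proof.
rewrite /unit_ball fineK// ge0_fin_numE//.
apply: (@le_lt_trans _ _ (leb n (@cube R n 1))).
  apply: le_measure; rewrite ?inE; [exact: measurable_eball|exact: measurable_cube|].
  by have := @eball_cube n 1 ltr01; rewrite expr1n.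
by rewrite lebesgue_rV_cube// ltry.
Qed.

Lemma lebesgue_eball n (t : R) : 0 < t ->
  leb n (@eball n (t ^+ 2)) = (t ^+ n * unit_ball n)%:E.
Proof.
move=> t0; rewrite EFinM -unit_ballE -lebesgue_rV_scale//; last exact: measurable_eball.
congr (leb n _); apply/seteqP; split=> x; rewrite /eball/= dotZl dotZr mulrA -expr2 exprVn;
  by rewrite ltr_pdivrMl ?mulr1// exprn_gt0.
Qed.

Lemma eball0 n t : t <= 0 -> @eball n t = set0.
Proof.
by move=> t0; apply/seteqP; split=> // x; rewrite /eball/= ltNge (le_trans t0)// dot_ge0.
Qed.

(** Tonelli in both orders for [g t] on the open set of pairs [(t, x)] with [|x|^2 < theta t]. It is
    used with [theta t = t] for the Gamma function and [theta t = t^2] for the quartic integral. *)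
Lemma layer_cake n (theta g : R -> R) : continuous theta -> measurable_fun setT g ->
  (forall t, 0 <= g t) ->
  (\int[lebesgue_measure]_t ((g t)%:E * leb n (@eball n (theta t))) =
   \int[leb n]_x \int[lebesgue_measure]_(t in [set t | (dot x x < theta t)%R]) (g t)%:E)%E.
Proof.
move=> ct mg g0.
pose tl (y : 'rV[R]_n.+1) : 'rV[R]_n := \row_i y 0 (lift ord0 i).
pose U := [set y : 'rV[R]_n.+1 | dot (tl y) (tl y) < theta (y 0 0)].
have ctl : continuous tl.
  move=> y A /nbhs_ballP[e /= e0 HA]; apply/nbhs_ballP; exists e => //= w [_ yw].
  by apply: HA; split=> // i j; rewrite !mxE; exact: yw.
have oU : open U.
  have -> : U = (fun y : 'rV[R]_n.+1 => theta (y 0 0) - dot (tl y) (tl y)) @^-1` [set s | 0 < s].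
    by apply/seteqP; split=> y; rewrite /U/= subr_gt0.
  apply: open_comp; last exact: open_gt.
  move=> y _; apply: (@continuousB _ _ _ (fun y : 'rV[R]_n.+1 => theta (y 0 0)) (fun y => dot (tl y) (tl y))).
    apply: (@continuous_comp _ _ _ (fun y : 'rV[R]_n.+1 => y 0 0) theta); last exact: ct.
    exact: coord_continuous.
  apply: (@continuous_comp _ _ _ tl (fun x => dot x x)); first exact: ctl.
  exact: continuous_sqnorm.
pose H (y : 'rV[R]_n.+1) := ((g (y 0 0))%:E * (\1_U y)%:E)%E.
have mH : measurable_fun setT H.
  apply: emeasurable_funM; apply/measurable_EFinP; last first.
    by apply: measurable_indic; exact: open_measurable_rV.
  apply: (measurableT_comp mg).
  by apply: continuous_measurable_rV; exact: coord_continuous.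
have H0 y : (0 <= H y)%E by rewrite mule_ge0// lee_fin.
have tlE (t : measurableTypeR R) v : tl (cons_rV (t, v)) = v.
  by apply/rowP => i; rewrite mxE cons_rVS.
have UE (t : measurableTypeR R) v : \1_U (cons_rV (t, v)) = \1_(@eball n (theta t)) v :> R.
  rewrite !indicE; congr (nat_of_bool _)%:R; apply/idP/idP => /set_mem h;
    by apply/mem_set; move: h; rewrite /U /eball/= tlE cons_rV0.
transitivity (\int[leb n.+1]_y H y)%E.
  rewrite tonelli_rV1//; apply: eq_integral => t _.
  under eq_integral do rewrite /H UE cons_rV0.
  transitivity (\int[leb n]_x ((g t)%:E * (\1_(@eball n (theta t)) x)%:E))%E; last by [].
  have mI : measurable_fun setT (fun v => (\1_(@eball n (theta t)) v)%:E : \bar R).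
    by apply/measurable_EFinP/measurable_indic; exact: measurable_eball.
  rewrite (ge0_integralZl (leb n) measurableT mI); [|by move=> v _; rewrite lee_fin|by rewrite lee_fin].
  by rewrite integral_indic ?setIT//; exact: measurable_eball.
rewrite tonelli_rV2//; apply: eq_integral => v _.
rewrite [RHS]integral_mkcond; apply: eq_integral => t _.
rewrite /H UE cons_rV0 patchE indicE.
have -> : (v \in @eball n (theta t)) = (t \in [set t | dot v v < theta t]).
  by apply/idP/idP => /set_mem h; apply/mem_set.
by case: ifP => _; rewrite ?mule1 ?mule0.
Qed.

End BallVolume.

(** * Gaussian integral, volume of the unit ball and the quartic integral *)

Section BallVolumeValue.
Context {R : realType}.
Local Notation leb n := (@lebesgue_rV R n).

Lemma ge0_integralZl_real (disp : measure_display) (T : measurableType disp)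
    (mu : {measure set T -> \bar R}) (D : set T) (f : T -> R) (k : R) :
  measurable D -> 0 <= k -> measurable_fun D f -> (forall x, D x -> 0 <= f x) ->
  (\int[mu]_(x in D) (k%:E * (f x)%:E) = k%:E * \int[mu]_(x in D) (f x)%:E)%E.
Proof.
move=> mD k0 mf f0; apply: ge0_integralZl_EFin => //; exact/measurable_EFinP.
Qed.

Lemma integral_expRN (s : R) :
  (\int[@lebesgue_measure R]_(t in [set` `]s, +oo[]) (expR (- t))%:E)%E = (expR (- s))%:E.
Proof.
have HF (t : R) : is_derive t 1 (fun t : R => - expR (- t)) (expR (- t)).
  have H : is_derive t 1 (fun t : R => expR (- t)) (expR (- t) * - 1).
    by apply: (@is_derive1_comp _ expR (fun t : R => - t)).
  by apply: (is_derive_eq (is_deriveN H)); rewrite mulrN1 opprK.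
have cF : continuous (fun t : R => - expR (- t)).
  by apply: derivable1_continuous => t; case: (HF t).
have ce : continuous (fun t : R => expR (- t)).
  by move=> t; apply: continuous_comp; [exact: opp_continuous|exact: continuous_expR].
rewrite integral_itv_obnd_cbnd; last first.
  by apply/measurable_EFinP; apply: measurable_funS (continuous_measurable_fun ce).
rewrite (@ge0_continuous_FTC2y _ _ (fun t => - expR (- t)) s 0).
- by rewrite -EFinB sub0r opprK.
- by move=> x _; exact: expR_ge0.
- exact: continuous_subspaceT.
- by rewrite -oppr0; apply: cvgN; exact: cvgr_expR.
- by move=> x _; case: (HF x).
- by apply: cvg_at_right_filter; exact: cF.
- by move=> x _; rewrite derive1E; case: (HF x).
Qed.

Lemma integral_monomial (a b : R) n : a <= b ->
  (\int[@lebesgue_measure R]_(t in [set` `]a, b[]) (n.+1%:R * t ^+ n)%:E)%E =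
  (b ^+ n.+1 - a ^+ n.+1)%:E.
Proof.
rewrite le_eqVlt => /predU1P[->|ab].
  by rewrite set_itvoo0 ?integral_set0 ?subrr.
have HF (t : R) : is_derive t 1 (fun t : R => t ^+ n.+1) (n.+1%:R * t ^+ n).
  apply: DeriveDef; first exact: exprn_derivable.
  by rewrite exp_derive /GRing.scale/= mulr1.
have cF : continuous (fun t : R => t ^+ n.+1) by exact: exprn_continuous.
have cf : continuous (fun t : R => n.+1%:R * t ^+ n).
  move=> t; apply: (@continuousM _ _ (cst (n.+1%:R : R)) (fun t : R => t ^+ n)).
    exact: cst_continuous.
  exact: exprn_continuous.
have mf (A : set R) : measurable A -> measurable_fun A (EFin \o (fun t => n.+1%:R * t ^+ n)).
  by move=> mA; apply/measurable_EFinP; apply: measurable_funS (continuous_measurable_fun cf).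
rewrite integral_itv_obnd_cbnd; last exact: mf.
rewrite integral_itv_bndo_bndc; last exact: mf.
rewrite (@continuous_FTC2 _ _ (fun t => t ^+ n.+1) a b)//.
- exact: continuous_subspaceT.
- split; [by move=> t _; case: (HF t)|..].
    by apply: cvg_at_right_filter; exact: cF.
  by apply: cvg_at_left_filter; exact: cF.
- by move=> t _; rewrite derive1E; case: (HF t).
Qed.

Lemma gauss_rV n :
  (\int[leb n]_x (expR (- dot x x))%:E)%E = (Num.sqrt pi ^+ n)%:E.
Proof.
have cg k : continuous (fun x : 'rV[R]_k => expR (- dot x x)).
  move=> x; apply: (@continuous_comp _ _ _ (fun x : 'rV[R]_k => - dot x x) expR).
    by apply: continuousN; exact: continuous_sqnorm.
  exact: continuous_expR.
elim: n => [|n IHn].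
  rewrite integral_lebesgue_rV0; last first.
    by apply/measurable_EFinP; exact: continuous_measurable_rV.
  by rewrite /dot big_ord0 oppr0 expR0 expr0.
rewrite tonelli_rV1; last 2 first.
- by apply/measurable_EFinP; exact: continuous_measurable_rV.
- by move=> x; rewrite lee_fin expR_ge0.
transitivity (\int[@lebesgue_measure R]_t ((Num.sqrt pi ^+ n)%:E * (gauss_fun t)%:E))%E.
  apply: eq_integral => t _.
  transitivity (\int[leb n]_v ((gauss_fun t)%:E * (expR (- dot v v))%:E))%E.
    apply: eq_integral => v _; rewrite -EFinM; congr (_%:E).
    rewrite /gauss_fun -expRD -opprD; congr (expR (- _)).
    rewrite /dot big_ord_recl cons_rV0 -expr2; congr (_ + _).
    by apply: eq_bigr => i _; rewrite cons_rVS.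
  rewrite (ge0_integralZl_real (leb n) measurableT (gauss_fun_ge0 t)
    (continuous_measurable_rV (cg n)) (fun v _ => expR_ge0 _)).
  by rewrite IHn muleC.
rewrite (@ge0_integralZl_real _ _ (@lebesgue_measure R) setT (@gauss_fun R))//.
- by rewrite integralT_gauss -EFinM exprSr.
- exact: measurable_gauss_fun.
- by move=> t _; exact: gauss_fun_ge0.
Qed.

Lemma unit_ball_gt0 n : 0 < unit_ball (R := R) n.
Proof.
rewrite -lte_fin -unit_ballE; apply: open_lebesgue_rV_gt0; first exact: open_eball.
by exists 0; rewrite /eball/= /dot big1// => i _; rewrite mxE mul0r.
Qed.

(** The Gaussian [exp(-|x|^2)] is the integral of [exp(-t)] over [t > |x|^2]. Layer by layer its
    total mass [pi^(n/2)] becomes the integral of [t^(n/2) exp(-t)] times the volume of the unit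
    ball. *)
Lemma unit_ball_Gamma n :
  unit_ball n * Gamma (1 + n%:R / 2) = (pi : R) `^ (n%:R / 2).
Proof.
have ce : continuous (fun t : R => expR (- t)).
  by move=> t; apply: continuous_comp; [exact: opp_continuous|exact: continuous_expR].
have := @layer_cake R n id (fun t => expR (- t)) (fun x A => id)
  (continuous_measurable_fun ce) (fun t => expR_ge0 _).
have -> : (\int[leb n]_x \int[@lebesgue_measure R]_(t in [set t | (dot x x < id t)%R])
    (expR (- t))%:E = (Num.sqrt pi ^+ n)%:E)%E.
  rewrite -gauss_rV; apply: eq_integral => x _.
  rewrite -integral_expRN; congr (integral _ _ _).
  by apply/seteqP; split=> t; rewrite /= in_itv/= andbT.
have -> : (\int[@lebesgue_measure R]_t ((expR (- t))%:E * leb n (@eball R n (id t))) =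
    \int[@lebesgue_measure R]_(t in [set` `](0:R)%R, +oo[])
      ((unit_ball n)%:E * (t `^ (1 + n%:R / 2 - 1) * expR (- t))%:E))%E.
  rewrite [RHS]integral_mkcond; apply: eq_integral => t _; rewrite patchE.
  case: ifPn => [|/negP]; rewrite inE/= in_itv/= andbT.
    move=> t0; rewrite -[t in eball t]sqr_sqrtr ?ltW// lebesgue_eball ?sqrtr_gt0//.
    rewrite -!EFinM; congr (_%:E).
    have -> : 1 + n%:R / 2 - 1 = 2^-1 * n%:R :> R by field.
    rewrite powRrM powR12_sqrt ?ltW// powR_mulrn ?sqrtr_ge0//; ring.
  by move=> /negP; rewrite -leNgt => /eball0 ->; rewrite measure0 mule0.
have w0 := unit_ball_gt0 n.
have mg : measurable_fun [set` `](0 : R), +oo[]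
    (fun t : R => t `^ (1 + n%:R / 2 - 1) * expR (- t)).
  apply: measurable_funM; first by apply: measurable_funS (measurable_powR _).
  by apply: measurable_funS (continuous_measurable_fun ce).
have g0 (t : R) : [set` `](0 : R), +oo[] t -> 0 <= t `^ (1 + n%:R / 2 - 1) * expR (- t).
  by move=> _; rewrite mulr_ge0 ?powR_ge0 ?expR_ge0.
rewrite (@ge0_integralZl_real _ _ (@lebesgue_measure R) _ _ _ _ (ltW w0) mg g0)// => H.
(* [Gamma] is the [fine] part of this integral. It is finite because its product with the positive
   volume of the unit ball is the finite Gaussian mass. *)
have : (\int[@lebesgue_measure R]_(t in [set` `](0:R)%R, +oo[])
   (t `^ (1 + n%:R / 2 - 1) * expR (- t))%:E = (Gamma (1 + n%:R / 2))%:E)%E.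
  rewrite /Gamma /Rintegral fineK// fin_numElt (@lt_le_trans _ _ 0%E)//=; last first.
    by apply: integral_ge0 => t Dt; rewrite lee_fin g0.
  rewrite ltey; apply/eqP => Hoo; move: H; rewrite Hoo gt0_muley ?lte_fin//.
move=> H1; move: H; rewrite H1 -EFinM => -[->].
have -> : n%:R / 2 = 2^-1 * n%:R :> R by field.
by rewrite powRrM powR12_sqrt ?pi_ge0// powR_mulrn ?sqrtr_ge0.
Qed.

Lemma unit_ball_volume n : unit_ball n = ball_volume n :> R.
Proof.
rewrite /ball_volume -unit_ball_Gamma mulfK//; apply/eqP => G0.
have := unit_ball_Gamma n; rewrite G0 mulr0 => /esym/eqP.
by rewrite gt_eqF// powR_gt0// pi_gt0.
Qed.

(** The positive part of [b^4 - |x|^4] is the integral of [4 t^3] over [|x| < t < b]. Exchanging the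
    integrals leaves that of [4 t^3 t^n] over [0 < t < b], times the volume of the unit ball. *)
Lemma integral_quartic n (b : R) : 0 < b ->
  (\int[leb n]_x (Num.max 0 (b ^+ 4 - dot x x ^+ 2))%:E)%E =
  (4 / (n%:R + 4) * unit_ball n * b ^+ (n + 4))%:E.
Proof.
move=> b0.
pose g (t : R) : R := (4 * t ^+ 3) * \1_([set` `](0 : R), b[]) t.
have g0 t : 0 <= g t.
  rewrite /g indicE; case: (boolP (_ \in _)) => [|_]; last by rewrite mulr0.
  by rewrite inE/= in_itv/= => /andP[t0 _]; rewrite mulr1 mulr_ge0// exprn_ge0// ltW.
have mg : measurable_fun setT g.
  apply: measurable_funM; last exact: measurable_indic.
  by apply: measurable_funM => //; exact: measurable_funX.
have := @layer_cake R n (fun t => t ^+ 2) g (@exprn_continuous _ 2) mg g0.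
have -> : (\int[leb n]_x \int[@lebesgue_measure R]_(t in [set t | (dot x x < t ^+ 2)%R]) (g t)%:E =
    \int[leb n]_x (Num.max 0 (b ^+ 4 - dot x x ^+ 2))%:E)%E.
  apply: eq_integral => x _.
  set rho := Num.sqrt (dot x x).
  have rho0 : 0 <= rho by exact: sqrtr_ge0.
  have rho2 : rho ^+ 2 = dot x x by rewrite sqr_sqrtr// dot_ge0.
  have lt2 t : 0 < t -> (dot x x < t ^+ 2) = (rho < t).
    by move=> t0; rewrite -rho2 ltr_pXn2r// nnegrE ltW.
  transitivity (\int[@lebesgue_measure R]_(t in [set` `]rho, b[]) (3.+1%:R * t ^+ 3)%:E)%E.
    rewrite integral_mkcond [RHS]integral_mkcond; apply: eq_integral => t _.
    rewrite !patchE /g indicE.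
    have E : (t \in [set t | dot x x < t ^+ 2]) = (dot x x < t ^+ 2).
      by apply/idP/idP => [/set_mem|] //; exact: mem_set.
    rewrite [X in (if X then _ else _) = _]E !mem_setE/= !in_itv/=.
    have [t0|t0] := ltP 0 t; last first.
      by rewrite mulr0 if_same ltNge (le_trans t0).
    rewrite lt2//.
    by case: (rho < t) => //=; case: (t < b); rewrite ?mulr1 ?mulr0.
  have rho4 : rho ^+ 4 = dot x x ^+ 2 by rewrite -rho2 -exprM.
  have [rb|br] := leP rho b.
    rewrite integral_monomial// rho4; congr (_%:E); apply/esym/max_idPr.
    by rewrite subr_ge0 -rho4 ler_pXn2r// nnegrE ltW.
  rewrite set_itv_ge ?bnd_simp -?leNgt ?(ltW br)// integral_set0; congr (_%:E); apply/esym/max_idPl.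
  by rewrite subr_le0 -rho4 ler_pXn2r ?nnegrE ?(ltW br)// ltW.
move=> <-.
transitivity (\int[@lebesgue_measure R]_(t in [set` `](0:R)%R, b[])
    ((4 / (n%:R + 4) * unit_ball n)%:E * ((n + 3).+1%:R * t ^+ (n + 3))%:E))%E.
  rewrite [RHS]integral_mkcond; apply: eq_integral => t _; rewrite patchE /g indicE.
  case: ifPn => [|_]; last by rewrite mulr0 mul0e.
  rewrite inE/= in_itv/= => /andP[t0 _].
  rewrite lebesgue_eball// -!EFinM mulr1; congr (_%:E).
  have -> : (n + 3).+1%:R = n%:R + 4 :> R by rewrite -addnS natrD.
  rewrite exprD; field.
  by rewrite gt_eqF// ltr_wpDl.
have mt : measurable_fun [set` `](0 : R), b[] (fun t : R => (n + 3).+1%:R * t ^+ (n + 3)).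
  exact: (@measurable_funM _ _ _ _ (cst (n + 3).+1%:R) (fun t : R => t ^+ (n + 3))).
have t0 (t : R) : [set` `](0 : R), b[] t -> 0 <= (n + 3).+1%:R * t ^+ (n + 3).
  by rewrite /= in_itv/= => /andP[t0 _]; rewrite mulr_ge0// exprn_ge0// ltW.
rewrite (@ge0_integralZl_real _ _ (@lebesgue_measure R) _ _ _ _ _ mt t0)//; last first.
  by rewrite !mulr_ge0// ?invr_ge0 ?addr_ge0// ltW// unit_ball_gt0.
by rewrite integral_monomial ?ltW// -EFinM expr0n subr0 -addnS.
Qed.

End BallVolumeValue.

(** * Lattice sums *)

Section LatticeSums.
Context {R : realType} {d : nat}.
Local Notation E := 'rV[R]_d.
Local Notation mu := (@lebesgue_rV R d).

(** A finite type for the integer points with coordinates between [-n] and [n], after the shift made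
    by [grid_int]. The odd count makes it symmetric, so that [grid_opp] realises [p -> -p]. *)
Definition grid (n : nat) := 'rV['I_(n.*2.+1)]_d.

Definition grid_int n (t : grid n) : 'rV[int]_d := \row_i ((t 0 i)%:Z - n%:Z).

Definition grid_opp n (t : grid n) : grid n := \row_i rev_ord (t 0 i).

Lemma grid_int_inj n : injective (@grid_int n).
Proof.
move=> s t /rowP H; apply/rowP => i; have := H i; rewrite !mxE => /addIr.
by case=> /ord_inj.
Qed.

Lemma grid_int_opp n (t : grid n) : grid_int (grid_opp t) = - grid_int t.
Proof.
apply/rowP => i; rewrite !mxE /= subSS.
have := ltn_ord (t 0 i); move: (nat_of_ord (t 0 i)) => k; rewrite ltnS => kn.
by rewrite -subzn// -addnn PoszD opprB addrAC addrK.
Qed.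

Lemma grid_oppK n : involutive (@grid_opp n).
Proof. by move=> t; apply/rowP => i; rewrite !mxE rev_ordK. Qed.

Lemma ex_grid n (v : 'rV[int]_d) : (forall i, `|v 0 i| <= n%:Z) ->
  exists t : grid n, grid_int t = v.
Proof.
move=> vn; exists (\row_i inord (absz (v 0 i + n%:Z))); apply/rowP => i; rewrite !mxE.
have := vn i; rewrite ler_norml => /andP[h1 h2].
have h0 : 0 <= v 0 i + n%:Z by rewrite -lerBlDr sub0r.
rewrite inordK; last first.
  by rewrite ltnS -lez_nat gez0_abs// -addnn PoszD lerD2r.
by rewrite gez0_abs// addrK.
Qed.

Variable m : nat.
Let h : R := m.+1%:R^-1.
Let h0 : 0 < h. Proof. by rewrite invr_gt0. Qed.

Definition lattice_floor (x : E) : 'rV[int]_d := \row_i Num.floor (m.+1%:R * x 0 i).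

Definition lattice_pt (v : 'rV[int]_d) : E := \row_i (m.+1%:R^-1 * (v 0 i)%:~R).

Definition cell (v : 'rV[int]_d) : set E :=
  box (fun i => `[m.+1%:R^-1 * (v 0 i)%:~R, m.+1%:R^-1 * (v 0 i + 1)%:~R[).

Lemma in_cell v x : cell v x <-> lattice_floor x = v.
Proof.
have H i : (x 0 i \in `[m.+1%:R^-1 * (v 0 i)%:~R, m.+1%:R^-1 * (v 0 i + 1)%:~R[) =
    ((v 0 i)%:~R <= m.+1%:R * x 0 i < (v 0 i + 1)%:~R).
  by rewrite in_itv/= ler_pdivrMl// ltr_pdivlMl.
split=> [Hx|Hv i].
  by apply/rowP => i; rewrite mxE; apply: floor_def; rewrite -H; exact: Hx.
suff E : (v 0 i)%:~R <= m.+1%:R * x 0 i < (v 0 i + 1)%:~R by rewrite -H in E.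
by rewrite -Hv mxE floor_itv.
Qed.

Lemma lattice_pt_near x i : `|lattice_pt (lattice_floor x) 0 i - x 0 i| <= h.
Proof.
rewrite !mxE; have /andP[h1 h2] := floor_itv (m.+1%:R * x 0 i).
have mh : m.+1%:R * h = 1 by rewrite mulfV.
rewrite distrC ger0_norm; last by rewrite subr_ge0 ler_pdivrMl.
rewrite lerBlDl -[X in _ + X]mulr1 -mulrDr ler_pdivlMl//.
by move/ltW: h2; rewrite intrD.
Qed.

Lemma lebesgue_cell v : mu (cell v) = (h ^+ d)%:E.
Proof.
rewrite (@lebesgue_rV_box R d _ (fun=> h)) ?prodr_const ?card_ord// => i.
rewrite lebesgue_measure_itv/= lte_fin ltr_pM2l// ltr_int ltrDl ltr01.
by rewrite -EFinB -mulrBr intrD addrAC subrr add0r mulr1.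
Qed.

(** The half-open cells are disjoint, so at most one term is nonzero. If the cell of [x] is missing
    from the grid, its lattice point lies outside the support of [F] and both sides are 0. *)
Lemma lattice_step_sum (F : E -> R) c n x : (c%:R <= h * n%:R) ->
  (forall x, ~ cube c%:R x -> F x = 0) ->
  F (lattice_pt (lattice_floor x)) =
  \sum_(t : grid n) F (lattice_pt (grid_int t)) * \1_(cell (grid_int t)) x.
Proof.
move=> cn F0.
have I1 t : \1_(cell (grid_int t)) x = (lattice_floor x == grid_int t)%:R :> R.
  rewrite indicE; congr (nat_of_bool _)%:R.
  by apply/idP/eqP => [/set_mem/in_cell//|H]; apply/mem_set/in_cell.
under eq_bigr do rewrite I1.
have [H|] := pselect (forall i, `|lattice_floor x 0 i| <= n%:Z).
  have [t tE] := ex_grid H.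
  rewrite (bigD1 t)//= big1 ?addr0 => [|s st]; first by rewrite tE eqxx mulr1.
  by rewrite -tE (inj_eq (@grid_int_inj n)) eq_sym (negbTE st) mulr0.
move=> /existsNP[i /negP]; rewrite -ltNge => Hi.
rewrite F0 => [|/(_ i)]; last first.
  rewrite in_itv/= -ler_norml => H.
  have : `|lattice_pt (lattice_floor x) 0 i| <= h * n%:R by exact: le_trans H cn.
  rewrite mxE normrM gtr0_norm// ler_pM2l// -intr_norm -[n%:R]/(n%:Z%:~R) ler_int.
  by rewrite leNgt Hi.
rewrite big1// => t _; rewrite (_ : (_ == _) = false) ?mulr0//; apply/eqP => E1.
move: Hi; rewrite E1 ltNge mxE => /negP; apply.
have := ltn_ord (t 0 i); rewrite ltnS => ti.
rewrite ler_norml; apply/andP; split; first by rewrite lerBrDr addNr.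
by rewrite lerBlDr -PoszD lez_nat addnn.
Qed.

End LatticeSums.

(** * Convergence of lattice sums to integrals *)

Section LatticeLimit.
Context {R : realType} {d : nat}.
Local Notation E := 'rV[R]_d.
Local Notation mu := (@lebesgue_rV R d).

(** The lattice sum is the integral of the step function [f m], and [f m] tends to [F] pointwise by
    continuity; dominated convergence concludes. With mesh [1/(m+1)], a grid of [(m+1) c] steps each
    way reaches the faces of the cube. *)
Lemma lattice_sum_cvg (F : E -> R) (c : nat) (I : R) : continuous F ->
  (forall x, 0 <= F x) -> (forall x, ~ cube c%:R x -> F x = 0) ->
  (\int[mu]_x (F x)%:E)%E = I%:E ->
  (\sum_(t : grid (m.+1 * c)) F (lattice_pt m (grid_int t))) * m.+1%:R^-1 ^+ d
    @[m --> \oo] --> I.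
Proof.
move=> cF F0 Fc FI.
pose f m (x : E) : R := F (lattice_pt m (lattice_floor m x)).
have nc m : (c%:R : R) <= m.+1%:R^-1 * (m.+1 * c)%N%:R.
  by rewrite natrM mulrA mulVf ?mul1r.
have fE m x := @lattice_step_sum R d m F c (m.+1 * c) x (nc m) Fc.
have mcell m v : measurable (@cell R d m v) by exact: measurable_box.
have mt m (t : grid (m.+1 * c)) : measurable_fun setT
    (fun x : E => F (lattice_pt m (grid_int t)) * \1_(cell m (grid_int t)) x).
  apply: (@measurable_funM _ _ _ _ (cst _) (\1_(cell m (grid_int t)) : E -> R)).
    exact: measurable_cst.
  by apply: measurable_indic.
have mf m : measurable_fun setT (f m).
  rewrite (_ : f m = fun x => \sum_(t : grid (m.+1 * c))
      F (lattice_pt m (grid_int t)) * \1_(cell m (grid_int t)) x); last first.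
    by apply/funext => x; exact: fE.
  by apply: measurable_sum => t; exact: mt.
have If m : (\int[mu]_x (f m x)%:E)%E =
    ((\sum_(t : grid (m.+1 * c)) F (lattice_pt m (grid_int t))) * m.+1%:R^-1 ^+ d)%:E.
  under eq_integral do rewrite /f fE -sumEFin.
  rewrite ge0_integral_sum//; last 2 first.
  - by move=> t; apply/measurable_EFinP; exact: mt.
  - by move=> t x _; rewrite lee_fin mulr_ge0.
  rewrite mulr_suml -sumEFin; apply: eq_bigr => t _.
  under eq_integral do rewrite EFinM.
  rewrite (@ge0_integralZl_real _ _ _ mu setT (\1_(cell m (grid_int t)) : E -> R));
    [|by []|exact: F0|by apply: measurable_indic|by []].
  rewrite integral_indic// setIT EFinM; congr (_ * _)%E; exact: lebesgue_cell.
have [C C0 HC] : exists2 C, 0 <= C & forall x, F x <= C.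
  have [C C0 HC] := continuous_bounded (@cube_bounded R d c%:R) cF.
  exists C => // x; have [/HC|/Fc ->//] := pselect (cube c%:R x).
  by apply: le_trans; exact: ler_norm.
(* A point and its lattice point differ by at most one mesh, hence by at most 1 in each coordinate,
   so the enlarged cube contains the support of every [f m]. *)
pose g (x : E) : \bar R := ((cst C%:E) \_ (cube (c%:R + 1))) x.
have ig : mu.-integrable setT g.
  apply: (integrable_mkcond _ (@measurable_cube R d (c%:R + 1))).1.
  apply: (@continuous_integrable_rV R d _ (cst C)); [exact: measurable_cube|exact: cube_bounded|].
  exact: cst_continuous.
have [|||||_ _] := @dominated_convergence _ _ _ mu setT measurableT
  (fun m x => (f m x)%:E) (fun x => (F x)%:E) g.
- by move=> m; apply/measurable_EFinP.
- by apply/measurable_EFinP; exact: continuous_measurable_rV.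
- apply: aeW => x _; apply: cvg_EFin; first by near=> m.
  apply/cvgrPdist_lt => e e0.
  have /cvgrPdist_lt/(_ e e0)/nbhs_ballP[dl /= dl0 Hdl] := cF x.
  near=> m; apply: Hdl; split=> // i j; rewrite (ord1 i) /ball/= distrC.
  apply: (le_lt_trans (lattice_pt_near m x j)).
  near: m; have /cvgrPdist_lt/(_ dl dl0) := @cvg_harmonic R.
  by apply: filterS => k; rewrite sub0r normrN ger0_norm//= invr_ge0.
- exact: ig.
- apply: aeW => x m _; rewrite /g patchE abse_EFin.
  case: ifPn => [_|/negP xc]; first by rewrite /f lee_fin ger0_norm ?F0//; exact: HC.
  rewrite /f Fc ?normr0// => H; apply: xc; apply/mem_set => i.
  have := H i; rewrite !in_itv/= -!ler_norml => Hi.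
  have := lattice_pt_near m x i => Hn.
  have -> : x 0 i = lattice_pt m (lattice_floor m x) 0 i
      - (lattice_pt m (lattice_floor m x) 0 i - x 0 i) by rewrite opprB addrC subrK.
  apply: le_trans (ler_normB _ _) _; apply: lerD => //.
  by apply: le_trans Hn _; rewrite invf_le1// ler1n.
rewrite FI (_ : [sequence _]_n = fun m => ((\sum_(t : grid (m.+1 * c))
   F (lattice_pt m (grid_int t))) * m.+1%:R^-1 ^+ d)%:E); last first.
  by apply/funext => m; rewrite -If.
by move=> /fine_cvgP[_].
Unshelve. all: by end_near. Qed.

End LatticeLimit.

(** * The eigenvalue estimate *)

Section Kroger.
Context {R : realType} {d : nat}.
Local Notation E := 'rV[R]_d.
Local Notation mu := (@lebesgue_rV R d).
Variables (Omega : set E) (a : R).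
Hypotheses (hd : (0 < d)%N) (oO : open Omega) (bO : bounded_set Omega) (O0 : Omega !=set0).
Hypotheses (a1 : a < 1) (ad : (1 < d)%N -> - (d%:R - 1)^-1 < a).
Local Notation M := (neumann_eigenvalue Omega a).

Let mO : measurable Omega := open_measurable_rV oO.

(** The half-side [pi (m+1)] is chosen so that the frequency spacing [pi / r] is the mesh
    [1/(m+1)]. *)
Lemma freq_lattice m (v : 'rV[int]_d) : freq (pi * m.+1%:R) v = lattice_pt m v :> E.
Proof.
apply/rowP => i; rewrite !mxE; congr (_ * _).
by rewrite invfM mulrA mulfV ?mul1r// gt_eqF// pi_gt0.
Qed.

Lemma lattice_bound k n (r : R) : 0 < r -> Omega `<=` cube r ->
  volume Omega * \sum_(t : grid (d := d) n)
    Num.max 0 (M k.+1 - sqnorm (freq r (grid_int t)) ^+ 2) <=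
  (2 * r) ^+ d * \sum_(j < k) (M k.+1 - M j.+1).
Proof.
move=> r0 Or.
pose p (t : @grid d n) := freq r (grid_int t).
pose w t := Num.max 0 (M k.+1 - sqnorm (p t) ^+ 2).
pose q t := dotL2 Omega (hartley (p t)) (hartley (p t)).
have W0 : 0 <= (2 * r) ^+ d by rewrite exprn_ge0// mulr_ge0// ltW.
have H1 (i : 'I_#|{: @grid d n}|) : smooth (hartley (p (enum_val i))).
  exact: smooth_hartley.
have H2 (i : 'I_#|{: @grid d n}|) := @cform_hartley R d Omega a (p (enum_val i)) mO bO.
have H3 (u : E -> R) : smooth u -> \sum_(i < #|{: @grid d n}|)
    dotL2 Omega (hartley (p (enum_val i))) u ^+ 2 <= (2 * r) ^+ d * dotL2 Omega u u.
  apply: (@bessel_hartley R d r #|{: @grid d n}| (fun i => grid_int (enum_val i))) => //.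
  by move=> i j /grid_int_inj/enum_val_inj.
have := riesz_mean_bound oO bO O0 a1 ad hd k H1 H2 H3 W0.
have -> : \sum_(i < #|{: @grid d n}|) Num.max 0 (M k.+1 - sqnorm (p (enum_val i)) ^+ 2) *
    dotL2 Omega (hartley (p (enum_val i))) (hartley (p (enum_val i))) =
    \sum_t w t * q t.
  by rewrite -(big_enum_val (A := {: @grid d n}) (fun t => w t * q t)); exact: eq_bigl.
apply: le_trans; rewrite -(ler_pM2l (ltr0Sn R 1)).
have pN t : p (grid_opp t) = - p t.
  by rewrite /p grid_int_opp; apply/rowP => i; rewrite !mxE mulrNz mulrN.
(* The weight [w] is even, so reindexing by [grid_opp] pairs each frequency with its opposite and
   replaces the unknown norms by [2 * volume Omega]. *)
have -> : 2 * \sum_t w t * q t = \sum_t w t * (q t + q (grid_opp t)).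
  under [RHS]eq_bigr do rewrite mulrDr.
  rewrite big_split/= mulr2n mulrDl mul1r; congr (_ + _).
  rewrite (reindex_inj (inv_inj (@grid_oppK d n))); apply: eq_bigr => t _ /=.
  by rewrite /w pN /sqnorm dotNl (dotC _ (- p t)) dotNl opprK.
rewrite mulrA mulr_sumr le_eqVlt; apply/orP; left; apply/eqP.
apply: eq_bigr => t _; rewrite /q pN dotL2_hartleyN// -/(p t) -/(w t).
by rewrite mulrC.
Qed.

(** [b] is the radius of the ball of frequencies with [|p|^4 < M k.+1]. After multiplication by the
    cell volume the right-hand side of [lattice_bound] is the same for all [m], so the bound passes
    to the limit. *)
Lemma kroger_bound k (b : R) : 0 < b -> M k.+1 = b ^+ 4 ->
  volume Omega * (4 / (d%:R + 4) * unit_ball d * b ^+ (d + 4)) <=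
  (2 * pi) ^+ d * \sum_(j < k) (M k.+1 - M j.+1).
Proof.
move=> b0 zb; set S := \sum_(j < k) _.
pose F (x : E) : R := Num.max 0 (b ^+ 4 - dot x x ^+ 2).
pose c := (Num.truncn b).+1.
have cF : continuous F.
  move=> x; apply: (@continuous_max _ _ (cst 0) (fun x : E => b ^+ 4 - dot x x ^+ 2)).
    exact: cst_continuous.
  apply: (@continuousB _ _ _ (cst (b ^+ 4)) (fun x : E => dot x x ^+ 2)).
    exact: cst_continuous.
  apply: (@continuous_comp _ _ _ (fun x : E => dot x x) (fun t => t ^+ 2)).
    exact: continuous_sqnorm.
  exact: exprn_continuous.
have F0 x : 0 <= F x by rewrite /F le_max lexx.
have Fc x : ~ cube c%:R x -> F x = 0.
  move=> xc; apply/max_idPl; rewrite subr_le0 leNgt; apply/negP => H; apply: xc.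
  have {}H : dot x x < c%:R ^+ 2.
    rewrite -(@ltr_pXn2r _ 2) ?nnegrE ?dot_ge0 ?exprn_ge0//.
    apply: (lt_trans H); rewrite -exprM ltr_pXn2r ?nnegrE ?(ltW b0)//.
    exact: truncnS_gt.
  by apply: (@eball_cube R d c%:R) => //; rewrite ltr0n.
have H := @lattice_sum_cvg R d F c _ cF F0 Fc (integral_quartic d b0).
have {}H := cvgM (cvg_cst (volume Omega)) H.
apply: (cvgr_to_le (H _ _)).
have [r r0 Or] := bounded_cube bO.
near=> m.
have rm : r <= pi * m.+1%:R.
  have h1 : r <= m%:R by near: m; exact: nbhs_infty_ger.
  apply: (le_trans h1); rewrite (@le_trans _ _ m.+1%:R) ?ler_nat//.
  by rewrite ler_peMl// (le_trans _ (@pi_ge2 R))// ler1n.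
have rm0 : 0 < pi * m.+1%:R :> R by rewrite mulr_gt0 ?pi_gt0.
have Orm : Omega `<=` cube (pi * m.+1%:R).
  move=> x /Or xr i; have := xr i; rewrite !in_itv/= -!ler_norml => /le_trans; exact.
have := lattice_bound k (m.+1 * c) rm0 Orm.
rewrite -/S zb => H1.
have hm : 0 < (m.+1%:R^-1 : R) ^+ d by rewrite exprn_gt0// invr_gt0.
rewrite /= mulrA.
have -> : (2 * pi) ^+ d * S = (2 * (pi * m.+1%:R)) ^+ d * S * m.+1%:R^-1 ^+ d.
  by rewrite mulrAC -exprMn mulrA mulfK.
rewrite ler_pM2r//; apply: le_trans H1.
rewrite le_eqVlt; apply/orP; left; apply/eqP; congr (_ * _); apply: eq_bigr => t _.
by rewrite freq_lattice.
Unshelve. all: by end_near. Qed.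

Lemma volume_gt0 : 0 < volume Omega.
Proof.
rewrite /volume fine_gt0// open_lebesgue_rV_gt0//=.
exact: lebesgue_rV_bounded.
Qed.

End Kroger.

(** * Elementary inequalities for the conclusion *)

Section FinalInequality.
Context {R : realType}.

(** Induction from equality at [n = 0]: each step increases the right side minus the left by
    [(x - 1) (2 x^(n+2) - x - 1)], whose two factors have the same sign on either side of 1. *)
Lemma young_sqr (x : R) n : 0 <= x -> (n%:R + 2) * x ^+ 2 <= n%:R + 2 * x ^+ (n + 2).
Proof.
move=> x0; elim: n => [|n IHn]; first by rewrite !add0r add0n.
have H : 0 <= (x - 1) * (2 * x ^+ (n + 2) - x - 1).
  have [x1|/ltW x1] := leP 1 x.
    have : x <= x ^+ (n + 2) by rewrite -[leLHS]expr1 addn2 ler_weXn2l.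
    by move=> h; rewrite mulr_ge0//; lra.
  have h1 : x ^+ (n + 2) <= x by rewrite -[leRHS]expr1 addn2 ler_wiXn2l.
  by rewrite mulr_le0//; lra.
have -> : x ^+ (n.+1 + 2) = x * x ^+ (n + 2) by rewrite addSn exprS.
rewrite -natr1; move: IHn H; set X := x ^+ (n + 2); set N := n%:R; nra.
Qed.

(** The hypothesis reads [|sqrt x - sqrt m| <= sqrt m * sqrt (1 - s)]. As [s >= 0], the root of
    [1 - s] is at most 1, so the lower bound for [sqrt x] is nonnegative and may be squared. *)
Lemma sqr_sqrt_bounds (m x s : R) : 0 <= m -> 0 <= x -> 0 <= s ->
  (Num.sqrt x - Num.sqrt m) ^+ 2 <= m * (1 - s) ->
  m * (1 - Num.sqrt (1 - s)) ^+ 2 <= x /\ x <= m * (1 + Num.sqrt (1 - s)) ^+ 2.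
Proof.
move=> m0 x0 s0 H.
have [m00|m00] := eqVneq m 0.
  move: H; rewrite m00 sqrtr0 subr0 sqr_sqrtr// !mul0r => xle; split=> //.
have mp : 0 < m by rewrite lt_def m00.
have s1 : 0 <= 1 - s.
  by rewrite -(pmulr_rge0 _ mp); apply: le_trans H; exact: sqr_ge0.
set q := Num.sqrt (1 - s); have q0 : 0 <= q by exact: sqrtr_ge0.
have qq : q ^+ 2 = 1 - s by rewrite sqr_sqrtr.
have q1 : q <= 1 by rewrite -(@ler_pXn2r _ 2) ?nnegrE// qq expr1n; lra.
set u := Num.sqrt x in H *; set v := Num.sqrt m in H *.
have u0 : 0 <= u by exact: sqrtr_ge0.
have v0 : 0 <= v by exact: sqrtr_ge0.
have uu : u ^+ 2 = x by rewrite sqr_sqrtr.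
have vv : v ^+ 2 = m by rewrite sqr_sqrtr.
have : `|u - v| <= v * q.
  rewrite -(@ler_pXn2r _ 2) ?nnegrE ?mulr_ge0// real_normK ?num_real//.
  by rewrite exprMn vv qq.
rewrite ler_norml => /andP[h1 h2].
have w0 : 0 <= v * (1 - q) by rewrite mulr_ge0// subr_ge0.
have w1 : 0 <= v * (1 + q) by rewrite mulr_ge0// addr_ge0.
rewrite -uu -vv -!exprMn; split; rewrite ler_pXn2r ?nnegrE//.
  by rewrite mulrBr mulr1; lra.
by rewrite mulrDr mulr1; lra.
Qed.

End FinalInequality.

(** [t] is the Weyl radius: the ball of frequencies of radius [t] has phase-space volume
    [(2 pi)^d k] over Omega. Working with this fourth root of [m_k] turns the real powers into
    integer ones. *)
Lemma weyl_mE {R : realType} d (Omega : set 'rV[R]_d) k : (0 < d)%N ->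
  0 < volume Omega -> (0 < k)%N -> exists t : R,
  [/\ 0 < t, weyl_m Omega k = t ^+ 4 &
      volume Omega * unit_ball d * t ^+ d = (2 * pi) ^+ d * k%:R].
Proof.
move=> d0 V0 k0; have B0 := @unit_ball_gt0 R d.
have kR : 0 < k%:R :> R by rewrite ltr0n.
have d0R : d%:R != 0 :> R by rewrite pnatr_eq0 -lt0n.
have VB : 0 < k%:R / (volume Omega * unit_ball d) by rewrite divr_gt0// mulr_gt0.
have p0 : 0 < 2 * pi :> R by rewrite mulr_gt0 ?pi_gt0.
exists (2 * pi * (k%:R / (volume Omega * unit_ball d)) `^ d%:R^-1); split.
- by rewrite mulr_gt0 ?powR_gt0.
- rewrite /weyl_m /weyl_const -unit_ball_volume; set c := 2 * pi.
  rewrite [in LHS]exprMn [in RHS]exprMn -exprM -mulrA.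
  congr (_ * _); rewrite -!powR_mulrn ?powR_ge0// -!powRrM.
  rewrite (_ : k%:R / (_ * _) = (unit_ball d)^-1 * (k%:R / volume Omega)); last first.
    by rewrite invfM [LHS]mulrA [LHS]mulrC.
  rewrite [d%:R^-1 * 4]mulrC [in RHS]powRM ?invr_ge0 ?divr_ge0 ?ltW//; congr (_ * _).
  rewrite -[in RHS](@powR_inv1 R) ?ltW// -powRrM; congr (_ `^ _).
  by field.
- rewrite exprMn -[X in _ * (_ * X)]powR_mulrn ?powR_ge0// -powRrM mulVf//.
  rewrite powRr1 ?ltW//; field; rewrite gt_eqF//= gt_eqF//.
Qed.

Theorem theorem6p1 (R : realType) (d : nat) (Omega : set 'rV[R]_d) (a : R)
    (hd : (0 < d)%N)
    (hOmega : bounded_domain Omega)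
    (hbd : continuous_boundary Omega)
    (* -1/(d-1) reads as -oo when d = 1 *)
    (ha_lo : (1 < d)%N -> - (d%:R - 1)^-1 < a)
    (ha_hi : a < 1) :
  forall k : nat, (1 <= k)%N ->
    let M := neumann_eigenvalue Omega a in
    let m := weyl_m Omega k in
    let S := weyl_ratio Omega a k in
    (Num.sqrt (M k.+1) - Num.sqrt m) ^+ 2 <= m * (1 - S) /\
    (m * (1 - Num.sqrt (1 - S)) ^+ 2 <= M k.+1 /\
     M k.+1 <= m * (1 + Num.sqrt (1 - S)) ^+ 2).
Proof.
move=> k k1 M m S.
case: (hOmega) => neO oO _ bO.
have V0 := volume_gt0 oO bO neO.
have M0 j : (0 < j)%N -> 0 <= M j by exact: neumann_ge0.
have kR : 0 < k%:R :> R by rewrite ltr0n.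
have dR : 0 < d%:R :> R by rewrite ltr0n.
have [t [t0 mt tdE]] := @weyl_mE R d Omega k hd V0 k1.
have m0 : 0 < m by rewrite /m mt exprn_gt0.
pose A := \sum_(j < k) M j.+1.
have mS : m * S = (d%:R + 4) / d%:R * (k%:R^-1 * A).
  by rewrite /S /weyl_ratio big_add1 big_mkord -/m mulrC divfK// gt_eqF.
have A0 : 0 <= A by apply: sumr_ge0 => j _; exact: M0.
have c0 : 0 < (d%:R + 4) / d%:R :> R by rewrite divr_gt0// addr_gt0.
have S0 : 0 <= S.
  by rewrite -(pmulr_rge0 _ m0) mS mulr_ge0// ?mulr_ge0// ?invr_ge0 ltW.
suff H : (Num.sqrt (M k.+1) - Num.sqrt m) ^+ 2 <= m * (1 - S).
  by split=> //; apply: sqr_sqrt_bounds => //; [exact: ltW | exact: M0].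
have sm : Num.sqrt m = t ^+ 2.
  by rewrite /m mt -[4%N]/(2 * 2)%N exprM sqrtr_sqr ger0_norm// sqr_ge0.
have Mle (j : 'I_k) : M j.+1 <= M k.+1 by exact: neumann_mono (leqW (ltn_ord j)).
rewrite mulrBr mulr1 mS.
(* The fourth root [b] below must be positive. If [M k.+1 = 0], all earlier eigenvalues are 0 as
   well and the claim is an equality. *)
have [z0|] := eqVneq (M k.+1) 0.
  have -> : A = 0.
    apply/eqP; rewrite eq_le A0 andbT; apply: sumr_le0 => j _.
    by rewrite (le_trans (Mle j))// z0.
  by rewrite z0 sqrtr0 add0r sqrrN sqr_sqrtr ?(ltW m0)// !mulr0 subr0.
move=> z0; have {}z0 : 0 < M k.+1 by rewrite lt_def z0 M0.
pose b := Num.sqrt (Num.sqrt (M k.+1)).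
have b0 : 0 < b by rewrite !sqrtr_gt0.
have b2 : Num.sqrt (M k.+1) = b ^+ 2 by rewrite sqr_sqrtr// sqrtr_ge0.
have b4 : M k.+1 = b ^+ 4.
  by rewrite -[4%N]/(2 * 2)%N exprM -b2 sqr_sqrtr// ltW.
rewrite b2 sm /m mt.
have VB : 0 < volume Omega * unit_ball d by rewrite mulr_gt0// unit_ball_gt0.
have td : 0 < t ^+ d by rewrite exprn_gt0.
pose x := b / t.
have bE : b = x * t by rewrite divfK// gt_eqF.
have x0 : 0 < x by rewrite divr_gt0.
have D4 : d%:R + 4 != 0 :> R by rewrite gt_eqF// addr_gt0.
(* This is [kroger_bound] with [(2 pi)^d k] rewritten as [volume Omega * unit_ball d * t^d], which
   then cancels and leaves only the ratio [x = b / t]. *)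
have avg : k%:R^-1 * A <= b ^+ 4 - 4 / (d%:R + 4) * x ^+ d * b ^+ 4.
  have := kroger_bound hd oO bO neO ha_hi ha_lo b0 b4.
  rewrite sumrB sumr_const card_ord -/A -/M b4.
  rewrite -(ler_pM2r kR) [leRHS]mulrAC -tdE.
  rewrite [X in X <= _](_ : _ = volume Omega * unit_ball d * t ^+ d *
    (k%:R * (4 / (d%:R + 4) * x ^+ d * b ^+ 4))); last first.
    by rewrite exprD {1}bE exprMn; ring.
  rewrite ler_pM2l ?mulr_gt0 ?unit_ball_gt0// => H.
  by rewrite mulrC ler_pdivrMr// mulrC mulrBr mulr_natl; lra.
apply: (@le_trans _ _ (t ^+ 4 - (d%:R + 4) / d%:R *
    (b ^+ 4 - 4 / (d%:R + 4) * x ^+ d * b ^+ 4))); last first.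
  by rewrite lerD2l lerN2 ler_pM2l.
rewrite -subr_ge0 {avg}.
(* In terms of [x] the powers of [t] factor out, and what remains is exactly the gap in [young_sqr]
   with [n = d]. *)
rewrite [leRHS](_ : _ = 2 / d%:R * (t ^+ 4 * x ^+ 2) *
    (d%:R + 2 * x ^+ (d + 2) - (d%:R + 2) * x ^+ 2)); last first.
  by rewrite exprD bE; field; rewrite D4 gt_eqF.
rewrite mulr_ge0//; first by rewrite ltW// mulr_gt0 ?divr_gt0// mulr_gt0 ?exprn_gt0.
by rewrite subr_ge0 young_sqr// ltW.
Qed.
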